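(* Let $\alpha$, $\beta$ and $\gamma$ be nonconstant inner functions and let $k$, $m$ be two fixed positive integers such that $k\leq\dim K_\alpha$ and $m\leq\dim K_\beta$. Assume that $A=U_{\overline{\varphi}_-+\varphi_+}^{\beta,\gamma}\in\mathcal{S}_m(\beta,\gamma)$ for some $\varphi_-\in K_\beta$, $\varphi_+\in zK_{W^*_m\gamma}$, and $B=U_{\overline{\psi}_-+\psi_+}^{\alpha,\beta}\in\mathcal{S}_k(\alpha,\beta)$ for some $\psi_-\in K_\alpha$, $\psi_+\in zK_{W^*_k\beta}$. Then $AB\in\mathcal{S}_{km}(\alpha,\gamma)$ if and only if there exist $\tau_p\in K_\gamma$, $p=0,1,\ldots,km-1$, and $\upsilon\in K_\alpha$ such that \begin{align*} &\sum_{n=0}^{m-1}\tfrac1{n!}(Ak_{0,n}^\beta)\otimes(S_\alpha^{kn}\psi_-)-\sum_{j=0}^{m-1}\left(\tfrac{1}{j!}\right)^2(S_\gamma A\widetilde{k}_{0,j}^\beta)\otimes(S_\alpha^{km}B^*\widetilde{k}_{0,j}^\beta)\\ &\quad+\sum_{j=0}^{m-1}\tfrac{1}{j!}(S_\gamma P_\gamma W_m(\overline{z}^{m-j}\varphi_+))\otimes\left(B^*k_{0,j}^\beta-\sum_{n=0}^{m-1}\langle S_\beta^{n}k_0^\beta,k_{0,j}^\beta\rangle\,S_\alpha^{kn}\psi_-\right)\\ &=k_0^\gamma\otimes\upsilon+\sum_{p=0}^{km-1}\tau_p\otimes k_{0,p}^\alpha. \end{align*} In that case $AB=U_{\xi}^{\alpha,\gamma}$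 (as an operator of order $km$) with \begin{align*} \xi=\ &\overline{\upsilon}+\overline{B^*\varphi_-}-\sum_{n=0}^{m-1}\langle S_\beta^{n}k_0^\beta,\varphi_-\rangle\,\overline{S_\alpha^{kn}\psi_-}-\sum_{n=0}^{m-1}\sum_{l=0}^{k-1}\frac{1}{l!}\langle S_\beta^{n+1}P_\beta W_k(\overline{z}^{k-l}\psi_+),\varphi_-\rangle\,\overline{S_\alpha^{kn}k_{0,l}^\alpha}\\ &+\sum_{p=0}^{km-1}(W_{km}^*\tau_{p})\,p!\,\overline{z}^p+\sum_{p=0}^{km-1}\sum_{n=0}^{m-1}\left(W_{km}^*AS_\beta^{n+1}P_\beta W_k(\overline{z}^{k(n+1)-p}\psi_+)\right)\overline{z}^p\\ &-\sum_{p=0}^{km-1}\sum_{n=0}^{m-1}\left(\sum_{j=0}^{m-1}\tfrac{1}{j!}\langle S_\beta^{n+1}P_\beta W_k(\overline{z}^{k(n+1)-p}\psi_+),k_{0,j}^\beta\rangle\,S_\gamma P_\gamma W_m(\overline{z}^{m-j}\varphi_+)\right)\overline{z}^p. \end{align*}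
   Context: $L^2$ is the space of square-integrable functions on the unit circle $\mathbb{T}$ with respect to normalized Lebesgue measure, and $L^\infty$ is the corresponding space of essentially bounded functions; $H^2\subset L^2$ is the Hardy space of the unit disk and $H^\infty=H^2\cap L^\infty$. An inner function is $\alpha\in H^\infty$ with $|\alpha|=1$ a.e. on $\mathbb{T}$; $K_\alpha=H^2\ominus\alpha H^2$, $P_\alpha$ is the orthogonal projection of $L^2$ onto $K_\alpha$, $K_\alpha^\infty=K_\alpha\cap H^\infty$ (dense in $K_\alpha$), and $S_\alpha f=P_\alpha(zf)$, $f\in K_\alpha$, is the compressed shift. $C_\alpha f=\alpha\overline{z}\,\overline{f}$ is the conjugation on $L^2$ preserving $K_\alpha$. For $j\ge0$: $k_{0,j}^\alpha=P_\alpha(j!z^j)$ (so $f^{(j)}(0)=\langle f,k_{0,j}^\alpha\rangle$ for $f\in K_\alpha$), $k_0^\alpha=k_{0,0}^\alpha$, $\widetilde{k}_{0,j}^\alpha=C_\alpha k_{0,j}^\alpha$. Rank-one operators: $(f\otimes g)h=\langle h,g\rangle f$. For a positive integer $N$, $W_N:L^2\to L^2$ is the bounded linear operator with $W_N(z^n)=z^{n/N}$ if $N\mid n$ and $W_N(z^n)=0$ otherwise ($n\in\mathbb{Z}$); its adjoint is $W_N^*g(z)=g(z^N)$. For inner $\alpha,\beta$ and $\varphi\in L^2$, the order-$N$ operator $U_\varphi^{\alpha,\beta}$ is $U_\varphi^{\alpha,\beta}f=P_\beta W_N(\varphi f)$, $f\in K_\alpha^\infty$. $\mathcal{S}_N(\alpha,\beta)$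 is the set of all order-$N$ operators $U_\varphi^{\alpha,\beta}$, $\varphi\in L^2$, that extend boundedly to $K_\alpha$ (identified with their bounded extensions). The order of an operator $U_\varphi^{\alpha,\beta}$ is the index of the class $\mathcal{S}_N$ in which it is considered: here $A$ has order $m$ and $B$ has order $k$.
   Formalization: Three misprints corrected: the scalar ⟨S_β^n k_0,k_{0,j}⟩ in the operator identity is conjugated; in the last two double sums of ξ, p runs only over kn ≤ p < k(n+1); and the last sum of ξ carries the factor W_{km}^*. *)

(* Defs.v *)
From HB Require Import structures.
From mathcomp Require Import all_boot all_order all_algebra complex.
From mathcomp Require Import all_classical all_reals all_analysis.

Set Implicit Arguments.
Unset Strict Implicit.
Unset Printing Implicit Defensive.

Import Order.TTheory GRing.Theory Num.Theory.

Local Open Scope classical_set_scope.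
Local Open Scope ring_scope.

(* Functions on the unit circle are represented by functions f : R[i] -> R[i],
   of which only the values at the points circle_pt t, 0 <= t <= 1, matter.
   The library's pointwise ring and module structures on function spaces give
   f + g, f * g, a *: f and, for operators, A + B and a *: A. *)
Notation cfun R := (R[i] -> R[i]).
Notation cop R := (cfun R -> cfun R).

(** * Normalized Lebesgue measure on the circle, L^2 and L^oo *)

Definition I01 (R : realType) : set R := `[0 : R, 1 : R]%classic.

Definition circle_pt (R : realType) (t : R) : R[i] :=
  Complex (cos (2 * pi * t)) (sin (2 * pi * t)).

Definition aeT (R : realType) (Q : R[i] -> Prop) : Prop :=
  {ae @lebesgue_measure R, forall t, I01 t -> Q (circle_pt t)}.

Definition eqT (R : realType) (f g : cfun R) : Prop := aeT (fun z => f z = g z).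
Notation "f =T g" := (eqT f g) (at level 70, no associativity).

Definition measurableT (R : realType) (f : cfun R) : Prop :=
  measurable_fun (@I01 R) (fun t : R => complex.Re (f (circle_pt t))) /\
  measurable_fun (@I01 R) (fun t : R => complex.Im (f (circle_pt t))).

Definition integralT (R : realType) (f : cfun R) : R[i] :=
  Complex
    (\int[@lebesgue_measure R]_(t in @I01 R) complex.Re (f (circle_pt t)))
    (\int[@lebesgue_measure R]_(t in @I01 R) complex.Im (f (circle_pt t))).

(* Elements of L^2 are functions, not classes: every statement about them is
   up to =T.  Measurability is Borel measurability, so that =T is only
   compatible with membership between measurable functions; every class of
   Lebesgue measurable functions has a Borel representative. *)
Definition L2 (R : realType) : set (cfun R) := [set f | measurableT f /\
  (\int[@lebesgue_measure R]_(t in @I01 R)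
     (Normc.normc (f (circle_pt t)) ^+ 2)%:E < +oo)%E].

Definition Linfty (R : realType) : set (cfun R) := [set f | measurableT f /\
  exists M : R, aeT (fun z => Normc.normc (f z) <= M)].

Definition conjf (R : realType) (f : cfun R) : cfun R := fun z => conjc (f z).

Definition ip (R : realType) (f g : cfun R) : R[i] := integralT (f * conjf g).

Definition norm2 (R : realType) (f : cfun R) : R :=
  Num.sqrt (complex.Re (ip f f)).

Definition zpow (R : realType) (n : int) : cfun R := fun z => z ^ n.
Definition idz (R : realType) : cfun R := fun z => z.
Definition zbar (R : realType) : cfun R := fun z => conjc z.

(** * Operators between subspaces of L^2 *)

Definition bounded_op (R : realType) (M N : set (cfun R)) (T : cop R) : Prop :=
  [/\ forall f, M f -> N (T f),
      forall (a : R[i]) f g, M f -> M g -> T (a *: f + g) =T a *: T f + T g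
    & exists c : R, forall f, M f -> norm2 (T f) <= c * norm2 f].

(* adjoint of T : M -> N with respect to the inner products of M and N *)
Definition adj (R : realType) (M : set (cfun R)) (T : cop R) : cop R :=
  fun g => xget 0 [set h | M h /\ forall f, M f -> ip (T f) g = ip f h].

Definition rank1 (R : realType) (f g : cfun R) : cop R := fun h => ip h g *: f.

(* n <= dim M, where M may be infinite dimensional *)
Definition dim_geq (R : realType) (M : set (cfun R)) (n : nat) : Prop :=
  exists e : 'I_n -> cfun R, (forall i, M (e i)) /\
    forall c : 'I_n -> R[i],
      \sum_(i < n) c i *: e i =T (0 : cfun R) -> forall i, c i = 0.

(** * Hardy spaces, inner functions and model spaces *)

(* boundary functions: the Fourier coefficients of negative index vanish *)
Definition H2 (R : realType) : set (cfun R) :=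
  [set f | L2 f /\ forall n : nat, ip f (zpow (- n.+1%:Z)) = 0].

Definition Hinfty (R : realType) : set (cfun R) := @H2 R `&` @Linfty R.

Definition inner (R : realType) (alpha : cfun R) : Prop :=
  Hinfty alpha /\ aeT (fun z => Normc.normc (alpha z) = 1).

Definition nonconstant (R : realType) (alpha : cfun R) : Prop :=
  ~ exists c : R[i], alpha =T cst c.

Definition Ksp (R : realType) (alpha : cfun R) : set (cfun R) :=
  [set f | H2 f /\ forall h, H2 h -> ip f (alpha * h) = 0].

Definition Kinfty (R : realType) (alpha : cfun R) : set (cfun R) :=
  Ksp alpha `&` @Hinfty R.

Definition zK (R : realType) (alpha : cfun R) : set (cfun R) :=
  [set f | L2 f /\ exists2 h, Ksp alpha h & f =T @idz R * h].

(* Ksp alpha, PK alpha, SK alpha are K_alpha, P_alpha, S_alpha; PK alpha f is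
   the element of K_alpha with f - PK alpha f orthogonal to K_alpha. *)
Definition PK (R : realType) (alpha : cfun R) : cop R := fun f =>
  xget 0 [set g | Ksp alpha g /\ forall h, Ksp alpha h -> ip (f - g) h = 0].

Definition SK (R : realType) (alpha : cfun R) : cop R :=
  fun f => PK alpha (@idz R * f).

Definition Cconj (R : realType) (alpha : cfun R) : cop R :=
  fun f => alpha * @zbar R * conjf f.

Definition k0 (R : realType) (alpha : cfun R) (j : nat) : cfun R :=
  PK alpha (j`!%:R *: zpow j%:Z).

Definition k0t (R : realType) (alpha : cfun R) (j : nat) : cfun R :=
  Cconj alpha (k0 alpha j).

(** * The operators W_N and the operators of order N *)

Definition is_W (R : realType) (N : nat) (T : cop R) : Prop :=
  bounded_op (@L2 R) (@L2 R) T /\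
  forall n : int, T (zpow n) =T
    if (N%:Z %| n)%Z then zpow (n %/ N%:Z)%Z else 0.

Definition W (R : realType) (N : nat) : cop R := xget (0 : cop R) [set T | is_W N T].

Definition Wstar (R : realType) (N : nat) (g : cfun R) : cfun R :=
  fun z => g (z ^+ N).

(* A is the bounded extension to Ksp alpha of f |-> P_beta W_N (phi f) *)
Definition isU (R : realType) (N : nat) (alpha beta phi : cfun R) (A : cop R)
    : Prop :=
  [/\ L2 phi, bounded_op (Ksp alpha) (Ksp beta) A
    & forall f, Kinfty alpha f -> A f =T PK beta (W N (phi * f))].

Definition Scal (R : realType) (N : nat) (alpha beta : cfun R) : set (cop R) :=
  [set A | exists phi, isU N alpha beta phi A].

(** * The operator identity and the symbol of the product *)

(* The published identity has <S_beta^n k_0, k_{0,j}> where conjc (ip _ _)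
   stands here.  The conjugate is needed because the second slot of rank1 is
   conjugate-linear: (T (x) k_{0,j}) (S_beta^n k_0 (x) g) is T (x) (c g) with
   c = conj <S_beta^n k_0, k_{0,j}>. *)
Definition product_lhs (R : realType) (alpha beta gamma : cfun R) (k m : nat)
    (phip psim : cfun R) (A B : cop R) : cop R :=
  let Bstar := adj (Ksp alpha) B in
  \sum_(n < m) n`!%:R^-1 *:
      rank1 (A (k0 beta n)) (iter (k * n) (SK alpha) psim)
  - \sum_(j < m) (j`!%:R^-1) ^+ 2 *:
      rank1 (SK gamma (A (k0t beta j)))
            (iter (k * m) (SK alpha) (Bstar (k0t beta j)))
  + \sum_(j < m) j`!%:R^-1 *:
      rank1 (SK gamma (PK gamma (W m (@zbar R ^+ (m - j) * phip))))
            (Bstar (k0 beta j)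
             - \sum_(n < m) conjc (ip (iter n (SK beta) (k0 beta 0)) (k0 beta j))
                 *: iter (k * n) (SK alpha) psim).

Definition product_rhs (R : realType) (alpha gamma : cfun R) (N : nat)
    (tau : 'I_N -> cfun R) (upsilon : cfun R) : cop R :=
  rank1 (k0 gamma 0) upsilon + \sum_(p < N) rank1 (tau p) (k0 alpha p).

(* A term T (x) k_{0,p} of the operator identity contributes
   p! W_{km}^* T zbar^p to the symbol.  The last two sums come from terms
   T (x) (1/l! S_alpha^{kn} k_{0,l}) with l < k, which is T (x) (1/p! k_{0,p})
   for p = k n + l; hence the range of p and the factor W_{km}^* in both of
   them.  The published symbol lets p run over all of 0, ..., km-1 for every n
   and has no W_{km}^* in the last sum; with either of these A B is in general
   not the operator with that symbol. *)
Definition product_symbol (R : realType) (alpha beta gamma : cfun R)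
    (k m : nat) (phim phip psim psip : cfun R) (A B : cop R)
    (tau : 'I_(k * m) -> cfun R) (upsilon : cfun R) : cfun R :=
  let Bstar := adj (Ksp alpha) B in
  let G n i := iter n.+1 (SK beta) (PK beta (W k (@zbar R ^+ i * psip))) in
  conjf upsilon + conjf (Bstar phim)
  - \sum_(n < m) ip (iter n (SK beta) (k0 beta 0)) phim
      *: conjf (iter (k * n) (SK alpha) psim)
  - \sum_(n < m) \sum_(l < k) (l`!%:R^-1 * ip (G n (k - l)%N) phim)
      *: conjf (iter (k * n) (SK alpha) (k0 alpha l))
  + \sum_(p < k * m) p`!%:R *: (Wstar (k * m) (tau p) * @zbar R ^+ p)
  + \sum_(n < m) \sum_(k * n <= p < k * n.+1)
      Wstar (k * m) (A (G n (k * n.+1 - p)%N)) * @zbar R ^+ p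
  - \sum_(n < m) \sum_(k * n <= p < k * n.+1)
      Wstar (k * m)
        (\sum_(j < m) (j`!%:R^-1 * ip (G n (k * n.+1 - p)%N) (k0 beta j))
           *: SK gamma (PK gamma (W m (@zbar R ^+ (m - j) * phip))))
      * @zbar R ^+ p.

(* Main.v *)
From HB Require Import structures.
From mathcomp Require Import all_boot all_order all_algebra complex.
From mathcomp Require Import all_classical all_reals all_analysis measurable_realfun.
From mathcomp Require Import ring lra.
Require Import Defs.

Set Implicit Arguments.
Unset Strict Implicit.
Unset Printing Implicit Defensive.

Import Order.TTheory GRing.Theory Num.Theory.
Import numFieldNormedType.Exports.

Local Open Scope classical_set_scope.
Local Open Scope ring_scope.

(** A bounded T : K_a -> K_b is an operator of order N if and only if, with S^*
    the backward shift,
      <T f, h> - <T S^{*N} f, S^* h>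
        = <f, u> conj(h_0) + sum_{p < N} p! f_p <t_p, h>
    for some u in K_a and t_p in K_b, and then conj(u) + sum_p p! W_N^* t_p zbar^p
    is a symbol of T.  For a given symbol the left-hand side only sees the
    negative part of the symbol and its N positive sections.  Conversely,
    iterating the equation M times leaves the remainder <T S^{*NM} f, S^{*M} h>,
    which tends to 0, and the sum of the other terms converges to the pairing
    given by the symbol.

    For the product A B the equation of A is used at B f, where S^{*m} B f
    is paired with A^* S^* h, and the equation of B is iterated m times.  Since
    S_beta is an isometry up to a rank-one term in K_beta, with
      <S^m y, S^m g> = <y, g> - sum_{j < m} (1/j!)^2 <y, kt_j> <kt_j, g>,
    the left-hand side of the equation for A B is the finite rank operator of
    the theorem plus terms that already have the required form (remainder_upsilon
    and remainder_tau). *)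

(** A symbol gives the values of its operator on bounded [f] only, because [phi * f] need not be
    square integrable otherwise. The equation is therefore first checked for bounded [f]; it extends
    to [Ksp a] because the difference of its sides is a bounded functional that vanishes on the
    functions [PK a (zpow j)], which are bounded and total. In the converse both slots are tested on
    bounded functions, since [conjf upsilon * f] and [conjf (tau p) * g] must be in L^2. In the
    product, the number of iterations of the equation of [B] is dictated by [A]: with
    [g = S^m A^* S^* h], exactly [m] iterations pair [S^m B S^{*km} f] with [g]. Removing the common
    [S^m] leaves the pairing of [A B S^{*km} f] with [S^* h], which is the second term of the
    equation of order [k * m]; what is lost in removing it is the second sum of the identity.
    Projections, adjoints and [W] are selected by a property, so each must be shown to exist. This
    is the purpose of the completeness of L^2, of the totality of the powers of z and of the Riesz
    representation. *)

Section circle.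
Context {R : realType}.
Local Notation mu := (@lebesgue_measure R).
Local Notation I := (@I01 R).
Local Notation c := (@circle_pt R).
Implicit Types f g h : cfun R.

(** * Measurable and square integrable functions on the circle *)

Definition reT f : R -> R := fun t => complex.Re (f (c t)).
Definition imT f : R -> R := fun t => complex.Im (f (c t)).
Definition sqT f : R -> R := fun t => Normc.normc (f (c t)) ^+ 2.

Lemma sqTE f t : sqT f t = reT f t ^+ 2 + imT f t ^+ 2.
Proof.
rewrite /sqT /reT /imT; case: (f (c t)) => a b /=.
by rewrite sqr_sqrtr// addr_ge0// sqr_ge0.
Qed.

Lemma sqT_ge0 f t : 0 <= sqT f t.
Proof. exact: sqr_ge0. Qed.

Lemma measurable_I : measurable I.
Proof. exact: measurable_itv. Qed.
Lemma measurable_Ig : (measurable : set (set (measurableTypeR R))) I.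
Proof. exact: measurable_itv. Qed.
Hint Resolve measurable_I measurable_Ig : core.

Lemma mu_I : mu I = 1%E.
Proof. by rewrite lebesgue_measure_itv/= lte_fin ltr01 oppr0 adde0. Qed.

Lemma circle_ptM t : c t * conjc (c t) = 1.
Proof.
apply/eqP; rewrite eq_complex /= /circle_pt /=.
have := cos2Dsin2 (2 * pi * t) => h.
by apply/andP; split; apply/eqP; [rewrite -[RHS]h|]; ring.
Qed.

Lemma circle_pt_neq0 t : c t != 0.
Proof.
apply/eqP => h; have := circle_ptM t; rewrite h mul0r => /esym/eqP.
by rewrite oner_eq0.
Qed.

Lemma circle_pt_conj t : conjc (c t) = (c t)^-1.
Proof. by apply: (mulfI (circle_pt_neq0 t)); rewrite circle_ptM mulfV// circle_pt_neq0. Qed.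

Lemma circle_ptD s t : c (s + t) = c s * c t.
Proof.
rewrite /circle_pt mulrDr cosD sinD.
by apply/eqP; rewrite eq_complex/=; apply/andP; split=> //; apply/eqP; ring.
Qed.

Lemma circle_ptN t : c (- t) = (c t)^-1.
Proof.
by rewrite -circle_pt_conj /circle_pt mulrN cosN sinN.
Qed.

Lemma circle_pt0 : c 0 = 1.
Proof. by rewrite /circle_pt mulr0 cos0 sin0. Qed.

Lemma circle_ptX n t : c t ^+ n = c (n%:R * t).
Proof.
elim: n => [|n IH]; first by rewrite expr0 mul0r circle_pt0.
by rewrite exprS IH -circle_ptD mulrS mulrDl mul1r.
Qed.

Lemma circle_ptXz (n : int) t : c t ^ n = c (n%:~R * t).
Proof.
case: n => n; first by rewrite -exprnP circle_ptX.
by rewrite NegzE -exprnN circle_ptX mulrNz mulNr circle_ptN.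
Qed.

Lemma circle_pt1 : c 1 = 1.
Proof.
by rewrite /circle_pt mulr1 mulrDl mul1r cosDpi sinDpi cospi sinpi opprK oppr0.
Qed.

Lemma circle_pt_nat n : c n%:R = 1.
Proof. by rewrite -[n%:R]mulr1 -circle_ptX circle_pt1 expr1n. Qed.

Lemma measurable_cos_lin (a : R) : measurable_fun I (fun t => cos (2 * pi * (a * t))).
Proof.
apply: measurable_funTS; apply: continuous_measurable_fun => x.
apply: continuous_comp; last exact: continuous_cos.
by apply: cvgMr; apply: cvgMr; exact: cvg_id.
Qed.

Lemma measurable_sin_lin (a : R) : measurable_fun I (fun t => sin (2 * pi * (a * t))).
Proof.
apply: measurable_funTS; apply: continuous_measurable_fun => x.
apply: continuous_comp; last exact: continuous_sin.
by apply: cvgMr; apply: cvgMr; exact: cvg_id.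
Qed.

Lemma measurableT_zpow (n : int) : measurableT (@zpow R n).
Proof.
split.
- rewrite [X in measurable_fun _ X](_ : _ = fun t => cos (2 * pi * (n%:~R * t))); first exact: measurable_cos_lin.
  by apply/funext => t; rewrite /zpow circle_ptXz.
- rewrite [X in measurable_fun _ X](_ : _ = fun t => sin (2 * pi * (n%:~R * t))); first exact: measurable_sin_lin.
  by apply/funext => t; rewrite /zpow circle_ptXz.
Qed.

Lemma measurableT_cst a : measurableT (cst a : cfun R).
Proof. by split; exact: measurable_cst. Qed.

Lemma measurableTD f g : measurableT f -> measurableT g -> measurableT (f + g).
Proof.
move=> [f1 f2] [g1 g2]; split.
- rewrite [X in measurable_fun _ X](_ : _ = reT f \+ reT g); first exact: measurable_funD.
  by apply/funext => t; rewrite /reT /=; change ((f + g) (c t)) with (f (c t) + g (c t)); case: (f _) (g _) => [? ?] [].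
- rewrite [X in measurable_fun _ X](_ : _ = imT f \+ imT g); first exact: measurable_funD.
  by apply/funext => t; rewrite /imT /=; change ((f + g) (c t)) with (f (c t) + g (c t)); case: (f _) (g _) => [? ?] [].
Qed.

Lemma measurableTM f g : measurableT f -> measurableT g -> measurableT (f * g).
Proof.
move=> [f1 f2] [g1 g2]; split.
- rewrite [X in measurable_fun _ X](_ : _ = (reT f \* reT g) \- (imT f \* imT g)).
    by apply: measurable_funB; exact: measurable_funM.
  by apply/funext => t; rewrite /reT /imT /=; change ((f * g) (c t)) with (f (c t) * g (c t)); case: (f _) (g _) => [? ?] [].
- rewrite [X in measurable_fun _ X](_ : _ = (reT f \* imT g) \+ (imT f \* reT g)).
    by apply: measurable_funD; exact: measurable_funM.
  by apply/funext => t; rewrite /reT /imT /=; change ((f * g) (c t)) with (f (c t) * g (c t)); case: (f _) (g _) => [? ?] [].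
Qed.

Lemma measurableT_conj f : measurableT f -> measurableT (conjf f).
Proof.
move=> [f1 f2]; split.
- rewrite [X in measurable_fun _ X](_ : _ = reT f) //.
  by apply/funext => t; rewrite /reT /conjf; case: (f _).
- rewrite [X in measurable_fun _ X](_ : _ = \- imT f); first exact: measurable_funN.
  by apply/funext => t; rewrite /imT /conjf /=; case: (f _).
Qed.

Lemma measurable_sqT f : measurableT f -> measurable_fun I (sqT f).
Proof.
move=> [f1 f2].
rewrite [X in measurable_fun _ X](_ : _ = fun t => reT f t ^+ 2 + imT f t ^+ 2); last first.
  by apply/funext => t; rewrite sqTE.
by apply: measurable_funD; exact: measurable_funX.
Qed.

Definition L1 f := mu.-integrable I (EFin \o reT f) /\ mu.-integrable I (EFin \o imT f).

Lemma L2P f : L2 f <-> measurableT f /\ mu.-integrable I (EFin \o sqT f).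
Proof.
split=> -[mf]; last first.
  case/integrableP => _; under eq_integral do rewrite /= ger0_norm ?sqT_ge0//.
  by [].
move=> h; split=> //; apply/integrableP; split.
  by apply/measurable_EFinP; exact: measurable_sqT.
by under eq_integral do rewrite /= ger0_norm ?sqT_ge0//.
Qed.

(** The closure properties of [L2] that follow all reduce to a pointwise bound by two members, with
    [h = 0] when one of them suffices. *)
Lemma L2_le (M : R) f g h : measurableT f -> L2 g -> L2 h ->
  (aeT (fun z => Normc.normc (f z) ^+ 2 <= M * (Normc.normc (g z) ^+ 2 + Normc.normc (h z) ^+ 2))) -> L2 f.
Proof.
move=> mf Lg Lh ae; split => //.
have [mg ig] := (L2P g).1 Lg; have [mh ih] := (L2P h).1 Lh.
have ik : mu.-integrable I (fun t => M%:E * ((EFin \o sqT g) t + (EFin \o sqT h) t))%E.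
  by apply: integrableZl => //; exact: integrableD.
apply: le_lt_trans; last by have /integrableP[_] := ik; exact.
apply: ae_ge0_le_integral => //.
- by move=> t _; rewrite lee_fin sqr_ge0.
- by apply/measurable_EFinP; exact: measurable_sqT.
- by have /integrableP[mk _] := ik; exact: (measurableT_comp _ mk).
- apply: (@filterS _ _ (ae_filter_ringOfSetsType mu)) ae => t /= ae It; have := ae It => le1.
  by rewrite lee_fin; apply: le_trans le1 _; exact: ler_norm.
Qed.

Lemma normc_sqr (x : R[i]) : Normc.normc x ^+ 2 = complex.Re x ^+ 2 + complex.Im x ^+ 2.
Proof. by case: x => a b /=; rewrite sqr_sqrtr// addr_ge0// sqr_ge0. Qed.

Lemma normc_conj (x : R[i]) : Normc.normc (conjc x) = Normc.normc x.
Proof. by case: x => a b /=; rewrite sqrrN. Qed.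

Lemma normc_ge0 (x : R[i]) : 0 <= Normc.normc x.
Proof. by case: x => a b /=; exact: sqrtr_ge0. Qed.

Lemma L2_meas f : L2 f -> measurableT f. Proof. by case. Qed.

Lemma aeTW (Q : R[i] -> Prop) : (forall t, Q (c t)) -> aeT Q.
Proof. by move=> h; exact: aeW. Qed.

Lemma aeT_imp (Q Q' : R[i] -> Prop) :
  (forall t, Q (c t) -> Q' (c t)) -> aeT Q -> aeT Q'.
Proof.
move=> h; apply: (@filterS _ _ (ae_filter_ringOfSetsType mu)) => t q It.
by apply: h; exact: q.
Qed.

Lemma aeT_imp2 (P Q Q' : R[i] -> Prop) :
  (forall t, P (c t) -> Q (c t) -> Q' (c t)) -> aeT P -> aeT Q -> aeT Q'.
Proof.
move=> h; apply: (@filterS2 _ _ (ae_filter_ringOfSetsType mu)) => t p q It.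
by apply: h; [exact: p|exact: q].
Qed.

Lemma L2D f g : L2 f -> L2 g -> L2 (f + g).
Proof.
move=> Lf Lg; apply: (@L2_le 2 _ f g) => //.
  by apply: measurableTD; exact: L2_meas.
apply: aeTW => t; change ((f + g) (c t)) with (f (c t) + g (c t)).
rewrite !normc_sqr; case: (f (c t)) (g (c t)) => [x y] [x' y'] /=.
by have := sqr_ge0 (x - x'); have := sqr_ge0 (y - y'); lra.
Qed.

Lemma L2_cst a : L2 (cst a : cfun R).
Proof.
split; first exact: measurableT_cst.
by have /= -> := integral_cst mu measurable_I (Normc.normc a ^+ 2)%:E; rewrite mu_I mule1 ltry.
Qed.

Lemma L2_0 : L2 (0 : cfun R). Proof. exact: L2_cst. Qed.

Lemma L2M f g : measurableT f -> (exists M, aeT (fun z => Normc.normc (f z) <= M)) -> L2 g -> L2 (f * g).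
Proof.
move=> mf [M ae] Lg; apply: (@L2_le (M ^+ 2) _ g 0) => //; first exact: measurableTM mf (L2_meas Lg).
  exact: L2_0.
apply: aeT_imp ae => t le1.
change ((f * g) (c t)) with (f (c t) * g (c t)); change ((0 : cfun R) (c t)) with (0 : R[i]).
rewrite Normc.normcM Normc.normc0 expr0n addr0 exprMn ler_wpM2r ?sqr_ge0//.
by rewrite ler_sqr ?nnegrE ?normc_ge0// (le_trans _ le1) ?normc_ge0.
Qed.

Lemma L2Z a f : L2 f -> L2 (a *: f).
Proof.
move=> Lf; have -> : a *: f = (cst a : cfun R) * f by [].
apply: L2M Lf; first exact: measurableT_cst.
by exists (Normc.normc a); exact: aeTW.
Qed.

Lemma L2N f : L2 f -> L2 (- f).
Proof. by rewrite -scaleN1r; exact: L2Z. Qed.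

Lemma L2B f g : L2 f -> L2 g -> L2 (f - g).
Proof. by move=> Lf Lg; apply: L2D => //; exact: L2N. Qed.

Lemma L2_sum (J : Type) (r : seq J) (P : pred J) (F : J -> cfun R) :
  (forall i, P i -> L2 (F i)) -> L2 (\sum_(i <- r | P i) F i).
Proof. by move=> h; elim/big_ind: _ => //; [exact: L2_0|move=> ? ?; exact: L2D]. Qed.

Lemma L2_conj f : L2 f -> L2 (conjf f).
Proof.
move=> Lf; apply: (@L2_le 1 _ f 0) => //; first exact: measurableT_conj (L2_meas Lf).
  exact: L2_0.
by apply: aeTW => t; rewrite normc_conj Normc.normc0 expr0n addr0 mul1r.
Qed.

Lemma normc_circle t : Normc.normc (c t) = 1.
Proof. by rewrite /= cos2Dsin2 sqrtr1. Qed.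

Lemma normc_zpow (n : int) t : Normc.normc (zpow n (c t)) = 1.
Proof. by rewrite /zpow circle_ptXz normc_circle. Qed.

Lemma L2_zpowM n f : L2 f -> L2 (@zpow R n * f).
Proof.
move=> Lf; apply: L2M => //; first exact: measurableT_zpow.
by exists 1; apply: aeTW => t; rewrite normc_zpow.
Qed.

Lemma L2_eqc f g : (forall t, f (c t) = g (c t)) -> L2 f -> L2 g.
Proof.
move=> fg [[m1 m2] i]; split; first split.
- by under [X in measurable_fun _ X]eq_fun do rewrite -fg.
- by under [X in measurable_fun _ X]eq_fun do rewrite -fg.
- by under eq_integral do rewrite -fg.
Qed.

Lemma L2_zpow n : L2 (@zpow R n).
Proof. by rewrite -[zpow n]mulr1; apply: L2_zpowM; exact: L2_cst. Qed.

(** Both parts of the product are dominated by [|f|^2 + |g|^2], by the arithmetic-geometric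
    inequality. *)
Lemma L1M f g : L2 f -> L2 g -> L1 (f * g).
Proof.
move=> Lf Lg.
have [mf i1] := (L2P f).1 Lf; have [mg i2] := (L2P g).1 Lg.
have [m1 m2] := measurableTM mf mg.
have ik : mu.-integrable I ((EFin \o sqT f) \+ (EFin \o sqT g))%E by exact: integrableD.
split; apply: le_integrable ik => //; try exact/measurable_EFinP;
  move=> t _ /=; rewrite lee_fin [leRHS]ger0_norm ?addr_ge0 ?sqT_ge0// !sqTE /reT /imT;
  change ((f * g) (c t)) with (f (c t) * g (c t)); case: (f (c t)) (g (c t)) => [x y] [x' y'] /=;
  rewrite ler_norml.
- have := sqr_ge0 (x - x'); have := sqr_ge0 (y - y').
  have := sqr_ge0 (x + x'); have := sqr_ge0 (y + y').
  have := sqr_ge0 (y); have := sqr_ge0 (x); have := sqr_ge0 (y'); have := sqr_ge0 (x').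
  by move=> *; apply/andP; split; nra.
- have := sqr_ge0 (x - y'); have := sqr_ge0 (y - x').
  have := sqr_ge0 (x + y'); have := sqr_ge0 (y + x').
  have := sqr_ge0 (y); have := sqr_ge0 (x); have := sqr_ge0 (y'); have := sqr_ge0 (x').
  by move=> *; apply/andP; split; nra.
Qed.

End circle.

(** * The inner product, the Cauchy-Schwarz inequality and the L^2 norm *)

Section inner_product.
Context {R : realType}.
Local Notation mu := (@lebesgue_measure R).
Local Notation I := (@I01 R).
Local Notation c := (@circle_pt R).
Implicit Types f g h : cfun R.
Implicit Types a b : R[i].
#[local] Hint Extern 0 (measurable _) => solve [exact: measurable_I | exact: measurable_Ig] : core.
Local Notation Re := complex.Re.
Local Notation Im := complex.Im.

Lemma ReD (x y : R[i]) : Re (x + y) = Re x + Re y. Proof. by case: x; case: y. Qed.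
Lemma ImD (x y : R[i]) : Im (x + y) = Im x + Im y. Proof. by case: x; case: y. Qed.
Lemma ReM (x y : R[i]) : Re (x * y) = Re x * Re y - Im x * Im y. Proof. by case: x; case: y. Qed.
Lemma ImM (x y : R[i]) : Im (x * y) = Re x * Im y + Im x * Re y. Proof. by case: x; case: y. Qed.
Lemma ReN (x : R[i]) : Re (- x) = - Re x. Proof. by case: x. Qed.
Lemma ImN (x : R[i]) : Im (- x) = - Im x. Proof. by case: x. Qed.
Lemma Re_conj (x : R[i]) : Re (conjc x) = Re x. Proof. by case: x. Qed.
Lemma Im_conj (x : R[i]) : Im (conjc x) = - Im x. Proof. by case: x. Qed.
Lemma conjcD (x y : R[i]) : conjc (x + y) = conjc x + conjc y. Proof. exact: rmorphD. Qed.
Lemma conjcN (x : R[i]) : conjc (- x) = - conjc x. Proof. exact: rmorphN. Qed.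
Lemma conjcM (x y : R[i]) : conjc (x * y) = conjc x * conjc y. Proof. exact: rmorphM. Qed.
Lemma conjc_sum (J : Type) (r : seq J) (P : pred J) (F : J -> R[i]) :
  conjc (\sum_(i <- r | P i) F i) = \sum_(i <- r | P i) conjc (F i).
Proof. exact: rmorph_sum. Qed.
Lemma realcM (x y : R) : (x * y)%:C%C = x%:C%C * y%:C%C :> R[i]. Proof. exact: rmorphM. Qed.
Lemma complex_eq (x y : R[i]) : Re x = Re y -> Im x = Im y -> x = y.
Proof. by case: x y => [? ?] [? ?] /= -> ->. Qed.

Lemma integrable_scale (r : R) (F : R -> R) : mu.-integrable I (EFin \o F) ->
  mu.-integrable I (EFin \o (fun t => r * F t)).
Proof.
move=> h; have := integrableZl measurable_Ig r h.
by apply: eq_integrable => //.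
Qed.

Lemma integralT_lin a f g : L1 f -> L1 g ->
  integralT (a *: f + g) = a * integralT f + integralT g.
Proof.
move=> [f1 f2] [g1 g2].
have if1 r : mu.-integrable I (EFin \o (fun t => r * reT f t)) by exact: integrable_scale.
have if2 r : mu.-integrable I (EFin \o (fun t => r * imT f t)) by exact: integrable_scale.
have key (r s : R) (gg : R -> R) : mu.-integrable I (EFin \o gg) ->
  (\int[mu]_(t in I) (r * reT f t + s * imT f t + gg t))%R =
   r * (\int[mu]_(t in I) reT f t)%R + s * (\int[mu]_(t in I) imT f t)%R + (\int[mu]_(t in I) gg t)%R.
  move=> ig; rewrite RintegralD//; last by apply: (@eq_integrable _ _ _ mu _ measurable_Ig _ _ _ (integrableD measurable_Ig (if1 r) (if2 s))).
  by rewrite RintegralD// !RintegralZl.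
apply: complex_eq; rewrite ?(ReD, ImD, ReM, ImM) /=.
- rewrite -[X in _ = X + _]/(_ + - _) -mulNr -key//.
  apply: eq_Rintegral => t _.
  by rewrite /reT /imT -[LHS]/(Re (a * f (c t) + g (c t))) ReD ReM mulNr.
- rewrite [X in _ = X + _]addrC -key//.
  apply: eq_Rintegral => t _.
  by rewrite /reT /imT -[LHS]/(Im (a * f (c t) + g (c t))) ImD ImM [X in X + _]addrC.
Qed.

Lemma integralT_conj f : L1 f -> integralT (conjf f) = conjc (integralT f).
Proof.
move=> [f1 f2]; apply: complex_eq => /=.
  by apply: eq_Rintegral => t _; rewrite Re_conj.
rewrite -mulN1r -RintegralZl//.
by apply: eq_Rintegral => t _; rewrite Im_conj mulN1r.
Qed.

Lemma integralT_ext f g : (forall t, f (c t) = g (c t)) -> integralT f = integralT g.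
Proof.
by move=> fg; apply: complex_eq; apply: eq_Rintegral => t _; rewrite fg.
Qed.

Lemma integralT_ae f g : measurableT f -> measurableT g -> f =T g -> integralT f = integralT g.
Proof.
move=> [f1 f2] [g1 g2] fg; apply: complex_eq; rewrite /= /Rintegral; congr fine;
  apply: ae_eq_integral => //; try exact/measurable_EFinP;
  by move: fg; apply: (@filterS _ _ (ae_filter_ringOfSetsType mu)) => t h It; rewrite /= h.
Qed.

(** The two integrands are one and the same function of [t], so this holds for arbitrary functions.
    It serves to move conjugates and unimodular factors from one slot to the other. *)
Lemma ip_ext f g f' g' :
  (forall t, f (c t) * conjc (g (c t)) = f' (c t) * conjc (g' (c t))) ->
  ip f g = ip f' g'.
Proof. exact: integralT_ext. Qed.

Lemma ip_linl a f g h : L2 f -> L2 g -> L2 h ->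
  ip (a *: f + g) h = a * ip f h + ip g h.
Proof.
move=> Lf Lg Lh; rewrite /ip -integralT_lin; first last.
- by apply: L1M => //; exact: L2_conj.
- by apply: L1M => //; exact: L2_conj.
by apply: integralT_ext => t; rewrite -[LHS]/((a * f (c t) + g (c t)) * conjc (h (c t))) mulrDl -mulrA.
Qed.

Lemma ipC f g : L2 f -> L2 g -> ip g f = conjc (ip f g).
Proof.
move=> Lf Lg; rewrite /ip -integralT_conj; last by apply: L1M => //; exact: L2_conj.
by apply: integralT_ext => t; rewrite -[RHS]/(conjc (f (c t) * conjc (g (c t)))) conjcM conjcK mulrC.
Qed.

Lemma ip0l h : ip 0 h = 0.
Proof.
apply: complex_eq; rewrite /= /Rintegral; rewrite integral0_eq// => t _; congr EFin.
  by rewrite -[LHS]/(Re (0 * _)) mul0r.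
by rewrite -[LHS]/(Im (0 * _)) mul0r.
Qed.

Lemma ipZl a f h : L2 f -> L2 h -> ip (a *: f) h = a * ip f h.
Proof.
by move=> Lf Lh; rewrite -[a *: f]addr0 ip_linl//; [rewrite ip0l addr0|exact: L2_0].
Qed.

Lemma ipDl f g h : L2 f -> L2 g -> L2 h -> ip (f + g) h = ip f h + ip g h.
Proof. by move=> Lf Lg Lh; rewrite -{1}[f]scale1r ip_linl// mul1r. Qed.

Lemma ipNl f h : L2 f -> L2 h -> ip (- f) h = - ip f h.
Proof. by move=> Lf Lh; rewrite -scaleN1r ipZl// mulN1r. Qed.

Lemma ipBl f g h : L2 f -> L2 g -> L2 h -> ip (f - g) h = ip f h - ip g h.
Proof. by move=> Lf Lg Lh; rewrite ipDl ?ipNl//; exact: L2N. Qed.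

Lemma ip_suml (J : Type) (r : seq J) (P : pred J) (F : J -> cfun R) h :
  (forall i, P i -> L2 (F i)) -> L2 h ->
  ip (\sum_(i <- r | P i) F i) h = \sum_(i <- r | P i) ip (F i) h.
Proof.
move=> LF Lh.
suff [] : L2 (\sum_(i <- r | P i) F i) /\
  ip (\sum_(i <- r | P i) F i) h = \sum_(i <- r | P i) ip (F i) h by [].
elim/big_rec2: _ => [|i x y Pi [Ly IH]]; first by split; [exact: L2_0|exact: ip0l].
by split; [apply: L2D => //; exact: LF|rewrite ipDl ?IH//; exact: LF].
Qed.

Lemma ipZr a f h : L2 f -> L2 h -> ip f (a *: h) = conjc a * ip f h.
Proof.
by move=> Lf Lh; rewrite ipC ?ipZl//; [rewrite conjcM -ipC|exact: L2Z].
Qed.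

Lemma ipDr f g h : L2 f -> L2 g -> L2 h -> ip f (g + h) = ip f g + ip f h.
Proof.
by move=> Lf Lg Lh; rewrite ipC ?ipDl//; [rewrite conjcD -!ipC|exact: L2D].
Qed.

Lemma ipNr f h : L2 f -> L2 h -> ip f (- h) = - ip f h.
Proof. by move=> Lf Lh; rewrite ipC ?ipNl//; [rewrite conjcN -ipC|exact: L2N]. Qed.

Lemma ipBr f g h : L2 f -> L2 g -> L2 h -> ip f (g - h) = ip f g - ip f h.
Proof. by move=> Lf Lg Lh; rewrite ipDr ?ipNr//; exact: L2N. Qed.

Lemma ip_sumr (J : Type) (r : seq J) (P : pred J) (F : J -> cfun R) h :
  (forall i, P i -> L2 (F i)) -> L2 h ->
  ip h (\sum_(i <- r | P i) F i) = \sum_(i <- r | P i) ip h (F i).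
Proof.
move=> LF Lh; rewrite ipC ?ip_suml//; last exact: L2_sum.
by rewrite conjc_sum; apply: eq_bigr => i Pi; rewrite -ipC//; exact: LF.
Qed.

Lemma ip0r h : L2 h -> ip h 0 = 0.
Proof. by move=> Lh; rewrite ipC ?ip0l ?conjc0//; exact: L2_0. Qed.

Lemma ipff f : ip f f = (\int[mu]_(t in I) sqT f t)%:C%C.
Proof.
apply: complex_eq => /=.
  apply: eq_Rintegral => t _; rewrite sqTE /reT /imT.
  by rewrite -[LHS]/(Re (f (c t) * conjc (f (c t)))) ReM Re_conj Im_conj mulrN opprK -!expr2.
rewrite /Rintegral integral0_eq// => t _; congr EFin.
by rewrite -[LHS]/(Im (f (c t) * conjc (f (c t)))) ImM Re_conj Im_conj mulrN mulrC addNr.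
Qed.

Lemma ipff_ge0 f : 0 <= ip f f.
Proof. by rewrite ipff ler0c; apply: Rintegral_ge0 => t _; exact: sqT_ge0. Qed.

Lemma ip_eq0 f : L2 f -> ip f f = 0 -> f =T 0.
Proof.
move=> /L2P[mf /[dup] fi /integrableP[mf2 fin]]; rewrite ipff => -[] f0.
have : (\int[mu]_(t in I) `|(EFin \o sqT f) t| = 0)%E.
  rewrite [LHS](_ : _ = (\int[mu]_(t in I) (sqT f t)%:E)%E); last first.
    by apply: eq_integral => t _ /=; rewrite ger0_norm// sqT_ge0.
  move: f0; rewrite /Rintegral => /eqP; rewrite fine_eq0; first by move/eqP.
  exact: integrable_fin_num.
move/(ae_eq_integral_abs mu measurable_I mf2).
apply: (@filterS _ _ (ae_filter_ringOfSetsType mu)) => t h It.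
apply: Normc.eq0_normc; apply/eqP; rewrite -sqrf_eq0; apply/eqP.
by have [] := h It.
Qed.

Lemma ip_eqTl f g h : L2 f -> L2 g -> L2 h -> f =T g -> ip f h = ip g h.
Proof.
move=> [mf _] [mg _] [mh _] fg.
by apply: integralT_ae; [exact: measurableTM mf (measurableT_conj mh)|
  exact: measurableTM mg (measurableT_conj mh)|apply: aeT_imp fg => t fg;
  rewrite -[LHS]/(f _ * _) fg].
Qed.

Lemma ip_eqTr f g h : L2 f -> L2 g -> L2 h -> f =T g -> ip h f = ip h g.
Proof. by move=> Lf Lg Lh fg; rewrite ipC// (ip_eqTl Lf Lg Lh fg) -ipC. Qed.

Lemma eqT_sym f g : f =T g -> g =T f. Proof. by apply: aeT_imp => t ->. Qed.
Lemma eqT_trans f g h : f =T g -> g =T h -> f =T h.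
Proof. by apply: aeT_imp2 => t -> ->. Qed.
Lemma eqTW f g : (forall t, f (c t) = g (c t)) -> f =T g.
Proof. by move=> h; exact: aeTW. Qed.
Lemma subr_eqT f g : f - g =T 0 -> f =T g.
Proof. by apply: aeT_imp => t /eqP; rewrite subr_eq0 => /eqP. Qed.

Lemma eqT_sqr f g : L2 f -> L2 g -> ip (f - g) (f - g) = 0 -> f =T g.
Proof. by move=> Lf Lg h; apply: subr_eqT; apply: ip_eq0 => //; exact: L2B. Qed.

Lemma norm2E f : norm2 f = Num.sqrt (\int[mu]_(t in I) sqT f t).
Proof. by rewrite /norm2 ipff. Qed.

Lemma norm2_ge0 f : 0 <= norm2 f. Proof. exact: sqrtr_ge0. Qed.

Lemma sqr_norm2 f : (norm2 f ^+ 2)%:C%C = ip f f.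
Proof.
rewrite norm2E ipff sqr_sqrtr//.
by apply: Rintegral_ge0 => t _; exact: sqT_ge0.
Qed.

Lemma normcJ2 (x : R[i]) : x * conjc x = (Normc.normc x ^+ 2)%:C%C.
Proof. by apply: complex_eq; rewrite ?ReM ?ImM Re_conj Im_conj /= ?normc_sqr; ring. Qed.

Lemma norm2_0 : norm2 (0 : cfun R) = 0.
Proof. by rewrite /norm2 ip0l /= sqrtr0. Qed.

Lemma norm2_eq0 f : L2 f -> norm2 f = 0 -> f =T 0.
Proof. by move=> Lf h; apply: ip_eq0 => //; rewrite -sqr_norm2 h expr0n. Qed.

Lemma cauchy_schwarz f g : L2 f -> L2 g -> Normc.normc (ip f g) <= norm2 f * norm2 g.
Proof.
move=> Lf Lg; suff h : ip f g * conjc (ip f g) <= ip f f * ip g g.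
  move: h; rewrite normcJ2 -!sqr_norm2 -realcM lecR -exprMn.
  by rewrite ler_pXn2r// ?nnegrE ?mulr_ge0 ?norm2_ge0 ?normc_ge0//.
have [g0|gn0] := eqVneq (ip g g) 0.
  rewrite g0 mulr0 (ip_eqTr (g := 0) Lg L2_0 Lf) ?ip0r ?mul0r//.
  exact: ip_eq0.
have gp : 0 < ip g g by rewrite lt_neqAle eq_sym gn0 ipff_ge0.
set p := ip f g; set q := ip g g.
(* The part of [f] orthogonal to [g] has squared norm [ip f f - |p|^2 / q]. *)
have := ipff_ge0 (f - (p / q) *: g).
have Lz : L2 ((p / q) *: g) by exact: L2Z.
have -> : ip (f - (p / q) *: g) (f - (p / q) *: g) = ip f f - p * conjc p / q.
  rewrite ipBl//; last exact: L2B.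
  rewrite !ipBr// !ipZl// !ipZr// (ipC Lf Lg) -/p -/q conjcM conjc_inv.
  rewrite {2 4}/q -(ipC Lg Lg) -/q.
  by field.
by rewrite subr_ge0 ler_pdivrMr.
Qed.

Lemma norm2Z a f : L2 f -> norm2 (a *: f) = Normc.normc a * norm2 f.
Proof.
move=> Lf; apply/eqP; rewrite -(@eqrXn2 _ 2)// ?mulr_ge0 ?norm2_ge0 ?normc_ge0//.
rewrite -(inj_eq (@complexI _)) sqr_norm2 exprMn realcM sqr_norm2 -normcJ2.
by rewrite ipZl ?ipZr// ?mulrA//; exact: L2Z.
Qed.

Lemma norm2N f : L2 f -> norm2 (- f) = norm2 f.
Proof. by move=> Lf; rewrite -scaleN1r norm2Z// normcN Normc.normc1 mul1r. Qed.

Lemma norm2_eqT f g : L2 f -> L2 g -> f =T g -> norm2 f = norm2 g.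
Proof.
by move=> Lf Lg fg; rewrite /norm2 (ip_eqTl Lf Lg Lf fg) (ip_eqTr Lf Lg Lg fg).
Qed.

End inner_product.

(** * Completeness of L^2 *)

Section completeness.
Context {R : realType}.
Local Notation mu := (@lebesgue_measure R).
Local Notation I := (@I01 R).
Local Notation c := (@circle_pt R).
Implicit Types f g h : cfun R.
#[local] Hint Extern 0 (measurable _) => solve [exact: measurable_I | exact: measurable_Ig] : core.
Local Notation Re := complex.Re.
Local Notation Im := complex.Im.

Lemma int_sqT f : L2 f -> (\int[mu]_(t in I) (sqT f t)%:E = (norm2 f ^+ 2)%:E)%E.
Proof.
move=> /L2P[_ fi]; have := sqr_norm2 f; rewrite ipff => -[->].
by rewrite /Rintegral fineK//; exact: integrable_fin_num.
Qed.

Lemma norm2_1 : norm2 (cst 1 : cfun R) = 1.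
Proof.
rewrite norm2E [X in Num.sqrt X](_ : _ = 1) ?sqrtr1//.
rewrite /Rintegral [X in fine X](_ : _ = 1%E)//.
have /= := integral_cst mu measurable_Ig (1%:E); rewrite mu_I mul1e => h; rewrite -[RHS]h.
by apply: eq_integral => t _; rewrite /sqT [X in Normc.normc X](_ : _ = 1)// Normc.normc1 expr1n.
Qed.

Lemma Re_le_normc (x : R[i]) : `|Re x| <= Normc.normc x.
Proof.
rewrite -(@ler_pXn2r _ 2)// ?nnegrE ?normc_ge0//.
by rewrite normc_sqr real_normK ?num_real// lerDl sqr_ge0.
Qed.

Lemma Im_le_normc (x : R[i]) : `|Im x| <= Normc.normc x.
Proof.
rewrite -(@ler_pXn2r _ 2)// ?nnegrE ?normc_ge0//.
by rewrite normc_sqr real_normK ?num_real// lerDr sqr_ge0.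
Qed.

Definition absT f : cfun R := fun z => (Normc.normc (f z))%:C%C.

Lemma measurable_normc f : measurableT f -> measurable_fun I (fun t => Normc.normc (f (c t))).
Proof.
move=> mf.
rewrite [X in measurable_fun _ X](_ : _ = Num.sqrt \o (sqT f)); last first.
  by apply/funext => t; rewrite /= /sqT sqrtr_sqr ger0_norm// normc_ge0.
apply: measurableT_comp; last exact: measurable_sqT.
by apply: continuous_measurable_fun; exact: sqrt_continuous.
Qed.

Lemma sqT_abs f t : sqT (absT f) t = sqT f t.
Proof. by rewrite /sqT /absT /= expr0n addr0 sqrtr_sqr ger0_norm// normc_ge0. Qed.

Lemma L2_abs f : L2 f -> L2 (absT f).
Proof.
move=> /L2P[mf fi]; apply/L2P; split.
  split; [exact: measurable_normc|exact: measurable_cst].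
by apply: eq_integrable fi => // t _; rewrite /= sqT_abs.
Qed.

Lemma norm2_abs f : norm2 (absT f) = norm2 f.
Proof. by rewrite !norm2E; congr Num.sqrt; apply: eq_Rintegral => t _; exact: sqT_abs. Qed.

(** Cauchy-Schwarz against the constant 1, on a space of total mass 1. *)
Lemma int_normc_le f : L2 f -> (\int[mu]_(t in I) (Normc.normc (f (c t)))%:E <= (norm2 f)%:E)%E.
Proof.
move=> Lf; have La := L2_abs Lf; have L1 := @L2_cst R 1.
have [i1 _] := L1M La (L2_conj L1).
have E : \int[mu]_(t in I) (Normc.normc (f (c t))) = Re (ip (absT f) (cst 1)).
  apply: eq_Rintegral => t _.
  by rewrite -[RHS]/(Re ((Normc.normc (f (c t)))%:C%C * conjc 1)) conjc1 mulr1.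
have <- : (\int[mu]_(t in I) (Normc.normc (f (c t))))%:E = (\int[mu]_(t in I) (Normc.normc (f (c t)))%:E)%E.
  rewrite /Rintegral fineK//; apply: integrable_fin_num => //.
  apply: eq_integrable i1 => // t _.
  by rewrite -[LHS]/(Re ((Normc.normc (f (c t)))%:C%C * conjc 1))%:E conjc1 mulr1.
rewrite lee_fin E (le_trans (ler_norm _))// (le_trans (Re_le_normc _))//.
by rewrite (le_trans (cauchy_schwarz La L1))// norm2_1 mulr1 norm2_abs.
Qed.

(** An upper limit instead of a limit, so that [limT] is measurable without any knowledge of where
    the sequence converges. *)
Definition limR (x : nat -> R) : R := fine (limn_esup (fun k => (x k)%:E)).

Lemma limRE (x : nat -> R) : cvgn x -> limR x = limn x.
Proof.
move=> cx; rewrite /limR.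
have h : (fun k => (x k)%:E) @ \oo --> (limn x)%:E by apply: cvg_EFin => //; exact: nearW.
by rewrite (cvg_limn_einf_sup h).2.
Qed.

Definition limT (u : nat -> cfun R) : cfun R :=
  fun z => Complex (limR (fun k => Re (u k z))) (limR (fun k => Im (u k z))).

Lemma measurable_limT u : (forall k, measurableT (u k)) -> measurableT (limT u).
Proof.
move=> mu_; split; rewrite /= /limR.
- apply: (measurableT_comp (f := fine)); first exact: fine_measurable.
  by apply: measurable_fun_limn_esup => k; apply/measurable_EFinP; case: (mu_ k).
- apply: (measurableT_comp (f := fine)); first exact: fine_measurable.
  by apply: measurable_fun_limn_esup => k; apply/measurable_EFinP; case: (mu_ k).
Qed.

Lemma cvg_abs_increments (x : nat -> R) (D : nat -> R) :
  (forall k, `|x k.+1 - x k| <= D k) -> cvgn (series D) -> cvgn x.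
Proof.
move=> h cD.
have : cvgn (series (fun k => x k.+1 - x k)).
  apply: normed_cvg.
  by apply: series_le_cvg cD => k; [exact: normr_ge0|exact: (le_trans (normr_ge0 _) (h k))|exact: h].
have E : series (fun k => x k.+1 - x k) = (fun n => x n - x 0%N).
  by apply/funext => n; rewrite /series /= telescope_sumr.
rewrite E => cy.
have -> : x = (fun n => (x n - x 0%N) + x 0%N) by apply/funext => n; rewrite subrK.
by apply: is_cvgD => //; exact: is_cvg_cst.
Qed.

(** The integral of the sum of the increments is the sum of their integrals, which is at most 2. The
    sum is thus finite almost everywhere, and there both parts of [u k] have absolutely summable
    increments. *)
Lemma ae_cvg_fast (u : nat -> cfun R) : (forall k, L2 (u k)) ->
  (forall k, norm2 (u k.+1 - u k) <= 2^-1 ^+ k) ->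
  aeT (fun z => cvgn (fun k => Re (u k z)) /\ cvgn (fun k => Im (u k z))).
Proof.
move=> Lu fast.
pose D k t : R := Normc.normc ((u k.+1 - u k) (c t)).
have Ld k : L2 (u k.+1 - u k) by exact: L2B.
have mD k : measurable_fun I (EFin \o D k).
  by apply/measurable_EFinP; apply: measurable_normc; exact: L2_meas.
have D0 k t : (0 <= (D k t)%:E)%E by rewrite lee_fin normc_ge0.
have iD : (\int[mu]_(t in I) (\sum_(0 <= k <oo) (D k t)%:E) < +oo)%E.
  rewrite integral_nneseries//.
  apply: (@le_lt_trans _ _ (\sum_(0 <= k <oo) (2^-1 ^+ k)%:E)%E).
    apply: lee_nneseries => [k *|k *]; first exact: integral_ge0.
    by apply: le_trans (int_normc_le (Ld k)) _; rewrite lee_fin.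
  apply: (@le_lt_trans _ _ 2%:E); last exact: ltry.
  apply: lime_le; first by apply: is_cvg_nneseries => k _ _; rewrite lee_fin exprn_ge0// invr_ge0.
  apply: nearW => n; rewrite sumEFin lee_fin.
  suff -> : \sum_(0 <= k < n) 2^-1 ^+ k = 2 - 2 * 2^-1 ^+ n :> R.
    by rewrite gerBl mulr_ge0// exprn_ge0// invr_ge0.
  elim: n => [|n IH]; first by rewrite big_nil expr0 mulr1 subrr.
  rewrite big_nat_recr//= IH exprS mulrA divff// mul1r mulr_natl mulr2n; ring.
have mS : measurable_fun I (fun t => \sum_(0 <= k <oo) (D k t)%:E)%E.
  by apply: ge0_emeasurable_sum => [k t _ _|k _]; [exact: D0|exact: mD].
have iS : mu.-integrable I (fun t => \sum_(0 <= k <oo) (D k t)%:E)%E.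
  apply/integrableP; split=> //.
  rewrite [X in (X < _)%E](_ : _ = \int[mu]_(t in I) (\sum_(0 <= k <oo) (D k t)%:E))%E//.
  by apply: eq_integral => t _; rewrite gee0_abs//; exact: nneseries_ge0.
apply: (@filterS _ _ (ae_filter_ringOfSetsType mu)) (integrable_ae measurable_Ig iS) => t h It.
have fin := h It.
have cD : cvgn (series (fun k => D k t)).
  apply: nnseries_is_cvg => [k|]; first exact: normc_ge0.
  by move: fin; rewrite fin_numElt => /andP[].
split; apply: cvg_abs_increments cD => k; rewrite /D.
- by rewrite -[X in `|X|]/(Re (u k.+1 (c t)) + - Re (u k (c t))) -ReN -ReD; exact: Re_le_normc.
- by rewrite -[X in `|X|]/(Im (u k.+1 (c t)) + - Im (u k (c t))) -ImN -ImD; exact: Im_le_normc.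
Qed.

(** Fatou's lemma for [|f - u k|^2]. With a late term of a Cauchy sequence as [f], it yields at once
    that the limit is in L^2 and how fast it is approached. *)
Lemma L2_fatou (u : nat -> cfun R) f (e : R) : 0 <= e -> L2 f -> (forall k, L2 (u k)) ->
  aeT (fun z => cvgn (fun k => Re (u k z)) /\ cvgn (fun k => Im (u k z))) ->
  (exists N, forall k, (N <= k)%N -> norm2 (f - u k) <= e) ->
  L2 (f - limT u) /\ norm2 (f - limT u) <= e.
Proof.
move=> e0 Lf Lu aec [N hN].
have ml : measurableT (limT u) by apply: measurable_limT => k; exact: L2_meas.
have md : measurableT (f - limT u).
  apply: measurableTD; first exact: L2_meas.
  by rewrite -scaleN1r; apply: measurableTM ml; exact: measurableT_cst.
have mk k : measurable_fun I (fun t => (sqT (f - u k) t)%:E).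
  by apply/measurable_EFinP; apply: measurable_sqT; apply: L2_meas; exact: L2B.
have le : (\int[mu]_(t in I) (sqT (f - limT u) t)%:E <= (e ^+ 2)%:E)%E.
  apply: (@le_trans _ _ (\int[mu]_(t in I) limn_einf (fun k => (sqT (f - u k) t)%:E))%E).
    have mi : measurable_fun I (fun t => limn_einf (fun k => (sqT (f - u k) t)%:E)).
      under eq_fun do rewrite -[limn_einf _]oppeK -limn_esupN.
      apply: measurableT_comp => //; apply: measurable_fun_limn_esup => k.
      by apply: measurableT_comp.
    apply: ae_ge0_le_integral => //.
    - by move=> t _; rewrite lee_fin sqT_ge0.
    - by apply/measurable_EFinP; exact: measurable_sqT.
    - move=> t _; rewrite limn_einf_lim; apply: lime_ge; first exact: is_cvg_einfs.
      apply: nearW => n; apply: le_ereal_inf_tmp => _ [k _ <-].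
      by rewrite lee_fin sqT_ge0.
    apply: (@filterS _ _ (ae_filter_ringOfSetsType mu)) aec => t h It.
    have {h} [c1 c2] := h It.
    suff h : (fun k => (sqT (f - u k) t)%:E) @ \oo --> (sqT (f - limT u) t)%:E.
      by rewrite (cvg_limn_einf_sup h).1.
    apply: cvg_EFin; first exact: nearW.
    rewrite sqTE; under eq_fun do rewrite sqTE.
    have E1 : reT (f - limT u) t = Re (f (c t)) - limn (fun k => Re (u k (c t))).
      by rewrite -limRE// -[LHS]/(Re (f (c t) - Complex _ _)) ReD ReN.
    have E2 : imT (f - limT u) t = Im (f (c t)) - limn (fun k => Im (u k (c t))).
      by rewrite -limRE// -[LHS]/(Im (f (c t) - Complex _ _)) ImD ImN.
    rewrite E1 E2; apply: cvgD.
      rewrite !expr2.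
      have h : (fun k => reT (f - u k) t) @ \oo --> Re (f (c t)) - limn (fun k => Re (u k (c t))).
        rewrite [X in X @ _](_ : _ = fun k => Re (f (c t)) - Re (u k (c t))); last first.
          by apply/funext => k; rewrite -[LHS]/(Re (f (c t) - u k (c t))) ReD ReN.
        by apply: cvgB => //; exact: cvg_cst.
      exact: cvgM.
    have h : (fun k => imT (f - u k) t) @ \oo --> Im (f (c t)) - limn (fun k => Im (u k (c t))).
      rewrite [X in X @ _](_ : _ = fun k => Im (f (c t)) - Im (u k (c t))); last first.
        by apply/funext => k; rewrite -[LHS]/(Im (f (c t) - u k (c t))) ImD ImN.
      by apply: cvgB => //; exact: cvg_cst.
    exact: cvgM.
  apply: le_trans (fatou _ _ _ _) _ => //.
    by move=> n t _; rewrite lee_fin sqT_ge0.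
  rewrite limn_einf_lim.
  apply: lime_le; first exact: is_cvg_einfs.
  (* The index [maxn n N] belongs to the tail over which the infimum is taken and also satisfies the
     bound [hN]. *)
  apply: nearW => n; apply: (@le_trans _ _ (\int[mu]_(t in I) (sqT (f - u (maxn n N)) t)%:E)%E).
    by apply: ereal_inf_lbound; exists (maxn n N) => //=; rewrite leq_maxl.
  rewrite int_sqT; last exact: L2B.
  by rewrite lee_fin ler_pXn2r ?nnegrE ?norm2_ge0// hN// leq_maxr.
have Ld : L2 (f - limT u) by split => //; apply: le_lt_trans le _; exact: ltry.
split=> //; move: le; rewrite int_sqT// lee_fin ler_pXn2r// ?nnegrE ?norm2_ge0//.
Qed.

Theorem L2_complete (u : nat -> cfun R) : (forall n, L2 (u n)) ->
  (forall e : R, 0 < e -> exists N, forall n m, (N <= n)%N -> (N <= m)%N -> norm2 (u n - u m) <= e) ->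
  exists2 v, L2 v & forall e : R, 0 < e -> exists N, forall n, (N <= n)%N -> norm2 (u n - v) <= e.
Proof.
move=> Lu cau.
have e0 k : 0 < 2^-1 ^+ k :> R by rewrite exprn_gt0// invr_gt0.
have [nk hnk] := choice (fun k => cau _ (e0 k)).
(* The maximum of the thresholds makes the indices nondecreasing, so that consecutive terms of the
   subsequence are both past the [k]-th threshold. *)
pose ik k := (\max_(i < k.+1) nk i)%N.
have ikS k : (ik k <= ik k.+1)%N by rewrite /ik [leqRHS]big_ord_recr /= leq_maxl.
have nki k : (nk k <= ik k)%N by rewrite /ik big_ord_recr /= leq_maxr.
have nki' k j : (k <= j)%N -> (nk k <= ik j)%N.
  by move=> kj; rewrite (leq_trans (nki k))//; exact: (homo_leq (@leqnn) leq_trans ikS).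
pose w k := u (ik k).
have Lw k : L2 (w k) by exact: Lu.
have fast k : norm2 (w k.+1 - w k) <= 2^-1 ^+ k.
  by apply: hnk => //; rewrite (leq_trans (nki k)).
have aec := ae_cvg_fast Lw fast.
have main e : 0 < e -> exists N, forall n, (N <= n)%N -> L2 (u n - limT w) /\ norm2 (u n - limT w) <= e.
  move=> ep; have [N hN] := cau _ ep.
  have [K hK] : exists K, 2^-1 ^+ K <= e.
    have h : (fun k => 2^-1 ^+ k : R) @ \oo --> 0.
      by apply: cvg_expr; rewrite ger0_norm ?invr_ge0// invf_lt1 ?ltr1n.
    have [K _ hK] := (cvgrPdist_le _ _).1 h _ ep.
    by exists K; have := hK K (leqnn K); rewrite sub0r normrN ger0_norm ?exprn_ge0 ?invr_ge0.
  exists (nk K) => n nn; apply: L2_fatou => //; first exact: ltW.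
  by exists K => k kk; apply: le_trans hK; apply: hnk => //; exact: nki'.
have [N hN] := main 1 ltr01.
exists (limT w); last by move=> e /main[N' h]; exists N' => n /h[].
have -> : limT w = u N - (u N - limT w) by rewrite opprB addrC subrK.
by apply: L2B => //; exact: (hN N (leqnn N)).1.
Qed.

End completeness.

(** * Totality of the powers of z in L^2 *)

Section totality.
Context {R : realType}.
Local Notation mu := (@lebesgue_measure R).
Local Notation I := (@I01 R).
Local Notation c := (@circle_pt R).
Implicit Types f g h : cfun R.
#[local] Hint Extern 0 (measurable _) => solve [exact: measurable_I | exact: measurable_Ig] : core.
Local Notation Re := complex.Re.
Local Notation Im := complex.Im.

Lemma Rint_cos (a : R) : a != 0 -> \int[mu]_(t in I) cos (a * t) = sin a / a.
Proof.
move=> a0; rewrite /Rintegral.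
rewrite (@continuous_FTC2 _ _ (fun t => a^-1 * sin (a * t)))//.
- by rewrite /= mulr1 mulr0 sin0 mulr0 subr0 mulrC.
- apply: continuous_subspaceT => x; apply: continuous_comp; last exact: continuous_cos.
  by apply: cvgMr; exact: cvg_id.
- have ct x : {for x, continuous (fun t => a^-1 * sin (a * t))}.
    apply: cvgMr; apply: continuous_comp; last exact: continuous_sin.
    by apply: cvgMr; exact: cvg_id.
  split.
  + by move=> x _; apply: ex_derive.
  + by apply: cvg_at_right_filter; exact: ct.
  + by apply: cvg_at_left_filter; exact: ct.
- move=> x _; rewrite derive1E derive_val /= ?scaler0 ?addr0 ?add0r.
  by rewrite /GRing.scale /= ?mulr1 ?mul1r; field.
Qed.

Lemma Rint_sin (a : R) : a != 0 -> \int[mu]_(t in I) sin (a * t) = (1 - cos a) / a.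
Proof.
move=> a0; rewrite /Rintegral.
rewrite (@continuous_FTC2 _ _ (fun t => - a^-1 * cos (a * t)))//.
- by rewrite /= mulr1 mulr0 cos0; field.
- apply: continuous_subspaceT => x; apply: continuous_comp; last exact: continuous_sin.
  by apply: cvgMr; exact: cvg_id.
- have ct x : {for x, continuous (fun t => - a^-1 * cos (a * t))}.
    apply: cvgMr; apply: continuous_comp; last exact: continuous_cos.
    by apply: cvgMr; exact: cvg_id.
  split.
  + by move=> x _; apply: ex_derive.
  + by apply: cvg_at_right_filter; exact: ct.
  + by apply: cvg_at_left_filter; exact: ct.
- move=> x _; rewrite derive1E derive_val /= ?scaler0 ?addr0 ?add0r.
  by rewrite /GRing.scale /= ?mulr1 ?mul1r; field.
Qed.

Lemma integralT_zpow (n : int) : integralT (@zpow R n) = (n == 0)%:R.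
Proof.
have [->|n0] := eqVneq n 0.
  rewrite (integralT_ext (g := cst 1)) => [|t]; last by rewrite /zpow expr0z.
  have := sqr_norm2 (cst 1 : cfun R); rewrite norm2_1 expr1n => E; rewrite [RHS]E.
  by apply: integralT_ext => t; rewrite -[RHS]/(1 * conjc 1) conjc1 mulr1.
have a0 : 2 * pi * n%:~R != 0 :> R by rewrite !mulf_neq0 ?intr_eq0// ?gt_eqF// pi_gt0.
have [s0 c1] : sin (2 * pi * n%:~R) = 0 :> R /\ cos (2 * pi * n%:~R) = 1 :> R.
  have : c n%:~R = 1 by rewrite -[n%:~R]mulr1 -circle_ptXz circle_pt1 exp1rz.
  by rewrite /circle_pt => -[-> ->].
apply: complex_eq; rewrite /=.
- transitivity (\int[mu]_(t in I) cos (2 * pi * n%:~R * t)).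
    by apply: eq_Rintegral => t _; rewrite /zpow circle_ptXz /= mulrA.
  by rewrite Rint_cos// s0 mul0r.
- transitivity (\int[mu]_(t in I) sin (2 * pi * n%:~R * t)).
    by apply: eq_Rintegral => t _; rewrite /zpow circle_ptXz /= mulrA.
  by rewrite Rint_sin// c1 subrr mul0r.
Qed.

Lemma zpow_conj (n : int) t : conjc (zpow n (c t)) = zpow (- n) (c t).
Proof.
by rewrite /zpow !circle_ptXz circle_pt_conj -circle_ptN mulrNz mulNr.
Qed.

Lemma zpowD (m n : int) t : zpow (m + n) (c t) = zpow m (c t) * zpow n (c t).
Proof. by rewrite /zpow expfzDr// circle_pt_neq0. Qed.

Lemma ip_zpow (m n : int) : ip (@zpow R m) (zpow n) = (m == n)%:R.
Proof.
rewrite -subr_eq0 -integralT_zpow; apply: integralT_ext => t.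
by rewrite zpowD -zpow_conj.
Qed.

(** The last constructor is what closes the class under products: [zpow m * zpow n] and
    [zpow (m + n)] agree on the circle but may differ at the origin. *)
Inductive trigpoly : cfun R -> Prop :=
| trig_zpow n : trigpoly (zpow n)
| trig_lin a f g : trigpoly f -> trigpoly g -> trigpoly (a *: f + g)
| trig_ext f g : (forall t, f (c t) = g (c t)) -> trigpoly f -> trigpoly g.

Lemma trig0 : trigpoly 0.
Proof.
apply: (trig_ext _ (trig_lin (-1) (trig_zpow 0) (trig_zpow 0))) => t.
by rewrite scaleN1r addNr.
Qed.

Lemma trigZ a f : trigpoly f -> trigpoly (a *: f).
Proof. by move=> tf; rewrite -[_ *: _]addr0; apply: trig_lin tf trig0. Qed.

Lemma trigD f g : trigpoly f -> trigpoly g -> trigpoly (f + g).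
Proof. by rewrite -{2}[f]scale1r; exact: trig_lin. Qed.

Lemma trig_cst a : trigpoly (cst a).
Proof.
by apply: (trig_ext _ (trigZ a (trig_zpow 0))) => t; rewrite -[LHS]/(a * _) /zpow expr0z mulr1.
Qed.

Lemma trigM f g : trigpoly f -> trigpoly g -> trigpoly (f * g).
Proof.
move=> tf tg; elim: tf g tg => [n|a f1 f2 _ IH1 _ IH2|f1 f2 ff _ IH] g tg.
- elim: tg => [m|a g1 g2 _ IH1 _ IH2|g1 g2 gg _ IH].
  + by apply: (trig_ext _ (trig_zpow (n + m))) => t; rewrite zpowD.
  + apply: (trig_ext _ (trig_lin a IH1 IH2)) => t.
    rewrite -[LHS]/(a * (zpow n (c t) * g1 (c t)) + zpow n (c t) * g2 (c t)).
    by rewrite -[RHS]/(zpow n (c t) * (a * g1 (c t) + g2 (c t))); ring.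
  + by apply: trig_ext IH => t; rewrite -[LHS]/(_ * g1 _) gg.
- apply: (trig_ext _ (trig_lin a (IH1 _ tg) (IH2 _ tg))) => t.
  rewrite -[LHS]/(a * (f1 (c t) * g (c t)) + f2 (c t) * g (c t)).
  by rewrite -[RHS]/((a * f1 (c t) + f2 (c t)) * g (c t)); ring.
- by apply: (trig_ext _ (IH _ tg)) => t; rewrite -[LHS]/(f1 _ * _) ff.
Qed.

Lemma trigX f n : trigpoly f -> trigpoly (f ^+ n).
Proof.
move=> tf; elim: n => [|n IH]; first exact: trig_cst.
by rewrite exprS; exact: trigM.
Qed.

Lemma L2_trig f : trigpoly f -> L2 f.
Proof.
elim=> [n|a f1 f2 _ IH1 _ IH2|f1 f2 ff _]; first exact: L2_zpow.
- by apply: L2D => //; exact: L2Z.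
- exact: L2_eqc.
Qed.

Lemma ip_trig f p : L2 f -> (forall n, ip f (zpow n) = 0) -> trigpoly p -> ip f p = 0.
Proof.
move=> Lf f0; elim=> [n|a f1 f2 t1 IH1 t2 IH2|f1 f2 ff t1 IH]; first exact: f0.
- rewrite ipDr//; [|by apply: L2Z; exact: L2_trig|exact: L2_trig].
  by rewrite ipZr ?IH1 ?IH2 ?mulr0 ?addr0//; exact: L2_trig.
- by rewrite -IH; apply: ip_ext => t; rewrite ff.
Qed.

Lemma bernoulli_ineq (x : R) n : -1 <= x -> 1 + n%:R * x <= (1 + x) ^+ n.
Proof.
move=> x1; elim: n => [|n IH]; first by rewrite mul0r addr0 expr0.
rewrite exprS; apply: (@le_trans _ _ ((1 + x) * (1 + n%:R * x))).
  by rewrite -natr1; have := sqr_ge0 x; have : 0 <= n%:R :> R by []; nra.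
by rewrite ler_wpM2l//; lra.
Qed.

(** The polynomials of the elementary proof of the Stone-Weierstrass theorem: on [0, 1] they tend to
    0 below 1/2 and to 1 above 1/2. *)
Definition stepp n (y : R) := 1 - (1 - y ^+ n) ^+ (2 ^ n).

Lemma stepp_bnd n y : 0 <= y <= 1 -> 0 <= stepp n y <= 1.
Proof.
move=> /andP[y0 y1]; rewrite /stepp.
have h0 : 0 <= y ^+ n by exact: exprn_ge0.
have h1 : y ^+ n <= 1 by exact: exprn_ile1.
by rewrite subr_ge0 gerBl exprn_ile1 ?exprn_ge0 ?subr_ge0// gerBl.
Qed.

(** Bernoulli's inequality for [(1 - y ^+ n) ^+ (2 ^ n)] gives [stepp n y <= (2 * y) ^+ n]. *)
Lemma stepp_lt y : 0 <= y < 2^-1 -> (stepp n y @[n --> \oo]) --> (0 : R).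
Proof.
move=> /andP[y0 y1].
apply: (@squeeze_cvgr _ _ _ _ (cst 0) (fun n => (2 * y) ^+ n)).
- apply: nearW => n /=; have /andP[-> _] /= : 0 <= stepp n y <= 1 by apply: stepp_bnd; lra.
  have h1 : y ^+ n <= 1 by apply: exprn_ile1 => //; lra.
  have h : -1 <= - y ^+ n by lra.
  have := bernoulli_ineq (2 ^ n) h; rewrite /stepp natrX exprMn mulrN; lra.
- exact: cvg_cst.
- by apply: cvg_expr; rewrite ger0_norm; lra.
Qed.

(** The product of [1 - stepp n y = (1 - y ^+ n) ^+ (2 ^ n)] with [(1 + y ^+ n) ^+ (2 ^ n)] is at
    most 1, and Bernoulli's inequality bounds the second factor below by [(2 * y) ^+ n]. *)
Lemma stepp_gt y : 2^-1 < y <= 1 -> (stepp n y @[n --> \oo]) --> (1 : R).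
Proof.
move=> /andP[y0 y1].
have r1 : (2 * y)^-1 < 1 by rewrite invf_lt1; lra.
have r0 : 0 < (2 * y)^-1 by rewrite invr_gt0; lra.
apply: (@squeeze_cvgr _ _ _ _ (fun n => 1 - (2 * y)^-1 ^+ n) (cst 1)).
- apply: nearW => n /=; have /andP[_ ->] /= : 0 <= stepp n y <= 1 by apply: stepp_bnd; lra.
  rewrite andbT /stepp lerB// exprVn.
  have h1 : y ^+ n <= 1 by apply: exprn_ile1 => //; lra.
  have h0 : 0 < y ^+ n by apply: exprn_gt0 => //; lra.
  have h : -1 <= y ^+ n by lra.
  have hb := bernoulli_ineq (2 ^ n) h; rewrite natrX -exprMn in hb.
  have p0 : 0 < (2 * y) ^+ n by apply: exprn_gt0; lra.
  rewrite -[leRHS]mul1r ler_pdivlMr//.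
  apply: (@le_trans _ _ ((1 - y ^+ n) ^+ (2 ^ n) * (1 + y ^+ n) ^+ (2 ^ n))).
    by rewrite ler_wpM2l ?exprn_ge0// ?subr_ge0//; lra.
  rewrite -exprMn exprn_ile1//.
    by rewrite mulr_ge0; lra.
  by have := sqr_ge0 (y ^+ n); nra.
- rewrite -[X in _ --> X]subr0; apply: cvgB; first exact: cvg_cst.
  by apply: cvg_expr; rewrite ger0_norm// ltW.
- exact: cvg_cst.
Qed.

(** By [arcyE] it exceeds 1/2 exactly where [sin (pi * t) * sin (pi * (x - t))] is positive, which
    for [t] and [x] in (0, 1) means [t < x]. The division by 4 keeps the values in [0, 1], where
    [stepp] acts. *)
Definition arcy (x t : R) := 2^-1 + (cos (2 * pi * t - pi * x) - cos (pi * x)) / 4.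

Lemma arcyE x t : arcy x t = 2^-1 + 2^-1 * (sin (pi * t) * sin (pi * (x - t))).
Proof.
rewrite /arcy; congr (_ + _).
have -> : 2 * pi * t - pi * x = pi * t - pi * (x - t) by ring.
have -> : pi * x = pi * t + pi * (x - t) by ring.
by rewrite cosB cosD; field.
Qed.

Lemma arcy_bnd x t : 0 <= arcy x t <= 1.
Proof.
rewrite /arcy; have := cos_geN1 (2 * pi * t - pi * x); have := cos_geN1 (pi * x).
by have := cos_le1 (2 * pi * t - pi * x); have := cos_le1 (pi * x); lra.
Qed.

(** [arcy x] in powers of z: [c (x / 2)] is exp(i pi x), and a quarter of the cosine is an eighth of
    the sum of two conjugate exponentials. *)
Definition arcT (x : R) : cfun R :=
  cst ((2^-1 - cos (pi * x) / 4)%:C%C) +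
   8^-1 *: (conjc (c (x / 2)) *: zpow 1 + c (x / 2) *: zpow (-1)).

Lemma trig_arcT x : trigpoly (arcT x).
Proof.
by apply: trigD; [exact: trig_cst|apply: trigZ; apply: trigD; apply: trigZ; exact: trig_zpow].
Qed.

Lemma arcTE x t : arcT x (c t) = (arcy x t)%:C%C.
Proof.
have -> : arcT x (c t) = (2^-1 - cos (pi * x) / 4)%:C%C + 8^-1 * (conjc (c (x / 2)) * c t + c (x / 2) * conjc (c t)).
  by rewrite (circle_pt_conj t) -[LHS]/(_ + 8^-1 * (_ * c t ^ 1 + _ * c t ^ (-1))) expr1z exprN1.
have -> : conjc (c (x / 2)) * c t = c (t - x / 2).
  by rewrite circle_ptD circle_ptN circle_pt_conj mulrC.
have -> : c (x / 2) * conjc (c t) = conjc (c (t - x / 2)).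
  by rewrite circle_ptD circle_ptN conjcM conjc_inv (circle_pt_conj (x / 2)) invrK mulrC.
rewrite addcJ /circle_pt /= /arcy.
have -> : 2 * pi * (t - x / 2) = 2 * pi * t - pi * x by field.
have -> : 8^-1 = (8^-1 : R)%:C%C by rewrite rmorphV ?unitfE ?pnatr_eq0//= rmorph_nat.
have -> : 2 = (2 : R)%:C%C :> R[i] by rewrite rmorph_nat.
rewrite -!realcM -rmorphD /=; by congr (_%:C%C); field.
Qed.

Lemma trig_real (F : R[i] -> R) (p : cfun R) (f : cfun R) : L2 f ->
  (forall t, p (c t) = (F (c t))%:C%C) -> ip f p = 0 ->
  \int[mu]_(t in I) (Re (f (c t)) * F (c t)) = 0 /\
  \int[mu]_(t in I) (Im (f (c t)) * F (c t)) = 0.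
Proof.
move=> Lf pF h.
have E t : (f * conjf p) (c t) = f (c t) * (F (c t))%:C%C.
  by rewrite -[LHS]/(f (c t) * conjc (p (c t))) pF conjc_real.
split.
- transitivity (Re (ip f p)); last by rewrite h.
  by apply: eq_Rintegral => t _; rewrite E ReM mulr0 subr0.
- transitivity (Im (ip f p)); last by rewrite h.
  by apply: eq_Rintegral => t _; rewrite E ImM mulr0 add0r.
Qed.

Lemma cvg_stepp_arc (x t : R) : 0 < x < 1 -> 0 < t < 1 -> t != x ->
  (stepp n (arcy x t) @[n --> \oo]) --> ((t <= x)%R%:R : R).
Proof.
move=> /andP[x0 x1] /andP[t0 t1] tx.
have s1 : 0 < sin (pi * t) by apply: sin_gt0_pi; rewrite mulr_gt0 ?pi_gt0//= gtr_pMr// pi_gt0.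
have [+|lt] := leP t x => /=.
  rewrite le_eqVlt (negbTE tx) /= => lt.
  apply: stepp_gt; have /andP[_ ->] := arcy_bnd x t; rewrite andbT arcyE ltrDl.
  rewrite !mulr_gt0// sin_gt0_pi// mulr_gt0 ?pi_gt0//= ?subr_gt0//.
  by rewrite gtr_pMr ?pi_gt0//; lra.
apply: stepp_lt; have /andP[-> _] := arcy_bnd x t; rewrite /= arcyE gtrDl.
rewrite pmulr_rlt0// pmulr_rlt0// -[x - t]opprB mulrN sinN oppr_lt0 sin_gt0_pi//.
by rewrite mulr_gt0 ?pi_gt0//= ?subr_gt0// gtr_pMr ?pi_gt0//; lra.
Qed.

(* The trigonometric polynomials [stepp n (arcT x)] converge boundedly to the
   indicator of the arc from 0 to x. *)
Lemma Rint_arc0 (G : R -> R) (x : R) : 0 < x < 1 -> mu.-integrable I (EFin \o G) ->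
  (forall n, \int[mu]_(t in I) (G t * stepp n (arcy x t)) = 0) ->
  \int[mu]_(t in I) (G t * (t <= x)%R%:R) = 0.
Proof.
move=> x01 iG h.
have mG := measurable_int mu iG.
have mst n : measurable_fun I (stepp n \o arcy x).
  apply: measurable_funB; first exact: measurable_cst.
  apply: measurable_funX; apply: measurable_funB; first exact: measurable_cst.
  apply: measurable_funX; apply: measurable_funTS; apply: continuous_measurable_fun => t.
  apply: cvgD; first exact: cvg_cst.
  apply: cvgMl; apply: cvgB; last exact: cvg_cst.
  apply: continuous_comp; last exact: continuous_cos.
  by apply: cvgB; [apply: cvgMr; exact: cvg_id|exact: cvg_cst].
have m1 n : measurable_fun I (fun t => (G t * stepp n (arcy x t))%:E).
  by apply/measurable_EFinP; apply: measurable_funM; [exact/measurable_EFinP|exact: mst].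
have m2 : measurable_fun I (fun t => (G t * (t <= x)%R%:R)%:E).
  apply/measurable_EFinP; apply: measurable_funM; first exact/measurable_EFinP.
  rewrite [X in measurable_fun _ X](_ : _ = \1_`]-oo, x]%classic); first exact: measurable_indic.
  by apply/funext => t; rewrite indicE; congr (_%:R); rewrite mem_setE in_itv.
have aec : \forall t \ae mu, I t ->
   (fun n => (G t * stepp n (arcy x t))%:E) @ \oo --> (G t * (t <= x)%R%:R)%:E.
  have n0 : mu.-negligible [set 0; x; 1].
    apply/negligibleP; first by do 2! [apply: measurableU => //]; exact: measurable_set1.
    by apply: countable_lebesgue_measure0; exact: finite_set_countable.
  apply: negligibleS n0 => t /=; apply: contra_notP => nt.
  rewrite /I01 /= in_itv /= => /andP[t0 t1].
  apply: cvg_EFin; first exact: nearW.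
  apply: cvgMr; apply: cvg_stepp_arc => //.
    by rewrite !lt_neqAle t0 t1 !andbT; apply/andP; split; apply/eqP => e; apply: nt; rewrite -?e; [left; left|right].
  by apply/eqP => e; apply: nt; left; right.
have dom : \forall t \ae mu, forall n, I t -> (`|(G t * stepp n (arcy x t))%:E| <= `|(G t)%:E|)%E.
  apply: aeW => t n _; rewrite lee_fin normrM ler_piMr//.
  have /andP[s0 s1] := stepp_bnd n (arcy_bnd x t).
  by rewrite ger0_norm.
have [_ _ cv] := dominated_convergence measurable_Ig m1 m2 aec (integrable_abse iG) dom.
rewrite /Rintegral -(cvg_lim _ cv)//.
rewrite (_ : (fun n => _) = cst 0%E) ?lim_cst//.
apply/funext => n /=; have := h n; rewrite /Rintegral => /eqP; rewrite fine_eq0; first by move/eqP.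
apply: integrable_fin_num => //.
apply: (le_integrable measurable_Ig (m1 n) _ (integrable_abse iG)) => t _.
rewrite /= lee_fin normr_id normrM ler_piMr//.
have /andP[s0 s1] := stepp_bnd n (arcy_bnd x t).
by rewrite ger0_norm.
Qed.

(** The primitive of [G] from 0 vanishes on (0, 1), and by Lebesgue's differentiation theorem its
    derivative is [G] almost everywhere. *)
Lemma ae0_of_arcs (G : R -> R) : mu.-integrable I (EFin \o G) ->
  \int[mu]_(t in I) G t = 0 ->
  (forall x, 0 < x < 1 -> \int[mu]_(t in I) (G t * (t <= x)%R%:R) = 0) ->
  {ae mu, forall t, I t -> G t = 0}.
Proof.
move=> iG G1 Gx.
(* Extended by zero, [G] becomes a function integrable on the whole line, to which the
   differentiation theorem applies. *)
pose H := G \_ I.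
have lH : locally_integrable [set: R] H by exact: integrable_locally_restrict.
have iH : mu.-integrable setT (EFin \o H).
  by rewrite /H -restrict_EFin; exact/(integrable_mkcond _ measurable_Ig).1.
have iHy y : mu.-integrable [set` Interval (BLeft 0) (BRight y)] (EFin \o H).
  by apply: (integrableS _ _ _ iH) => //; exact: measurable_itv.
have F0 y : y != 0 -> y != 1 -> \int[mu]_(t in [set` Interval (BLeft 0) (BRight y)]) H t = 0.
  move=> y0 y1; rewrite /H -Rintegral_mkcondr.
  have [yn|yp] := ltP y 0.
    rewrite [X in Rintegral _ X _](_ : _ = set0) ?Rintegral_set0//.
    apply/seteqP; split => // t /= [+ _]; rewrite in_itv/= => /andP[a b].
    by have := le_lt_trans (le_trans a b) yn; rewrite ltxx.
  have [y1'|y1'] := ltP 1 y.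
    rewrite [X in Rintegral _ X _](_ : _ = I)//.
    apply/seteqP; split => [t /= []//|t]; rewrite /I01 /= in_itv/= => /andP[a b].
    by split; rewrite ?in_itv /= ?a ?b// (le_trans b)// ltW.
  have y01 : 0 < y < 1 by rewrite !lt_neqAle yp y1' y1 eq_sym y0.
  rewrite -[RHS](Gx y y01).
  transitivity (\int[mu]_(t in I) (G \_ [set` Interval (BLeft 0) (BRight y)]) t).
    by rewrite setIC Rintegral_mkcondr.
  apply: eq_Rintegral => t; rewrite inE /I01 /= in_itv/= => /andP[a b].
  rewrite patchE mem_setE in_itv /= a /=.
  by case: leP; rewrite ?mulr1 ?mulr0.
have n0 : mu.-negligible [set (0 : R); 1].
  apply/negligibleP; first by apply: measurableU; exact: measurable_set1.
  by apply: countable_lebesgue_measure0; exact: finite_set_countable.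
have {}n0 : {ae mu, forall t : R, ~ [set (0 : R); 1] t}.
  by apply: negligibleS n0 => t /= /contrapT.
have := FTC1 iHy lH; move: n0.
apply: (@filterS2 _ _ (ae_filter_ringOfSetsType mu)) => t n0 h.
rewrite /I01 /= in_itv /= => /andP[t0 t1].
have {}t0 : 0 < t by rewrite lt_neqAle t0 andbT; apply/eqP => e; apply: n0; left.
have {}t1 : t < 1 by rewrite lt_neqAle t1 andbT; apply/eqP => e; apply: n0; right.
have [_] := h t0.
have -> : H t = G t by rewrite /H patchE mem_setE /I01 in_itv /= ltW //= ltW.
move=> <-; rewrite derive1E.
have -> : 'D_1 (fun x : R => \int[mu]_(t0 in [set` Interval (BLeft 0) (BRight x)]) H t0) t = 'D_1 (cst (0 : R)) t.
  apply: near_eq_derive.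
  have : \forall y \near t, 0 < y < 1.
    by near do [apply/andP; split]; [exact: lt_nbhsr|exact: lt_nbhsl].
  apply: filterS => y /andP[y0 y1]; apply: F0; first by rewrite gt_eqF.
  by rewrite lt_eqF.
by rewrite derive_cst.
Unshelve. all: by end_near. Qed.

Lemma cfunXE f n z : (f ^+ n) z = f z ^+ n.
Proof.
elim: n => [|n IH]; first by rewrite !expr0.
by rewrite !exprS -IH.
Qed.

(** Orthogonality to the powers is orthogonality to all trigonometric polynomials. The polynomials
    [stepp n (arcT x)] are real on the circle, so each part of [f] integrates to 0 against them, and
    in the limit over every arc from 0. *)
Theorem zpow_total f : L2 f -> (forall n, ip f (zpow n) = 0) -> f =T 0.
Proof.
move=> Lf f0.
have [i1 i2] : L1 f.
  have <- : f * conjf (cst 1) = f.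
    by apply/funext => z; rewrite -[LHS]/(f z * conjc 1) conjc1 mulr1.
  by apply: L1M => //; apply: L2_conj; exact: L2_cst.
have key n x : ip f (1 - (1 - arcT x ^+ n) ^+ (2 ^ n)) = 0.
  have T1 : trigpoly (1 : cfun R) by exact: trig_cst.
  have TN g : trigpoly g -> trigpoly (1 - g) by rewrite -scaleN1r => tg; apply: trigD => //; exact: trigZ.
  by apply: ip_trig => //; do 2! [apply: (TN); apply: trigX]; exact: trig_arcT.
have key' n x : \int[mu]_(t in I) (reT f t * stepp n (arcy x t)) = 0 /\
   \int[mu]_(t in I) (imT f t * stepp n (arcy x t)) = 0.
  have [|h1 h2] := @trig_real (fun z => stepp n (Re (arcT x z))) _ f Lf _ (key n x).
  - move=> t; rewrite -[LHS]/(1 - ((1 - arcT x ^+ n) ^+ (2 ^ n)) (c t)) cfunXE.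
    rewrite -[X in 1 - X ^+ _]/(1 - (arcT x ^+ n) (c t)) cfunXE arcTE /stepp /=.
    by rewrite rmorphB rmorphXn rmorphB rmorphXn rmorph1.
  - split; [rewrite -[RHS]h1|rewrite -[RHS]h2]; apply: eq_Rintegral => t _; rewrite arcTE //.
have Z : ip f (zpow 0) = 0 := f0 0.
have [|Z1 Z2] := @trig_real (fun=> 1) _ f Lf _ Z; first by move=> t; rewrite /zpow expr0z.
have A1 : {ae mu, forall t, I t -> reT f t = 0}.
  apply: ae0_of_arcs => //.
    by rewrite -[RHS]Z1; apply: eq_Rintegral => t _; rewrite mulr1.
  by move=> x x01; apply: Rint_arc0 => // n; exact: (key' n x).1.
have A2 : {ae mu, forall t, I t -> imT f t = 0}.
  apply: ae0_of_arcs => //.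
    by rewrite -[RHS]Z2; apply: eq_Rintegral => t _; rewrite mulr1.
  by move=> x x01; apply: Rint_arc0 => // n; exact: (key' n x).2.
move: A1 A2; apply: (@filterS2 _ _ (ae_filter_ringOfSetsType mu)) => t h1 h2 It.
by apply: complex_eq; [exact: h1|exact: h2].
Qed.

End totality.

(** * The substitution of z^N, as an isometry of L^2 *)

Section Wstar.
Context {R : realType}.
Local Notation mu := (@lebesgue_measure R).
Local Notation I := (@I01 R).
Local Notation c := (@circle_pt R).
Implicit Types f g h : cfun R.
#[local] Hint Extern 0 (measurable _) => solve [exact: measurable_I | exact: measurable_Ig] : core.
Local Notation Re := complex.Re.
Local Notation Im := complex.Im.

Variable N : nat.
Hypothesis N_gt0 : (0 < N)%N.

Let N0 : (0 : R) < N%:R. Proof. by rewrite ltr0n. Qed.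
Let Nn0 : (N%:R : R) != 0. Proof. by rewrite gt_eqF. Qed.

Let r : {nonneg R} := (N%:R : R)%:nng.
Let phi (j : nat) (t : R) : R := N%:R * t - j%:R.
Let E (j : nat) : set R := `[j%:R / N%:R, j.+1%:R / N%:R[%classic.

Let measurable_phi j :
  measurable_fun [set: measurableTypeR R] (phi j : measurableTypeR R -> measurableTypeR R).
Proof.
apply: continuous_measurable_fun => t; apply: cvgB; last exact: cvg_cst.
by apply: cvgMr; exact: cvg_id.
Qed.

Let phi_preimage j : phi j @^-1` `[0, 1[%classic = E j.
Proof.
apply/seteqP; split => t; rewrite /E /phi /= !in_itv /= -natr1 ler_pdivrMr// ltr_pdivlMr//; lra.
Qed.

(** The change of variables [s = N t - j]: the two measures agree on half-open intervals, which
    determine Lebesgue measure. *)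
Let pushforward_phi j (A : set R) : measurable A ->
  mu A = pushforward (mscale r mu) (phi j : measurableTypeR R -> measurableTypeR R) A.
Proof.
move=> mA; apply: lebesgue_measure_unique => //= _ [[a b] _ <-].
rewrite /pushforward /mscale /=.
have -> : phi j @^-1` `]a, b]%classic = `](a + j%:R) / N%:R, (b + j%:R) / N%:R]%classic.
  by apply/seteqP; split => t; rewrite /phi /= !in_itv /= ltr_pdivrMr// ler_pdivlMr//; lra.
rewrite !lebesgue_measure_itv /= !lte_fin ltr_pM2r ?invr_gt0// ltrD2r.
case: ifP => _; last by rewrite mule0.
by rewrite -!EFinB -EFinM; congr (_%:E); field.
Qed.

Let bigsetU_E n : \big[setU/set0]_(i <- iota 0 n) E i = `[0, n%:R / N%:R[%classic.
Proof.
elim: n => [|n IH]; first by rewrite big_nil mul0r set_itvco0.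
rewrite -addn1 iotaD big_cat big_seq1 IH /= add0n /E addn1.
apply/seteqP; split => t; rewrite /= !in_itv /= -natr1 !ler_pdivrMr// !ltr_pdivlMr//.
- by have : (0 : R) <= n%:R by []; rewrite -(pmulr_lge0 t N0); lra.
- case/andP => t0 tn; case: (ltP (t * N%:R) n%:R) => h; [left|right]; lra.
Qed.

Let circle_phi j t : c t ^+ N = c (phi j t).
Proof.
rewrite /phi circle_ptD circle_ptN circle_pt_nat invr1 mulr1 circle_ptX //.
Qed.

Let measurable_comp_phi (F : R[i] -> R) j : measurable_fun I (fun t => F (c t)) ->
  measurable_fun (E j) (fun t => F (c (phi j t))).
Proof.
move=> mF.
apply: (@measurable_comp _ _ _ (measurableTypeR R) (measurableTypeR R) R
  `[0%R, 1%R[%classic (fun t => F (c t)) (E j) (phi j)).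
- exact: measurable_itv.
- by rewrite -(phi_preimage j); exact: image_preimage_subset.
- apply: measurable_funS mF => //.
  by move=> t; rewrite /I01 /= !in_itv /= => /andP[-> /ltW].
- exact: measurable_funTS.
Qed.

(** Measurability is known for parameters in [0, 1] only, whereas [N * t] leaves this interval. On
    [E j] the parameter [N * t - j], which has the same point of the circle, lies in [0, 1). *)
Let measurable_piece (F : R[i] -> R) : measurable_fun I (fun t => F (c t)) ->
  measurable_fun I (fun t => F (c t ^+ N)).
Proof.
(* The union runs over all [j], because [t = 1] lies in [E N]. *)
move=> mF; apply: (@measurable_funS _ _ _ _ (\bigcup_j E j)).
- by apply: bigcup_measurable => j _; exact: measurable_itv.
- move=> t; rewrite /I01 /= in_itv /= => /andP[t0 t1].
  pose j := Num.trunc (t * N%:R).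
  have /andP[j1 j2] : (j%:R <= t * N%:R < j.+1%:R)%R by apply: trunc_itv; rewrite mulr_ge0// ltW.
  by exists j => //; rewrite /E /= in_itv /= ler_pdivrMr// ltr_pdivlMr// j1 j2.
- apply/measurable_fun_bigcup; first by move=> j; exact: measurable_itv.
  move=> j; under [X in measurable_fun _ X]eq_fun do rewrite (circle_phi j).
  exact: measurable_comp_phi.
Qed.

Lemma measurableT_Wstar g : measurableT g -> measurableT (Wstar N g).
Proof.
move=> [m1 m2]; split; first exact: (@measurable_piece (fun z => Re (g z))).
exact: (@measurable_piece (fun z => Im (g z))).
Qed.

(** The map z to z^N covers the circle [N] times; each piece [E j] carries the whole integral
    divided by [N]. *)
Let int_piece (F : R[i] -> R) : (forall z, 0 <= F z) -> measurable_fun I (fun t => F (c t)) ->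
  (\int[mu]_(t in I) (F (c t ^+ N))%:E = \int[mu]_(t in I) (F (c t))%:E)%E.
Proof.
move=> F0 mF; have mFN := measurable_piece mF.
have sub : `[0, 1[%classic `<=` I by move=> t; rewrite /I01 /= !in_itv /= => /andP[-> /ltW].
have mo (G : R -> R) : measurable_fun I G -> measurable_fun (`[0%R, 1%R[%classic : set R) (fun t => (G t)%:E).
  by move=> mG; apply/measurable_EFinP; exact: measurable_funS sub mG.
rewrite /I01 -integral_itv_bndo_bndc; last exact: mo.
rewrite -integral_itv_bndo_bndc; last exact: mo.
have E1 : `[0, 1[%classic = \big[setU/set0]_(i <- iota 0 N) E i :> set R by rewrite bigsetU_E divff.
have step j : (\int[mu]_(t in E j) (F (c t ^+ N))%:E = (N%:R^-1)%:E * \int[mu]_(t in `[0%R, 1%R[) (F (c t))%:E)%E.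
  transitivity (\int[mu]_(t in E j) ((fun t => (F (c t))%:E) \o phi j) t)%E.
    by apply: eq_integral => t _; rewrite /= (circle_phi j).
  have -> : (\int[mu]_(t in `[0%R, 1%R[) (F (c t))%:E =
    \int[pushforward (mscale r mu) (phi j : measurableTypeR R -> measurableTypeR R)]_(t in `[0%R, 1%R[) (F (c t))%:E)%E.
    by apply: eq_measure_integral => A mA _; exact: pushforward_phi.
  rewrite ge0_integral_pushforward//; first last.
  - by move=> t _; rewrite lee_fin.
  - exact: mo.
  rewrite phi_preimage ge0_integral_mscale//; first last.
  - by move=> t _; rewrite lee_fin.
  - by apply/measurable_EFinP; exact: measurable_comp_phi.
  - exact: measurable_itv.
  by rewrite muleA -EFinM mulVf// mul1e.
rewrite [in LHS]E1 ge0_integral_bigsetU//=; first last.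
- by move=> t _; rewrite lee_fin.
- by rewrite -E1; exact: mo.
- apply/trivIsetP => i j _ _ ij; apply/seteqP; split => // t [].
  rewrite /E /= !in_itv /= !ler_pdivrMr// !ltr_pdivlMr// => /andP[a1 a2] /andP[b1 b2].
  move: ij; rewrite neq_ltn => /orP[]; rewrite -(ler_nat R) => h.
    by have := lt_le_trans a2 (le_trans h b1); rewrite ltxx.
  by have := lt_le_trans b2 (le_trans h a1); rewrite ltxx.
- exact: iota_uniq.
- by move=> i; exact: measurable_itv.
under eq_bigr do rewrite step.
rewrite -ge0_sume_distrl; last by move=> *; rewrite lee_fin invr_ge0 ltW.
rewrite sumEFin big_const_seq count_predT size_iota iter_addr_0 -[X in X%:E]mulr_natr mulVf// mul1e.
by apply: eq_integral.
Qed.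

Lemma L2_Wstar g : L2 g -> L2 (Wstar N g).
Proof.
move=> [mg ig]; split; first exact: measurableT_Wstar.
rewrite (_ : (\int[_]_(_ in _) _)%E = (\int[mu]_(t in I) (Normc.normc (g (c t)) ^+ 2)%:E)%E) //.
apply: (@int_piece (fun z => Normc.normc (g z) ^+ 2)) => [z|]; first exact: sqr_ge0.
exact: measurable_sqT.
Qed.

Lemma norm2_Wstar g : L2 g -> norm2 (Wstar N g) = norm2 g.
Proof.
move=> [mg _]; rewrite !norm2E; congr Num.sqrt; rewrite /Rintegral; congr fine.
apply: (@int_piece (fun z => Normc.normc (g z) ^+ 2)) => [z|]; first exact: sqr_ge0.
exact: measurable_sqT.
Qed.

(** Polarization of [norm2_Wstar]. *)
Lemma ip_Wstar f g : L2 f -> L2 g -> ip (Wstar N f) (Wstar N g) = ip f g.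
Proof.
move=> Lf Lg.
have pol (u v : cfun R) : L2 u -> L2 v -> ip u v =
    4^-1 * (ip (u + v) (u + v) - ip (u - v) (u - v)
     + 'i%C * (ip (u + 'i%C *: v) (u + 'i%C *: v) - ip (u - 'i%C *: v) (u - 'i%C *: v))).
  move=> Lu Lv; have Liv := L2Z 'i%C Lv.
  rewrite !ipDl// ?ipDr// ?ipNl// ?ipNr//; try exact: L2N; try exact: L2D; try exact: L2B.
  rewrite !(ipZl, ipZr)//.
  have -> : conjc 'i%C = - 'i%C :> R[i] by apply: complex_eq; rewrite /= ?oppr0.
  have := sqr_i R; rewrite expr2 => ii.
  by field: ii.
have s (u : cfun R) : L2 u -> ip (Wstar N u) (Wstar N u) = ip u u.
  by move=> Lu; rewrite -!sqr_norm2 norm2_Wstar.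
rewrite (pol _ _ (L2_Wstar Lf) (L2_Wstar Lg)) (pol _ _ Lf Lg).
have Lig := L2Z 'i%C Lg.
by rewrite -(s _ (L2D Lf Lg)) -(s _ (L2B Lf Lg)) -(s _ (L2D Lf Lig)) -(s _ (L2B Lf Lig)).
Qed.

End Wstar.

(** * Fourier expansions, Riesz representation, the operator [W], projection onto H^2 *)

Section hilbert.
Context {R : realType}.
Local Notation c := (@circle_pt R).
Implicit Types f g h : cfun R.
Local Notation Re := complex.Re.
Local Notation Im := complex.Im.

Definition cvgL2 (u : nat -> cfun R) g : Prop :=
  forall e : R, 0 < e -> exists N, forall n, (N <= n)%N -> norm2 (u n - g) <= e.

Definition cvgC (x : nat -> R[i]) (l : R[i]) : Prop :=
  forall e : R, 0 < e -> exists N, forall n, (N <= n)%N -> Normc.normc (x n - l) <= e.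

Lemma real_sum (J : Type) (r : seq J) (P : pred J) (F : J -> R) :
  (\sum_(j <- r | P j) F j)%:C%C = \sum_(j <- r | P j) (F j)%:C%C :> R[i].
Proof. exact: (rmorph_sum (real_complex R)). Qed.

Lemma cvgC_unique x l l' : cvgC x l -> cvgC x l' -> l = l'.
Proof.
move=> h h'; apply/eqP; rewrite -subr_eq0; apply/eqP; apply: Normc.eq0_normc.
apply/eqP; rewrite eq_le normc_ge0 andbT; apply/ler_addgt0Pl => e e0; rewrite addr0.
have e2 : 0 < e / 2 by rewrite divr_gt0.
have [N hN] := h _ e2; have [N' hN'] := h' _ e2.
have -> : l - l' = - (x (maxn N N') - l) + (x (maxn N N') - l') by ring.
apply: le_trans (le_normcD _ _) _; rewrite normcN [leRHS]splitr lerD//.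
  by rewrite hN// leq_maxl.
by rewrite hN'// leq_maxr.
Qed.

Lemma cvgC_near x y l : (exists N, forall n, (N <= n)%N -> x n = y n) -> cvgC x l -> cvgC y l.
Proof.
move=> [N hN] h e e0; have [N' hN'] := h _ e0.
by exists (maxn N N') => n; rewrite geq_max => /andP[n1 n2]; rewrite -hN// hN'.
Qed.

Lemma cvgC_cst l : cvgC (fun=> l) l.
Proof. by move=> e e0; exists 0%N => n _; rewrite subrr Normc.normc0 ltW. Qed.

Lemma cvgC_D x y l l' : cvgC x l -> cvgC y l' -> cvgC (fun n => x n + y n) (l + l').
Proof.
move=> h h' e e0; have e2 : 0 < e / 2 by rewrite divr_gt0.
have [N hN] := h _ e2; have [N' hN'] := h' _ e2.
exists (maxn N N') => n; rewrite geq_max => /andP[n1 n2].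
rewrite opprD addrACA; apply: le_trans (le_normcD _ _) _.
by rewrite [leRHS]splitr lerD// ?hN// hN'.
Qed.

Lemma cvgC_sum (J : Type) (r : seq J) (P : pred J) (x : J -> nat -> R[i]) (l : J -> R[i]) :
  (forall j, P j -> cvgC (x j) (l j)) ->
  cvgC (fun n => \sum_(j <- r | P j) x j n) (\sum_(j <- r | P j) l j).
Proof.
move=> h; elim: r => [|j r IH].
  by rewrite big_nil; apply: cvgC_near (cvgC_cst 0); exists 0%N => n _; rewrite big_nil.
rewrite big_cons; case: ifP => Pj.
  by apply: cvgC_near (cvgC_D (h _ Pj) IH); exists 0%N => n _; rewrite big_cons Pj.
by apply: cvgC_near IH; exists 0%N => n _; rewrite big_cons Pj.
Qed.

Lemma cvgC_bound (x : nat -> R[i]) l (b : nat -> R) C :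
  (forall n, 0 <= b n) -> (forall n, Normc.normc (x n - l) <= C * b n) ->
  (forall e : R, 0 < e -> exists N, forall n, (N <= n)%N -> b n <= e) -> cvgC x l.
Proof.
move=> b0 h hb e e0; have C0 : 0 < `|C| + 1 by rewrite ltr_wpDl.
have [N hN] := hb (e / (`|C| + 1)) (divr_gt0 e0 C0).
exists N => n /hN; rewrite ler_pdivlMr// => le1; apply: le_trans (h n) _.
apply: le_trans le1; rewrite mulrC ler_wpM2l//.
by rewrite (le_trans (ler_norm _))// lerDl.
Qed.

Lemma cvgL2_ip u g h : (forall n, L2 (u n)) -> L2 g -> L2 h -> cvgL2 u g ->
  cvgC (fun n => ip (u n) h) (ip g h).
Proof.
move=> Lu Lg Lh ug; apply: (@cvgC_bound _ _ (fun n => norm2 (u n - g)) (norm2 h)) => // n; first exact: norm2_ge0.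
rewrite -ipBl// mulrC; apply: cauchy_schwarz => //; exact: L2B.
Qed.

Lemma cvgL2_eqT u g g' : (forall n, L2 (u n)) -> L2 g -> L2 g' -> g =T g' -> cvgL2 u g -> cvgL2 u g'.
Proof.
move=> Lu Lg Lg' gg h e e0; have [N hN] := h _ e0; exists N => n nN.
rewrite -(@norm2_eqT _ (u n - g)) ?hN//; try exact: L2B.
by apply: aeT_imp gg => t gg; rewrite -[LHS]/(u n (c t) - _) gg.
Qed.

Section orthonormal.
Variable e : nat -> cfun R.
Hypothesis Le : forall j, L2 (e j).
Hypothesis ortho : forall i j, ip (e i) (e j) = (i == j)%:R.

Definition psum (a : nat -> R[i]) n : cfun R := \sum_(j < n) a j *: e j.

Lemma L2_psum a n : L2 (psum a n).
Proof. by apply: L2_sum => j _; exact: L2Z. Qed.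

Lemma ip_psum_e a n j : ip (psum a n) (e j) = if (j < n)%N then a j else 0.
Proof.
rewrite /psum ip_suml//; last by move=> i _; exact: L2Z.
under eq_bigr do rewrite ipZl// ortho.
case: ltnP => jn.
  rewrite (bigD1 (Ordinal jn))//= eqxx mulr1 big1 ?addr0// => i.
  by rewrite -val_eqE /= => /negbTE ->; rewrite mulr0.
by rewrite big1// => i _; rewrite (ltn_eqF (leq_trans (ltn_ord i) jn)) mulr0.
Qed.

Lemma ip_psum a b n m : (n <= m)%N -> ip (psum b m) (psum a n) = \sum_(j < n) b j * conjc (a j).
Proof.
move=> nm; rewrite {2}/psum ip_sumr//; [|by move=> i _; exact: L2Z|exact: L2_psum].
apply: eq_bigr => j _; rewrite ipZr//; last exact: L2_psum.
by rewrite ip_psum_e (leq_trans (ltn_ord j) nm) mulrC.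
Qed.

Let sq (a : nat -> R[i]) n : R := \sum_(j < n) Normc.normc (a j) ^+ 2.

Let sqE (a : nat -> R[i]) n : \sum_(j < n) a j * conjc (a j) = (sq a n)%:C%C.
Proof. by rewrite /sq real_sum; apply: eq_bigr => j _; rewrite normcJ2. Qed.

Let sq_nd a : {homo sq a : n m / (n <= m)%N >-> n <= m}.
Proof.
apply/nondecreasing_seqP => n; rewrite /sq big_ord_recr /= lerDl; exact: sqr_ge0.
Qed.

Let norm_psumB a n m : (n <= m)%N -> norm2 (psum a m - psum a n) ^+ 2 = sq a m - sq a n.
Proof.
move=> nm; apply: (@complexI R); rewrite sqr_norm2.
have -> : (sq a m - sq a n)%:C%C = \sum_(j < m) a j * conjc (a j) - \sum_(j < n) a j * conjc (a j) :> R[i].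
  by rewrite !sqE; exact: (rmorphB (real_complex R)).
have Lp := L2_psum a.
rewrite ipBl//; last exact: L2B.
rewrite !ipBr// (ip_psum _ _ (leqnn m)) (ip_psum _ _ (leqnn n)) (ip_psum _ _ nm).
by rewrite (ipC (Lp m) (Lp n)) (ip_psum _ _ nm) !sqE conjc_real subrr subr0.
Qed.

(** The sums of squares are nondecreasing and bounded, hence Cauchy, and their increments are the
    squared distances between the partial sums [psum a n]. *)
Theorem riesz_fischer (a : nat -> R[i]) (C : R) : (forall n, \sum_(j < n) Normc.normc (a j) ^+ 2 <= C) ->
  exists2 g, L2 g & cvgL2 (psum a) g.
Proof.
move=> hC; apply: L2_complete; first exact: L2_psum.
have cs : cvgn (sq a).
  by apply: nondecreasing_is_cvgn => //; exists C => _ [n _ <-]; exact: hC.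
move=> d d0; have d2 : 0 < d ^+ 2 / 2 by rewrite divr_gt0 ?exprn_gt0.
have [N _ hN] := (cvgrPdist_le _ _).1 cs _ d2.
exists N => n m.
wlog nm : n m / (n <= m)%N => [hw|].
  have [nm|/ltnW mn] := leqP n m; first exact: hw.
  by move=> n1 m1; rewrite -opprB norm2N ?hw//; apply: L2B; exact: L2_psum.
move=> n1 m1; rewrite -opprB norm2N; last by apply: L2B; exact: L2_psum.
rewrite -(@ler_pXn2r _ 2)// ?nnegrE ?norm2_ge0 ?(ltW d0)// norm_psumB//.
have := hN _ n1; have := hN _ m1; rewrite /= !ler_norml => /andP[a1 a2] /andP[b1 b2].
by rewrite [leRHS]splitr; lra.
Qed.

Lemma cvg_psum_coef a g : L2 g -> cvgL2 (psum a) g -> forall j, ip g (e j) = a j.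
Proof.
move=> Lg cg j; apply: cvgC_unique (cvgL2_ip (L2_psum a) Lg (Le j) cg) _.
apply: cvgC_near (cvgC_cst (a j)).
by exists j.+1 => n nj; rewrite ip_psum_e nj.
Qed.

Lemma cvg_psum_orth a g h : L2 g -> L2 h -> cvgL2 (psum a) g -> (forall j, ip (e j) h = 0) -> ip g h = 0.
Proof.
move=> Lg Lh cg h0; apply: cvgC_unique (cvgL2_ip (L2_psum a) Lg Lh cg) _.
apply: cvgC_near (cvgC_cst 0); exists 0%N => n _.
rewrite ip_suml//; last by move=> i _; exact: L2Z.
by rewrite big1// => i _; rewrite ipZl// h0 mulr0.
Qed.

Lemma bessel f n : L2 f -> \sum_(j < n) Normc.normc (ip f (e j)) ^+ 2 <= norm2 f ^+ 2.
Proof.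
move=> Lf; set a := fun j => ip f (e j); rewrite -[leLHS]/(sq a n).
have Lp := L2_psum a n.
have fp : ip f (psum a n) = (sq a n)%:C%C.
  rewrite /psum ip_sumr//; last by move=> i _; exact: L2Z.
  by rewrite -sqE; apply: eq_bigr => j _; rewrite ipZr// mulrC.
have := ipff_ge0 (f - psum a n).
rewrite ipBl//; last exact: L2B.
rewrite !ipBr// (ip_psum _ _ (leqnn n)) (ipC Lf Lp) fp sqE conjc_real subrr subr0.
by rewrite -sqr_norm2 -rmorphB ler0c subr_ge0.
Qed.

Lemma fourier_cvg f : L2 f -> exists2 g, L2 g & cvgL2 (psum (fun j => ip f (e j))) g.
Proof. by move=> Lf; apply: (@riesz_fischer _ (norm2 f ^+ 2)) => n; exact: bessel. Qed.

End orthonormal.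

(** The order 0, -1, 1, -2, ... of the integers, by which results on sequences indexed by [nat]
    apply to two-sided Fourier series. *)
Definition int_enum (n : nat) : int := if odd n then Negz n./2 else Posz n./2.

Lemma int_enum_inj : injective int_enum.
Proof.
move=> n m; rewrite /int_enum => h.
rewrite -(odd_double_half n) -(odd_double_half m).
by case: (odd n) (odd m) h => -[] // [->].
Qed.

Lemma int_enum_surj (k : int) : exists n, int_enum n = k.
Proof.
case: k => k; [exists k.*2|exists k.*2.+1]; rewrite /int_enum /= ?odd_double ?doubleK//.
by rewrite uphalf_double.
Qed.

Let ez (j : nat) : cfun R := zpow (int_enum j).
Let Lez j : L2 (ez j). Proof. exact: L2_zpow. Qed.
Let ortho_ez i j : ip (ez i) (ez j) = (i == j)%:R.
Proof. by rewrite ip_zpow (inj_eq int_enum_inj). Qed.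

Lemma eqT_zpow f g : L2 f -> L2 g -> (forall n, ip f (zpow n) = ip g (zpow n)) -> f =T g.
Proof.
move=> Lf Lg h; apply: subr_eqT; apply: zpow_total; first exact: L2B.
by move=> n; rewrite ipBl ?h ?subrr//; exact: L2_zpow.
Qed.

(** Completeness provides some limit with the coefficients of [f]; totality identifies it with
    [f]. *)
Lemma fourier_cvg_total f : L2 f -> cvgL2 (psum ez (fun j => ip f (ez j))) f.
Proof.
move=> Lf; have [g Lg cg] := fourier_cvg Lez ortho_ez Lf.
apply: cvgL2_eqT (cg) => //; first exact: L2_psum.
apply: eqT_zpow => // k; have [j <-] := int_enum_surj k.
exact: (cvg_psum_coef Lez ortho_ez Lg cg).
Qed.

(** The representing element is the sum of the Fourier series with coefficients
    [conjc (l (ez j))]. *)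
Theorem riesz_representation (l : cfun R -> R[i]) (C : R) :
  (forall a f g, L2 f -> L2 g -> l (a *: f + g) = a * l f + l g) ->
  (forall f, L2 f -> Normc.normc (l f) <= C * norm2 f) ->
  exists2 h, L2 h & forall f, L2 f -> l f = ip f h.
Proof.
move=> lin bnd.
have l0 : l 0 = 0.
  have := lin 1 0 0 L2_0 L2_0; rewrite scale1r addr0 mul1r => /eqP.
  by rewrite -subr_eq0 opprD addrA subrr sub0r oppr_eq0 => /eqP.
pose a j := conjc (l (ez j)).
have lps b n : l (psum ez b n) = \sum_(j < n) b j * l (ez j).
  rewrite /psum; elim: n => [|n IH]; first by rewrite !big_ord0.
  rewrite !big_ord_recr /= addrC lin//; first by rewrite IH addrC.
  exact: (L2_psum Lez b n).
(* On the partial sum with these same coefficients, of norm [x], the value of [l] is [x^2]; the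
   bound on [l] gives [x^2 <= C x], hence [x^2 <= C^2]. *)
have bd n : \sum_(j < n) Normc.normc (a j) ^+ 2 <= C ^+ 2.
  have E : l (psum ez a n) = (\sum_(j < n) Normc.normc (a j) ^+ 2)%:C%C.
    rewrite lps real_sum; apply: eq_bigr => j _; rewrite -normcJ2.
    by rewrite /a conjcK mulrC.
  have F : norm2 (psum ez a n) ^+ 2 = \sum_(j < n) Normc.normc (a j) ^+ 2.
    apply: (@complexI R); rewrite sqr_norm2 (ip_psum Lez ortho_ez _ _ (leqnn n)).
    by rewrite real_sum; apply: eq_bigr => j _; rewrite -normcJ2.
  have := bnd _ (L2_psum Lez a n); rewrite E -F.
  have n0 := norm2_ge0 (psum ez a n); move: (norm2 _) n0 => x x0.
  rewrite /= expr0n addr0 sqrtr_sqr ger0_norm ?sqr_ge0// => h.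
  have [->|xn] := eqVneq x 0; first by rewrite expr0n sqr_ge0.
  have xp : 0 < x by rewrite lt_neqAle eq_sym xn.
  by move: h; rewrite expr2 ler_pM2r// => h; nra.
have [h Lh ch] := riesz_fischer Lez ortho_ez bd.
exists h => // f Lf.
have hc := cvg_psum_coef Lez ortho_ez Lh ch.
pose b j := ip f (ez j).
apply: (cvgC_unique _ (cvgL2_ip (L2_psum Lez b) Lf Lh (fourier_cvg_total Lf))).
apply: (@cvgC_bound _ _ (fun n => norm2 (psum ez b n - f)) C) => [n|n|]; [exact: norm2_ge0| |exact: fourier_cvg_total].
have Lp := L2_psum Lez b n.
have -> : ip (psum ez b n) h = l (psum ez b n).
  rewrite lps /psum ip_suml//; last by move=> j _; exact: L2Z.
  apply: eq_bigr => j _; rewrite ipZl// (ipC Lh (Lez j)) hc /a conjcK//.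
have -> : l (psum ez b n) - l f = l (psum ez b n - f).
  by rewrite -[- f]scaleN1r (addrC (psum ez b n)) lin// mulN1r addrC.
by apply: bnd; exact: L2B.
Qed.

Lemma WstarD N f g : Wstar N (f + g) = Wstar N f + Wstar N g. Proof. by []. Qed.
Lemma WstarZ N a f : Wstar N (a *: f) = a *: Wstar N f. Proof. by []. Qed.

Lemma WstarE N f z : Wstar N f z = f (z ^+ N). Proof. by []. Qed.

Lemma Wstar_zpow N (n : int) t : Wstar N (zpow n) (c t) = zpow (N%:Z * n) (c t).
Proof. by rewrite /Wstar /zpow !circle_ptX !circle_ptXz mulrCA mulrA rmorphM. Qed.

Opaque Wstar zpow.

Section W.
Variable N : nat.
Hypothesis N_gt0 : (0 < N)%N.

Let adjW f : L2 f -> exists w, L2 w /\ forall g, L2 g -> ip (Wstar N g) f = ip g w.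
Proof.
move=> Lf; have [|g Lg|w Lw hw] := @riesz_representation (fun g => ip (Wstar N g) f) (norm2 f).
- by move=> a g h Lg Lh; rewrite WstarD WstarZ ip_linl//; exact: L2_Wstar.
- apply: le_trans (cauchy_schwarz _ _) _ => //; first exact: L2_Wstar.
  by rewrite norm2_Wstar// mulrC.
by exists w.
Qed.

(** The witness is the adjoint of the isometry [Wstar N], obtained from the Riesz representation. *)
Lemma is_W_exists : exists T : cop R, is_W N T.
Proof.
pose T f := xget 0 [set w | L2 w /\ forall g, L2 g -> ip (Wstar N g) f = ip g w].
have TP f : L2 f -> L2 (T f) /\ forall g, L2 g -> ip (Wstar N g) f = ip g (T f).
  move=> Lf; have [w hw] := adjW Lf.
  by apply: (@xgetPex _ 0 [set w | L2 w /\ forall g, L2 g -> ip (Wstar N g) f = ip g w]); exists w.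
clearbody T; exists T; split; first split.
- by move=> f /TP[].
- move=> a f g Lf Lg.
  have [L1 h1] := TP f Lf; have [L3 h3] := TP g Lg.
  have [L4 h4] := TP _ (L2D (L2Z a Lf) Lg).
  have L5 : L2 (a *: T f + T g) by apply: L2D => //; exact: L2Z.
  apply: eqT_zpow => // n; have Lz := @L2_zpow R n.
  rewrite (ipC Lz L4) (ipC Lz L5) -h4//; congr conjc.
  have LW := L2_Wstar N_gt0 Lz.
  rewrite (ipDr LW (L2Z a Lf) Lg) (ipDr Lz (L2Z a L1) L3).
  by rewrite (ipZr a LW Lf) (ipZr a Lz L1) h1// h3.
- exists 1 => f Lf; have [L1 h1] := TP f Lf; rewrite mul1r.
  have [->|tn] := eqVneq (norm2 (T f)) 0; first exact: norm2_ge0.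
  have tp : 0 < norm2 (T f) by rewrite lt_neqAle eq_sym tn norm2_ge0.
  rewrite -(ler_pM2l tp) -expr2.
  have -> : norm2 (T f) ^+ 2 = Re (ip (Wstar N (T f)) f) by rewrite h1// -sqr_norm2.
  rewrite (le_trans (ler_norm _))// (le_trans (Re_le_normc _))//.
  rewrite (le_trans (cauchy_schwarz _ _))//; first exact: L2_Wstar.
  by rewrite norm2_Wstar.
- move=> n; have [L1 h1] := TP _ (@L2_zpow R n).
  have L3 : L2 (if (N%:Z %| n)%Z then @zpow R (n %/ N%:Z)%Z else 0).
    by case: ifP => _; [exact: L2_zpow|exact: L2_0].
  apply: eqT_zpow => // k; have Lz := @L2_zpow R k.
  rewrite (ipC Lz L1) (ipC Lz L3) -h1//; congr conjc.
  rewrite (ip_ext (f' := zpow (N%:Z * k)) (g' := zpow n)) => [|t]; last by rewrite Wstar_zpow.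
  rewrite ip_zpow; case: ifP => dn.
    rewrite ip_zpow; congr (_%:R); rewrite -{1}(divzK dn) mulrC.
    by rewrite (inj_eq (mulIf _))//; case: (N) N_gt0.
  rewrite ip0r//; case: eqP => // e; move: dn; rewrite -e dvdz_mulr//.
Qed.

Lemma is_W_W : is_W N (@W R N).
Proof. by have [T hT] := is_W_exists; exact: (xgetPex 0 (ex_intro _ T hT)). Qed.

Lemma L2_W f : L2 f -> L2 (W N f).
Proof. by have [[h _ _] _] := is_W_W; exact: h. Qed.

(** [W N] is an unspecified operator satisfying [is_W], so only its linearity, its bound and its
    values on powers are available. The functional [f |-> ip (W N f) g] has a representing element,
    and its Fourier coefficients are compared with those of [Wstar N g]. *)
Lemma ip_W f g : L2 f -> L2 g -> ip (W N f) g = ip f (Wstar N g).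
Proof.
move=> Lf Lg; have [[LW linW [C bW]] Wz] := is_W_W.
have LWg := L2_Wstar N_gt0 Lg.
have [||w Lw hw] := @riesz_representation (fun f => ip (W N f) g) (C * norm2 g).
- move=> a f1 f2 L1 L3.
  rewrite (ip_eqTl _ _ Lg (linW a f1 f2 L1 L3)) ?ip_linl//; try exact: LW.
    by apply: LW; apply: L2D => //; exact: L2Z.
  by apply: L2D; [apply: L2Z; exact: LW|exact: LW].
- move=> f1 L1; apply: le_trans (cauchy_schwarz (LW _ L1) Lg) _.
  by rewrite -mulrA [_ * norm2 f1]mulrC mulrA ler_wpM2r ?norm2_ge0// bW.
rewrite hw//; apply: ip_eqTr => //; apply: eqT_zpow => // n.
have Ln := @L2_zpow R n.
rewrite (ipC Ln Lw) (ipC Ln LWg) -hw//; congr conjc.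
have L3 : L2 (if (N%:Z %| n)%Z then @zpow R (n %/ N%:Z)%Z else 0).
  by case: ifP => _; [exact: L2_zpow|exact: L2_0].
rewrite (ip_eqTl _ _ Lg (Wz n))//; last exact: LW.
case: ifP => dn.
  rewrite -(ip_Wstar N_gt0)//; last exact: L2_zpow.
  by apply: ip_ext => t; rewrite Wstar_zpow (mulrC N%:Z) divzK.
(* When [N] does not divide [n], the [n]-th coefficient of [Wstar N g] has to vanish. It equals
   [ip g v], where [v] is the image of [zpow n] under the adjoint of [Wstar N], and every
   coefficient of [v] is 0. *)
rewrite ip0l; have [v [Lv hv]] := adjW Ln.
rewrite (ipC LWg Ln) hv// (ip_eqTr (g := 0)) ?ip0r ?conjc0//; first exact: L2_0.
apply: eqT_zpow => //; first exact: L2_0.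
move=> k; have Lk := @L2_zpow R k; rewrite ip0l (ipC Lk Lv) -hv//.
rewrite (ip_ext (f' := zpow (N%:Z * k)) (g' := zpow n)) => [|t]; last by rewrite Wstar_zpow.
rewrite ip_zpow; case: eqP => [e|_]; last by rewrite conjc0.
by move: dn; rewrite -e dvdz_mulr.
Qed.

End W.

Definition en (j : nat) : cfun R := zpow j.
Lemma L2_en j : L2 (en j). Proof. exact: L2_zpow. Qed.
Lemma ortho_en i j : ip (en i) (en j) = (i == j)%:R.
Proof. by rewrite ip_zpow. Qed.

Definition fsum f : nat -> cfun R := psum en (fun j => ip f (en j)).

Lemma L2_fsum f n : L2 (fsum f n).
Proof. exact: (L2_psum L2_en). Qed.

Lemma H2_L2 f : H2 f -> L2 f. Proof. by case. Qed.

Lemma ip_Negz f n : H2 f -> ip f (zpow (Negz n)) = 0.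
Proof. by move=> [_ h]; rewrite NegzE. Qed.

Lemma H2_eqT f g : H2 f -> H2 g -> (forall n : nat, ip f (zpow n) = ip g (zpow n)) -> f =T g.
Proof.
move=> Hf Hg h; apply: eqT_zpow; try exact: H2_L2.
by case=> n; [exact: h|rewrite !ip_Negz].
Qed.

Lemma Negz_neq (i n : nat) : (Posz i == Negz n) = false. Proof. by []. Qed.

(** Here [f] is any element of L^2: [fsum] keeps the nonnegative frequencies, and the limit is the
    Riesz projection of [f]. *)
Lemma cvg_fsum_H2 f : L2 f -> exists2 g, H2 g & cvgL2 (fsum f) g.
Proof.
move=> Lf; have [g Lg cg] := fourier_cvg L2_en ortho_en Lf.
exists g => //; split => // n; apply: (cvg_psum_orth L2_en Lg _ cg); first exact: L2_zpow.
by move=> j; rewrite ip_zpow -NegzE Negz_neq.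
Qed.

Lemma cvg_fsum f : H2 f -> cvgL2 (fsum f) f.
Proof.
move=> Hf; have Lf := H2_L2 Hf; have [g Hg cg] := cvg_fsum_H2 Lf.
apply: cvgL2_eqT (cg) => //; [exact: L2_fsum|exact: H2_L2|].
apply: H2_eqT => // n; exact: (cvg_psum_coef L2_en ortho_en (H2_L2 Hg) cg).
Qed.

Lemma H2_orth f h : L2 f -> H2 h -> (forall n : nat, ip f (zpow n) = 0) -> ip f h = 0.
Proof.
move=> Lf Hh h0; have Lh := H2_L2 Hh; rewrite ipC//.
rewrite (cvg_psum_orth L2_en Lh Lf (cvg_fsum Hh)) ?conjc0// => j.
by rewrite (ipC Lf (L2_en j)) h0 conjc0.
Qed.

Lemma H2_proj f : L2 f -> exists2 g, H2 g & forall h, H2 h -> ip (f - g) h = 0.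
Proof.
move=> Lf; have [g Hg cg] := cvg_fsum_H2 Lf; have Lg := H2_L2 Hg.
exists g => // h Hh; apply: H2_orth => //; first exact: L2B.
move=> n; rewrite ipBl//; last exact: L2_zpow.
by rewrite (cvg_psum_coef L2_en ortho_en Lg cg) subrr.
Qed.

End hilbert.

(* Membership in L^2, H^2 and the model spaces *)
Create HintDb L2db discriminated.
#[export] Hint Constants Opaque : L2db.

Section membership.
Context {R : realType}.
Implicit Types f g h : cfun R.

Lemma H2I f : L2 f -> (forall n : nat, ip f (zpow (- n.+1%:Z)) = 0) -> H2 f.
Proof. by split. Qed.
Lemma H2_neg f (n : nat) : H2 f -> ip f (zpow (- n.+1%:Z)) = 0.
Proof. by case. Qed.
Lemma KspI (a f : cfun R) : H2 f -> (forall h, H2 h -> ip f (a * h) = 0) -> Ksp a f.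
Proof. by split. Qed.
Lemma K_H2 (a f : cfun R) : Ksp a f -> H2 f. Proof. by case. Qed.
Lemma K_L2 (a f : cfun R) : Ksp a f -> L2 f. Proof. by move=> /K_H2 /H2_L2. Qed.
Lemma K_orth (a f h : cfun R) : Ksp a f -> H2 h -> ip f (a * h) = 0.
Proof. by case=> _; apply. Qed.
Lemma mulfE f g z : (f * g) z = f z * g z. Proof. by []. Qed.
Lemma addfE f g z : (f + g) z = f z + g z. Proof. by []. Qed.
Lemma oppfE f z : (- f) z = - f z. Proof. by []. Qed.
Lemma scalefE a f z : (a *: f) z = a * f z. Proof. by []. Qed.
Lemma conjfE f z : conjf f z = conjc (f z). Proof. by []. Qed.
Definition fE := (mulfE, addfE, oppfE, scalefE, conjfE).
End membership.

#[global] Hint Resolve L2_0 L2_cst L2_zpow L2_fsum L2_psum : L2db.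
(* Hypotheses are matched syntactically: a unification attempt between two
   function-space terms may unfold the ring operations and the integrals. *)
Ltac hd t := match t with ?f _ => hd f | _ => t end.
Ltac same_var_head f g := let a := hd f in let b := hd g in is_var a; constr_eq a b.
Ltac L2more := fail.
Ltac L2step := match goal with
  | H : L2 ?f |- L2 ?g => constr_eq f g; exact H
  | H : H2 ?f |- L2 ?g => constr_eq f g; exact (H2_L2 H)
  | H : Ksp _ ?f |- L2 ?g => constr_eq f g; exact (K_L2 H)
  | H : H2 ?f |- H2 ?g => constr_eq f g; exact H
  | H : Ksp _ ?f |- H2 ?g => constr_eq f g; exact (K_H2 H)
  | |- L2 (?f + ?g) => apply L2D
  | |- L2 (- ?f) => apply L2N
  | |- L2 (?a *: ?f) => apply L2Z
  | |- L2 (zpow _ * ?f) => apply L2_zpowM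
  | |- L2 (conjf ?f) => apply L2_conj
  | |- L2 (\sum_(i <- _ | _) _) => apply L2_sum; intros ? _
  | |- _ => solve [auto 5 with nocore L2db]
  | |- _ => L2more
  | H : Ksp _ ?f |- L2 ?g => same_var_head f g; exact (K_L2 H)
  end.
Ltac L2s := try solve [repeat L2step].

(** * Backward shift, model spaces and compressed shift *)

Section model_space.
Context {R : realType}.
Local Notation c := (@circle_pt R).
Implicit Types f g h : cfun R.
Opaque L2 H2 Ksp ip.

Lemma H2D a f g : H2 f -> H2 g -> H2 (a *: f + g).
Proof.
move=> Hf Hg; apply: H2I; L2s.
move=> n; rewrite ip_linl; L2s.
by rewrite (H2_neg _ Hf) (H2_neg _ Hg) mulr0 addr0.
Qed.

Lemma H2_0 : H2 (0 : cfun R).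
Proof. by apply: H2I => [|n]; [exact: L2_0|rewrite ip0l]. Qed.

Lemma H2_zpow (n : nat) : H2 (@zpow R n).
Proof. by apply: H2I => [|k]; [exact: L2_zpow|rewrite -NegzE ip_zpow]. Qed.

Lemma zpow0E z : zpow 0 z = 1 :> R[i]. Proof. by rewrite /zpow expr0z. Qed.

Lemma zpowM_adj (n : int) f g : ip (zpow n * f) g = ip f (zpow (- n) * g).
Proof.
by apply: ip_ext => t; rewrite !fE conjcM zpow_conj opprK; ring.
Qed.

Lemma ip_zpowM_zpow (n m : int) f : ip (zpow n * f) (zpow m) = ip f (zpow (m - n)).
Proof. by rewrite zpowM_adj; apply: ip_ext => t; rewrite !fE -zpowD addrC. Qed.

Lemma H2_zpowM (n : nat) f : H2 f -> H2 (zpow n * f).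
Proof.
move=> Hf; apply: H2I; first by L2s.
move=> k; rewrite ip_zpowM_zpow.
have -> : - k.+1%:Z - n%:Z = - (k + n).+1%:Z by rewrite -opprD -addSn PoszD.
exact: H2_neg.
Qed.

Definition coef f (n : nat) : R[i] := ip f (zpow n).

(* The backward shift: the adjoint of the compressed shift on every model space. *)
Definition Sst f : cfun R := zpow (-1) * (f - cst (coef f 0)).

Lemma L2_Sst f : L2 f -> L2 (Sst f). Proof. by rewrite /Sst => Lf; L2s. Qed.
Ltac L2more ::= match goal with |- L2 (Sst _) => apply L2_Sst end.

Lemma coef_cst a (n : int) : ip (cst a : cfun R) (zpow n) = a * (n == 0)%:R.
Proof.
rewrite (ip_ext (f' := a *: zpow 0) (g' := zpow n)) => [|t].
  by rewrite ipZl; L2s; rewrite ip_zpow eq_sym.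
by rewrite -[(a *: zpow 0) _]/(a * _) zpow0E mulr1.
Qed.

Lemma ip_Sst_zpow f (n : int) : L2 f -> n != -1 -> ip (Sst f) (zpow n) = ip f (zpow (n + 1)).
Proof.
move=> Lf n1; rewrite /Sst ip_zpowM_zpow opprK ipBl; L2s.
by rewrite coef_cst addr_eq0 (negbTE n1) mulr0 subr0.
Qed.

Lemma H2_Sst f : H2 f -> H2 (Sst f).
Proof.
move=> Hf; apply: H2I; first by L2s.
(* At index -1 the coefficient would be [coef f 0], which the constant subtracted in [Sst] removes;
   all other indices follow [ip_Sst_zpow]. *)
case=> [|n].
  rewrite /Sst ip_zpowM_zpow subrr ipBl; L2s.
  by rewrite coef_cst eqxx mulr1 subrr.
rewrite ip_Sst_zpow; [|by L2s|by []].
have -> : - n.+2%:Z + 1 = - n.+1%:Z by rewrite -addn1 PoszD opprD addrK.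
exact: H2_neg.
Qed.
Ltac L2more ::= match goal with
  | |- L2 (Sst _) => apply L2_Sst
  | |- H2 (Sst _) => apply H2_Sst
  | |- L2 (iter _ _ _) => apply H2_L2
  end.

Lemma Sst_recover f t : f (c t) = zpow 1 (c t) * Sst f (c t) + coef f 0.
Proof.
rewrite -[Sst f _]/(zpow (-1) (c t) * (f (c t) - coef f 0)) mulrA -zpowD addrN zpow0E mul1r.
by rewrite subrK.
Qed.

Lemma coef_iter_Sst n f j : H2 f -> coef (iter n Sst f) j = coef f (n + j).
Proof.
move=> Hf; elim: n j => // n IH j; rewrite iterS /coef ip_Sst_zpow; last by [].
  by have := IH j.+1; rewrite addnS -addSn /coef -addn1 PoszD.
by apply: H2_L2; elim: n {IH} => // n IH; exact: H2_Sst.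
Qed.

Lemma H2_iter_Sst n f : H2 f -> H2 (iter n Sst f).
Proof. by move=> Hf; elim: n => // n IH; exact: H2_Sst. Qed.
Ltac L2more ::= match goal with
  | |- L2 (Sst _) => apply L2_Sst
  | |- H2 (Sst _) => apply H2_Sst
  | |- L2 (iter _ Sst _) => apply H2_L2
  | |- H2 (iter _ Sst _) => apply H2_iter_Sst
  end.

Lemma iter_SstE n f t : H2 f ->
  iter n Sst f (c t) = zpow (- n%:Z) (c t) * (f (c t) - fsum f n (c t)).
Proof.
move=> Hf; elim: n => [|n IH].
  by rewrite /fsum /psum big_ord0 oppr0 zpow0E mul1r subr0.
rewrite iterS -[LHS]/(zpow (-1) (c t) * (iter n Sst f (c t) - coef (iter n Sst f) 0)).
rewrite coef_iter_Sst// addn0 IH /fsum /psum big_ord_recr /=.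
rewrite -[X in _ = _ * (_ - X)]/((\sum_(i < n) ip f (en i) *: en i) (c t) + coef f n * zpow n (c t)).
have -> : - n.+1%:Z = -1 + - n%:Z by rewrite -add1n PoszD opprD.
rewrite zpowD.
have e : zpow (- n%:Z) (c t) * zpow n (c t) = 1 by rewrite -zpowD addNr zpow0E.
set s := (\sum_(i < n) _) _; rewrite -mulrA; congr (_ * _).
by rewrite [in RHS]opprD [in RHS]addrA [RHS]mulrDr mulrN mulrCA e mulr1.
Qed.

(** By [iter_SstE] only a Taylor polynomial of degree below [n] is discarded, and it is orthogonal
    to [zpow n * h]. *)
Lemma ip_iter_Sst n f h : H2 f -> H2 h -> ip (iter n Sst f) h = ip f (zpow n * h).
Proof.
move=> Hf Hh; have Lf := H2_L2 Hf; have Lh := H2_L2 Hh.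
rewrite (ip_ext (f' := zpow (- n%:Z) * (f - fsum f n)) (g' := h)) => [|t]; last by rewrite iter_SstE.
rewrite zpowM_adj opprK ipBl; L2s.
rewrite [X in _ - X](_ : _ = 0) ?subr0// /fsum /psum ip_suml; [|by move=> i _; rewrite /en; L2s|by L2s].
rewrite big1// => i _; rewrite ipZl; [|by rewrite /en; L2s|by L2s].
rewrite (ipC (f := zpow n * h)); [|by L2s|by rewrite /en; L2s].
rewrite ip_zpowM_zpow.
have -> : i%:Z - n%:Z = - (n - i).-1.+1%:Z.
  by rewrite prednK ?subn_gt0// -subzn 1?ltnW// opprB.
by rewrite (H2_neg _ Hh) conjc0 mulr0.
Qed.

Lemma norm2_zpowM n f : norm2 (zpow n * f) = norm2 f.
Proof.
rewrite /norm2; congr (Num.sqrt (complex.Re _)).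
rewrite zpowM_adj; apply: ip_ext => t.
rewrite -[X in _ * conjc X]/(zpow (- n) (c t) * (zpow n (c t) * f (c t))).
by rewrite mulrA -zpowD addNr zpow0E mul1r.
Qed.

Lemma norm2_iter_Sst n f : H2 f -> norm2 (iter n Sst f) = norm2 (fsum f n - f).
Proof.
move=> Hf; have Lf := H2_L2 Hf.
rewrite -opprB norm2N; L2s.
rewrite -(norm2_zpowM (- n%:Z) (f - _)); apply: norm2_eqT; [by L2s|by L2s|].
by apply: eqTW => t; rewrite iter_SstE.
Qed.

(** Up to a unimodular factor, [iter n Sst f] is the Taylor tail of [f]. *)
Lemma iter_Sst_cvg0 f : H2 f ->
  forall e : R, 0 < e -> exists N, forall n, (N <= n)%N -> norm2 (iter n Sst f) <= e.
Proof.
move=> Hf e e0; have [N hN] := cvg_fsum Hf e0.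
by exists N => n nN; rewrite norm2_iter_Sst// hN.
Qed.

Section inner.
Variable alpha : cfun R.
Hypothesis inner_alpha : inner alpha.

Lemma inner_H2 : H2 alpha. Proof. by case: inner_alpha => [[]]. Qed.
Lemma inner_L2 : L2 alpha. Proof. exact: H2_L2 inner_H2. Qed.
#[local] Hint Resolve inner_L2 : L2db.

Lemma inner_bound : exists M : R, aeT (fun z => Normc.normc (alpha z) <= M).
Proof. by exists 1; case: inner_alpha => _; apply: aeT_imp => t ->. Qed.

Lemma L2_inner f : L2 f -> L2 (alpha * f).
Proof. by apply: L2M; [exact: L2_meas inner_L2|exact: inner_bound]. Qed.

Lemma L2_innerc f : L2 f -> L2 (conjf alpha * f).
Proof.
apply: L2M; first exact: measurableT_conj (L2_meas inner_L2).
by have [M h] := inner_bound; exists M; apply: aeT_imp h => t; rewrite normc_conj.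
Qed.
Ltac L2more ::= match goal with
  | |- L2 (Sst _) => apply L2_Sst
  | |- H2 (Sst _) => apply H2_Sst
  | |- L2 (iter _ Sst _) => apply H2_L2
  | |- H2 (iter _ Sst _) => apply H2_iter_Sst
  | |- L2 (alpha * _) => apply L2_inner
  | |- L2 (conjf alpha * _) => apply L2_innerc
  end.

Lemma inner_ae : aeT (fun z => alpha z * conjc (alpha z) = 1).
Proof. by case: inner_alpha => _; apply: aeT_imp => t h; rewrite normcJ2 h expr1n. Qed.

Lemma ip_inner_adj f g : ip (alpha * f) g = ip f (conjf alpha * g).
Proof.
by apply: ip_ext => t; rewrite !fE conjcM conjcK; ring.
Qed.

Lemma ip_inner f g : L2 f -> L2 g -> ip (alpha * f) (alpha * g) = ip f g.
Proof.
move=> Lf Lg; rewrite ip_inner_adj; apply: ip_eqTr; L2s.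
apply: aeT_imp inner_ae => t h.
by rewrite -[LHS]/(conjc (alpha (c t)) * (alpha (c t) * g (c t))) mulrA [conjc _ * _]mulrC h mul1r.
Qed.

(** With [alpha] moved to the other slot, a negative coefficient becomes a pairing of [h] with
    [conjf alpha] times a negative power. That function has no nonnegative frequency, hence is
    orthogonal to [H2]. *)
Lemma H2_inner h : H2 h -> H2 (alpha * h).
Proof.
move=> Hh; have Lh := H2_L2 Hh; apply: H2I; first by L2s.
move=> n; rewrite ip_inner_adj.
rewrite (ipC (f := conjf alpha * zpow (- n.+1%:Z))); L2s.
rewrite (H2_orth _ Hh) ?conjc0//; first by L2s.
move=> k; rewrite (ip_ext (f' := zpow (- n.+1%:Z - k%:Z)) (g' := alpha)) => [|t].
  rewrite (ipC inner_L2); L2s.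
  have -> : - n.+1%:Z - k%:Z = - (n + k).+1%:Z by rewrite -opprD -addSn PoszD.
  by rewrite (H2_neg _ inner_H2) conjc0.
by rewrite !fE zpowD zpow_conj; ring.
Qed.

Lemma KD a f g : Ksp alpha f -> Ksp alpha g -> Ksp alpha (a *: f + g).
Proof.
move=> Kf Kg; apply: KspI; first by apply: H2D; L2s.
move=> h Hh; rewrite ip_linl; L2s.
by rewrite !K_orth// mulr0 addr0.
Qed.

Lemma K0 : Ksp alpha 0.
Proof. by apply: KspI; [exact: H2_0|move=> h Hh; rewrite ip0l]. Qed.

Lemma KZ a f : Ksp alpha f -> Ksp alpha (a *: f).
Proof. by move=> Kf; rewrite -[_ *: _]addr0; exact: (KD a Kf K0). Qed.

Lemma KA f g : Ksp alpha f -> Ksp alpha g -> Ksp alpha (f + g).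
Proof. by rewrite -{2}[f]scale1r; exact: KD. Qed.

Lemma KB f g : Ksp alpha f -> Ksp alpha g -> Ksp alpha (f - g).
Proof. by rewrite -scaleN1r addrC => Kf Kg; exact: KD. Qed.

Lemma K_sum (J : Type) (r : seq J) (P : pred J) (F : J -> cfun R) :
  (forall i, P i -> Ksp alpha (F i)) -> Ksp alpha (\sum_(i <- r | P i) F i).
Proof. by move=> h; elim/big_ind: _ => //; [exact: K0|exact: KA]. Qed.

Lemma K_eqT f g : Ksp alpha f -> Ksp alpha g ->
  (forall h, Ksp alpha h -> ip f h = ip g h) -> f =T g.
Proof.
move=> Kf Kg h; have Kd := KB Kf Kg.
apply: eqT_sqr; L2s.
by rewrite ipBl; L2s; rewrite (h _ Kd) subrr.
Qed.

(** With P the projection onto [H2], the element is [P f - alpha P (conj alpha P f)]: multiplication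
    by [alpha] is isometric, so the subtracted term is the projection of [P f] onto [alpha H2]. *)
Lemma PK_spec f : L2 f -> Ksp alpha (PK alpha f) /\
  forall h, Ksp alpha h -> ip (f - PK alpha f) h = 0.
Proof.
move=> Lf; apply: (@xgetPex _ 0 [set g | Ksp alpha g /\ forall h, Ksp alpha h -> ip (f - g) h = 0]).
have [g Hg hg] := H2_proj Lf; have Lg := H2_L2 Hg.
have Lcg : L2 (conjf alpha * g) by L2s.
have [q Hq hq] := H2_proj Lcg; have Lq := H2_L2 Hq.
have Hp : H2 (g - alpha * q).
  by rewrite -scaleN1r addrC; apply: H2D => //; exact: H2_inner.
exists (g - alpha * q); split; first apply: KspI => //.
- move=> h Hh; have Lh := H2_L2 Hh; rewrite ipBl; L2s.
  rewrite ip_inner//; have := hq h Hh; rewrite ipBl; L2s.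
  by rewrite (ip_ext (f' := g) (g' := alpha * h)) => [//|t]; rewrite ?/u !fE conjcM; ring.
- move=> h Kh; have Lh := K_L2 Kh.
  have -> : f - (g - alpha * q) = f - g + alpha * q by rewrite opprB addrCA addrC.
  rewrite ipDl; L2s.
  rewrite (ipC (f := h) (g := alpha * q)); L2s.
  by rewrite (K_orth Kh Hq) conjc0 addr0 (hg _ (K_H2 Kh)).
Qed.

Lemma K_PK f : L2 f -> Ksp alpha (PK alpha f). Proof. by case/PK_spec. Qed.
Lemma L2_PK f : L2 f -> L2 (PK alpha f). Proof. by move=> /K_PK /K_L2. Qed.
#[local] Hint Resolve L2_PK : L2db.

Lemma ip_PKl f h : L2 f -> Ksp alpha h -> ip (PK alpha f) h = ip f h.
Proof.
move=> Lf Kh; have [Kp hp] := PK_spec Lf; have := hp h Kh.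
by rewrite ipBl; L2s => /eqP; rewrite subr_eq0 => /eqP.
Qed.

Lemma ip_PKr f h : L2 f -> Ksp alpha h -> ip h (PK alpha f) = ip h f.
Proof. by move=> Lf Kh; have Lh := K_L2 Kh; rewrite ipC ?ip_PKl -?ipC//; L2s. Qed.

Lemma PK_unique f g : L2 f -> Ksp alpha g -> (forall h, Ksp alpha h -> ip f h = ip g h) ->
  PK alpha f =T g.
Proof. by move=> Lf Kg h; apply: K_eqT => //; [exact: K_PK|move=> u Ku; rewrite ip_PKl// h]. Qed.

Lemma PK_id f : Ksp alpha f -> PK alpha f =T f.
Proof. by move=> Kf; apply: PK_unique; L2s. Qed.

Lemma PK_lin a f g : L2 f -> L2 g -> PK alpha (a *: f + g) =T a *: PK alpha f + PK alpha g.
Proof.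
move=> Lf Lg; have Kf := K_PK Lf; have Kg := K_PK Lg.
apply: PK_unique; [by L2s|exact: KD|move=> h Kh].
by rewrite !ip_linl; L2s; rewrite !ip_PKl.
Qed.

Lemma norm2_PK f : L2 f -> norm2 (PK alpha f) <= norm2 f.
Proof.
move=> Lf; have Kp := K_PK Lf; have Lp := K_L2 Kp.
have [->|n0] := eqVneq (norm2 (PK alpha f)) 0; first exact: norm2_ge0.
have np : 0 < norm2 (PK alpha f) by rewrite lt_neqAle eq_sym n0 norm2_ge0.
rewrite -(ler_pM2r np) -expr2.
have -> : norm2 (PK alpha f) ^+ 2 = complex.Re (ip f (PK alpha f)) by rewrite -ip_PKl// -sqr_norm2.
apply: le_trans (ler_norm _) _; apply: le_trans (Re_le_normc _) _.
exact: cauchy_schwarz.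
Qed.

Lemma idzE : @idz R = zpow 1.
Proof. by apply/funext => z; rewrite /idz /zpow expr1z. Qed.

Lemma K_SK f : L2 f -> Ksp alpha (SK alpha f).
Proof. by move=> Lf; apply: K_PK; rewrite idzE; L2s. Qed.

Lemma K_iter_SK n f : Ksp alpha f -> Ksp alpha (iter n (SK alpha) f).
Proof. by move=> Kf; elim: n => // n IH; rewrite iterS; exact: K_SK (K_L2 IH). Qed.

Lemma ip_Sst f u : H2 f -> H2 u -> ip (Sst f) u = ip f (zpow 1 * u).
Proof. exact: (@ip_iter_Sst 1). Qed.

Lemma K_Sst f : Ksp alpha f -> Ksp alpha (Sst f).
Proof.
move=> Kf; apply: KspI; L2s.
move=> h Hh; rewrite ip_Sst; [|by L2s|exact: H2_inner].
by rewrite mulrCA K_orth//; exact: (@H2_zpowM 1).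
Qed.

Lemma K_iter_Sst n f : Ksp alpha f -> Ksp alpha (iter n Sst f).
Proof. by move=> Kf; elim: n => // n IH; exact: K_Sst. Qed.

Lemma ip_SKl f g : Ksp alpha f -> Ksp alpha g -> ip (SK alpha f) g = ip f (Sst g).
Proof.
move=> Kf Kg; rewrite ip_PKl//; last by rewrite idzE; L2s.
rewrite idzE (ipC (f := Sst g)); L2s.
rewrite ip_Sst; L2s.
by rewrite -ipC; L2s.
Qed.

Lemma ip_iter_SKl n f g : Ksp alpha f -> Ksp alpha g ->
  ip (iter n (SK alpha) f) g = ip f (iter n Sst g).
Proof.
move=> Kf; elim: n g => // n IH g Kg; rewrite iterS ip_SKl//; last exact: K_iter_SK.
by rewrite IH; [rewrite -iterSr|exact: K_Sst].
Qed.

Lemma ip_iter_SKr n f g : Ksp alpha f -> Ksp alpha g ->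
  ip g (iter n (SK alpha) f) = ip (iter n Sst g) f.
Proof.
move=> Kf Kg; have Ks := K_iter_SK n Kf; have Kt := K_iter_Sst n Kg.
rewrite (ipC (f := iter n (SK alpha) f)); L2s.
by rewrite ip_iter_SKl// -ipC; L2s.
Qed.

Lemma K_k0 j : Ksp alpha (k0 alpha j).
Proof. by apply: K_PK; L2s. Qed.

Lemma ip_k0 f j : Ksp alpha f -> ip f (k0 alpha j) = j`!%:R * coef f j.
Proof. by move=> Kf; rewrite ip_PKr//; [rewrite ipZr ?conjc_nat; L2s|L2s]. Qed.

(** Consequently [S^n k_{0,l}] divided by [l!] is [k_{0,n+l}] divided by [(n+l)!], which allows the
    terms of the product to be indexed by [p = k * n + l]. *)
Lemma ip_iter_SK_k0 n l f : Ksp alpha f ->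
  ip f (iter n (SK alpha) (k0 alpha l)) = l`!%:R * coef f (n + l).
Proof.
move=> Kf; rewrite ip_iter_SKr//; last exact: K_k0.
by rewrite ip_k0; [rewrite coef_iter_Sst; L2s|exact: K_iter_Sst].
Qed.

Lemma normc_sum_le (J : Type) (r : seq J) (P : pred J) (F : J -> R[i]) :
  Normc.normc (\sum_(j <- r | P j) F j) <= \sum_(j <- r | P j) Normc.normc (F j).
Proof.
elim/big_rec2: _ => [|i x y _ h]; first by rewrite Normc.normc0.
by apply: le_trans (le_normcD _ _) _; rewrite lerD2l.
Qed.

(* P(z^j) is a trigonometric polynomial minus alpha times another, hence bounded. *)
Lemma Kinfty_PK_zpow (j : nat) : Kinfty alpha (PK alpha (zpow j)).
Proof.
have Lj := @L2_zpow R j; have Kp := K_PK Lj.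
pose u := conjf alpha * zpow j; have Lu : L2 u by rewrite /u; L2s.
(* The [i]-th coefficient of [u] is the conjugate of the coefficient of [alpha] at [j - i], which is
   0 for [i > j]. Hence the polynomial [q] is the whole projection of [u] onto [H2]. *)
pose q := fsum u j.+1.
have qE z : q z = \sum_(i < j.+1) coef u i * zpow i z.
  by rewrite /q /fsum /psum fct_sumE.
have Hq : H2 q.
  rewrite /q /fsum /psum; elim/big_ind: _ => [|f g Hf Hg|i _]; first exact: H2_0.
    by rewrite -[f]scale1r; exact: H2D.
  by rewrite -[_ *: _]addr0; apply: H2D; [exact: H2_zpow|exact: H2_0].
have uq h : H2 h -> ip (u - q) h = 0.
  move=> Hh; apply: H2_orth => //; first by L2s.
  move=> i; rewrite ipBl; L2s.
  rewrite (ip_psum_e L2_en ortho_en (fun i => ip u (en i)) j.+1 i).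
  case: ltnP => ij; first by rewrite subrr.
  rewrite subr0 (ip_ext (f' := zpow (j%:Z - i%:Z)) (g' := alpha)) => [|t]; last first.
    by rewrite /u !fE zpowD zpow_conj; ring.
  rewrite (ipC inner_L2); L2s.
  have -> : j%:Z - i%:Z = - (i - j).-1.+1%:Z by rewrite prednK ?subn_gt0// -subzn ?opprB// ltnW.
  by rewrite (H2_neg _ inner_H2) conjc0.
have Haq := H2_inner Hq.
have Kpq : Ksp alpha (zpow j - alpha * q).
  apply: KspI; first by rewrite -scaleN1r addrC; apply: H2D => //; exact: H2_zpow.
  move=> h Hh; rewrite ipBl; L2s.
  rewrite ip_inner; L2s.
  have := uq h Hh; rewrite ipBl; L2s.
  by rewrite (ip_ext (f' := zpow j) (g' := alpha * h)) => [//|t]; rewrite ?/u !fE conjcM; ring.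
have pE : PK alpha (zpow j) =T zpow j - alpha * q.
  apply: PK_unique => // h Kh; rewrite ipBl; L2s.
  rewrite (ipC (f := h) (g := alpha * q)); L2s.
  by rewrite (K_orth Kh Hq) conjc0 subr0.
split=> //; split; first exact: K_H2 Kp.
split; first by apply: L2_meas; L2s.
exists (1 + \sum_(i < j.+1) Normc.normc (coef u i)).
case: inner_alpha => _; apply: aeT_imp2 pE => t -> a1.
rewrite !fE; apply: le_trans (le_normcD _ _) _.
rewrite normcN Normc.normcM a1 mul1r normc_zpow lerD2l qE.
apply: le_trans (normc_sum_le _ _ _) _; apply: ler_sum => i _.
by rewrite Normc.normcM normc_zpow mulr1.
Qed.

(** The pairing with [PK alpha (zpow j)] is the conjugate of [coef f j]. As these functions are
    bounded, this takes the place of the density of [Kinfty alpha] in [Ksp alpha]. *)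
Lemma K_eq0_coef f : Ksp alpha f -> (forall j, ip (PK alpha (zpow j%:Z)) f = 0) -> f =T 0.
Proof.
move=> Kf h; apply: H2_eqT; [by L2s|exact: H2_0|move=> n].
rewrite ip0l (ipC (f := zpow n)); L2s.
by rewrite -ip_PKl ?h ?conjc0; L2s.
Qed.

Lemma K_eqT_coef f g : Ksp alpha f -> Ksp alpha g -> (forall j, coef f j = coef g j) -> f =T g.
Proof. by move=> Kf Kg h; apply: H2_eqT; L2s. Qed.

Lemma L2_Cconj f : L2 f -> L2 (Cconj alpha f).
Proof.
move=> Lf; apply: (@L2_eqc _ (alpha * (zpow (-1) * conjf f))); last by L2s.
by move=> t; rewrite /Cconj !fE /zbar circle_pt_conj /zpow exprN1 mulrA.
Qed.

Lemma CconjE f t : Cconj alpha f (c t) = alpha (c t) * (zpow (-1) (c t) * conjc (f (c t))).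
Proof. by rewrite /Cconj !fE /zbar circle_pt_conj /zpow exprN1 mulrA. Qed.

Lemma ip_Cconj f g : ip f (Cconj alpha g) = ip g (Cconj alpha f).
Proof. by apply: ip_ext => t; rewrite !CconjE !conjcM !conjcK zpow_conj; ring. Qed.

(** The negative coefficients of the image vanish because [f] is orthogonal to [alpha H2].
    Orthogonality of the image to [alpha * h] holds because [conjf (zpow 1 * h)] has negative
    frequencies only and [f] is in [H2]. *)
Lemma K_Cconj f : Ksp alpha f -> Ksp alpha (Cconj alpha f).
Proof.
move=> Kf; have Lc := L2_Cconj (K_L2 Kf); apply: KspI.
  apply: H2I => // n; rewrite (ip_ext (f' := alpha * zpow n) (g' := f)) => [|t].
    rewrite (ipC (f := f)); L2s.
    by rewrite (K_orth Kf (H2_zpow n)) conjc0.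
  rewrite CconjE zpow_conj opprK !fE -addn1 PoszD zpowD.
  have e : zpow (-1) (c t) * zpow 1 (c t) = 1 by rewrite -zpowD addNr zpow0E.
  by rewrite -[RHS]mulr1 -e; ring.
move=> h Hh.
rewrite (ip_ext (f' := alpha * (zpow (-1) * conjf f)) (g' := alpha * h)) => [|t]; last first.
  by rewrite CconjE !fE.
rewrite ip_inner; L2s.
rewrite (ip_ext (f' := conjf (zpow 1 * h)) (g' := f)) => [|t]; last first.
  by rewrite !fE conjcM zpow_conj; ring.
apply: H2_orth; L2s; move=> n.
rewrite (ip_ext (f' := zpow (- n.+1%:Z)) (g' := h)) => [|t]; last first.
  by rewrite !fE conjcM !zpow_conj -addn1 PoszD opprD addrC zpowD; ring.
rewrite (ipC (f := h)); L2s.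
by rewrite (H2_neg _ Hh) conjc0.
Qed.

Lemma K_k0t j : Ksp alpha (k0t alpha j).
Proof. by apply: K_Cconj; exact: K_k0. Qed.

(** By [SK_E] and [ip_zpow_iter_SK], [ip (zpow j.+1 * f) alpha] is the coefficient of the component
    along [alpha] that is cut off when [SK alpha] is applied to [S^j f]. So the vectors
    [k0t alpha j] measure how far powers of [SK alpha] are from isometries. *)
Lemma ip_k0t f j : Ksp alpha f -> ip f (k0t alpha j) = j`!%:R * ip (zpow j.+1 * f) alpha.
Proof.
move=> Kf; have Kc := K_Cconj Kf; have Kk := K_k0 j.
rewrite ip_Cconj (ipC (g := k0 alpha j) (f := Cconj alpha f)); L2s.
rewrite ip_k0// conjcM conjc_nat; congr (_ * _).
rewrite /coef -ipC; L2s.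
apply: ip_ext => t; rewrite CconjE !conjcM conjcK zpow_conj fE -addn1 PoszD zpowD; ring.
Qed.

Lemma K_alpha_orth f : Ksp alpha f -> ip f alpha = 0.
Proof. by move=> Kf; rewrite -[alpha]mulr1 (K_orth Kf)//; have := H2_zpow 0; congr H2; apply/funext => z; rewrite zpow0E. Qed.

(** Multiplication by z leaves the model space only in the direction of [alpha]. *)
Lemma SK_E f : Ksp alpha f -> SK alpha f =T zpow 1 * f - ip (zpow 1 * f) alpha *: alpha.
Proof.
move=> Kf; have Ha := inner_H2; set a := ip _ _; rewrite /SK idzE.
have Hz : H2 (zpow 1 * f) by apply: (@H2_zpowM 1); L2s.
apply: PK_unique; L2s.
- apply: KspI; first by rewrite -scaleNr addrC; exact: H2D.
  move=> h Hh; have Hah := H2_inner Hh.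
  rewrite ipBl; L2s; rewrite ipZl; L2s.
  have h0 : ip alpha (alpha * h) = conjc (coef h 0).
    rewrite -{1}[alpha]mulr1 ip_inner; [|exact: L2_cst|by L2s].
    rewrite (ipC (f := h)); [|by L2s|exact: L2_cst].
    by congr conjc; apply: ip_ext => t; rewrite zpow0E.
  (* Splits [h] into its constant term and [z S^* h]. The correction term cancels the first part;
     the second vanishes since [f] is orthogonal to [alpha H2]. *)
  have E : ip (zpow 1 * f) (alpha * h) = ip (zpow 1 * f) (coef h 0 *: alpha) + ip (zpow 1 * f) (zpow 1 * (alpha * Sst h)).
    rewrite -ipDr; L2s; apply: ip_ext => t; congr (_ * conjc _).
    by rewrite !fE {1}(Sst_recover h t); ring.
  rewrite E h0 ipZr; L2s.
  have -> : ip (zpow 1 * f) (zpow 1 * (alpha * Sst h)) = ip f (alpha * Sst h).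
    by rewrite zpowM_adj; apply: ip_ext => t; congr (_ * conjc _); rewrite !fE mulrA -zpowD addNr zpow0E mul1r.
  by rewrite (K_orth Kf) ?addr0 -/a; L2s; rewrite mulrC subrr.
- move=> h Kh; rewrite ipBl; L2s; rewrite ipZl; L2s.
  by rewrite (ipC (f := h) (g := alpha)); L2s; rewrite K_alpha_orth// conjc0 mulr0 subr0.
Qed.

Lemma ip_zpow_inner0 (n : nat) : ip (zpow n.+1 * alpha) alpha = 0.
Proof.
have -> : ip (zpow n.+1 * alpha) alpha = ip (alpha * zpow n.+1) (alpha * zpow 0).
  by apply: ip_ext => t; rewrite !fE zpow0E mulr1; ring.
by rewrite ip_inner; L2s; rewrite ip_zpow.
Qed.

(** The correction in [SK_E] does not contribute, as [zpow n.+1 * alpha] is orthogonal to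
    [alpha]. *)
Lemma ip_zpow_SK n f : Ksp alpha f -> ip (zpow n.+1 * SK alpha f) alpha = ip (zpow n.+2 * f) alpha.
Proof.
move=> Kf; have Ks := K_SK (K_L2 Kf).
rewrite (ip_eqTl (g := zpow n.+2 * f - ip (zpow 1 * f) alpha *: (zpow n.+1 * alpha))); L2s.
  by rewrite ipBl; L2s; rewrite ipZl; L2s; rewrite ip_zpow_inner0 mulr0 subr0.
apply: aeT_imp (SK_E Kf) => t h; rewrite !fE h !fE.
by rewrite -[n.+2]addn1 PoszD zpowD; ring.
Qed.

Lemma ip_zpow_iter_SK m n f : Ksp alpha f ->
  ip (zpow m.+1 * iter n (SK alpha) f) alpha = ip (zpow (m + n).+1 * f) alpha.
Proof.
move=> Kf; elim: n m => [|n IH] m; first by rewrite addn0.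
by rewrite iterS ip_zpow_SK ?IH ?addSnnS//; exact: K_iter_SK.
Qed.

Lemma ip_SK_SK f g : Ksp alpha f -> Ksp alpha g ->
  ip (SK alpha f) (SK alpha g) = ip f g - ip (zpow 1 * f) alpha * conjc (ip (zpow 1 * g) alpha).
Proof.
move=> Kf Kg; have Ksf := K_SK (K_L2 Kf); have Ksg := K_SK (K_L2 Kg).
have La := inner_L2.
rewrite (ip_eqTl _ _ _ (SK_E Kf)); L2s.
rewrite ipBl; L2s; rewrite ipZl; L2s.
rewrite (ipC (f := SK alpha g) (g := alpha)); L2s.
rewrite (K_alpha_orth Ksg) conjc0 mulr0 subr0.
rewrite (ip_eqTr _ _ _ (SK_E Kg)); L2s.
rewrite ipBr; L2s; rewrite ipZr; L2s.
rewrite [X in _ - X]mulrC; congr (_ - _).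
rewrite zpowM_adj; apply: ip_ext => t; congr (_ * conjc _).
by rewrite !fE mulrA -zpowD addNr zpow0E mul1r.
Qed.

(** Each power costs one rank-one term by [ip_SK_SK]. At [S^j f] and [S^j g] it is expressed through
    [k0t alpha j]; by [ip_k0t] each of the two factors carries a [j!], whence the square. *)
Lemma ip_iter_SK2 m f g : Ksp alpha f -> Ksp alpha g ->
  ip (iter m (SK alpha) f) (iter m (SK alpha) g) =
  ip f g - \sum_(j < m) (j`!%:R^-1) ^+ 2 * (ip f (k0t alpha j) * ip (k0t alpha j) g).
Proof.
move=> Kf Kg; elim: m => [|m IH]; first by rewrite big_ord0 subr0.
rewrite !iterS ip_SK_SK ?IH; try exact: K_iter_SK.
rewrite big_ord_recr /= opprD addrA; congr (_ - _).
rewrite !ip_zpow_iter_SK// !add0n.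
have Kk := K_k0t m.
rewrite (ipC (f := g) (g := k0t alpha m)); L2s.
rewrite !ip_k0t// conjcM conjc_nat.
have m0 : m`!%:R != 0 :> R[i] by rewrite pnatr_eq0 -lt0n fact_gt0.
by field.
Qed.

End inner.

End model_space.

Ltac L2more ::= match goal with
  | |- L2 (Sst _) => apply L2_Sst
  | |- H2 (Sst _) => apply H2_Sst
  | |- L2 (iter _ Sst _) => apply H2_L2
  | |- H2 (iter _ Sst _) => apply H2_iter_Sst
  | H : inner ?a |- L2 (?b * _) => constr_eq a b; apply (L2_inner H)
  | H : inner ?a |- L2 (conjf ?b * _) => constr_eq a b; apply (L2_innerc H)
  | H : is_true (0 < ?N)%N |- L2 (Wstar ?M _) => constr_eq N M; apply (L2_Wstar H)
  | H : is_true (0 < ?N)%N |- L2 (W ?M _) => constr_eq N M; apply (L2_W H)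
  | H : inner ?a |- L2 (PK ?b _) => constr_eq a b; apply (L2_PK H)
  end.

(** * Bounded operators, adjoints, and the equation satisfied by an operator with a given symbol *)

Section operators.
Context {R : realType}.
Local Notation c := (@circle_pt R).
Implicit Types f g h : cfun R.
Opaque L2 H2 Ksp ip.

Lemma cvgL2_ipr u g h : (forall n, L2 (u n)) -> L2 g -> L2 h -> cvgL2 u g ->
  cvgC (fun n => ip h (u n)) (ip h g).
Proof.
move=> Lu Lg Lh ug e e0; have [N hN] := cvgL2_ip Lu Lg Lh ug e0.
exists N => n nN; rewrite (ipC (Lu n) Lh) (ipC Lg Lh) -normc_conj.
by have := hN n nN; rewrite conjcD conjcN !conjcK.
Qed.

Lemma Linfty_L2 f g : Linfty f -> L2 g -> L2 (f * g).
Proof. by move=> [mf bf]; exact: L2M. Qed.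

Lemma Linfty_bound f : Linfty f -> exists2 M : R, 0 <= M & aeT (fun z => Normc.normc (f z) <= M).
Proof.
move=> [_ [M h]]; exists `|M|; first exact: normr_ge0.
by apply: aeT_imp h => t le; apply: le_trans le _; exact: ler_norm.
Qed.

Lemma Linfty_Sst f : L2 f -> Linfty f -> Linfty (Sst f).
Proof.
move=> Lf If; have [M M0 h] := Linfty_bound If.
split; first by apply: L2_meas; exact: L2_Sst.
exists (M + Normc.normc (coef f 0)); apply: aeT_imp h => t le.
rewrite /Sst !fE Normc.normcM normc_zpow mul1r.
by apply: le_trans (le_normcD _ _) _; rewrite normcN lerD2r.
Qed.

Lemma Kinfty_Sst a f : inner a -> Kinfty a f -> Kinfty a (Sst f).
Proof.
move=> ia [Kf [Hf If]]; split; first exact: (K_Sst ia Kf).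
by split; [exact: H2_Sst|apply: Linfty_Sst If; L2s].
Qed.

Lemma Kinfty_iter_Sst a n f : inner a -> Kinfty a f -> Kinfty a (iter n Sst f).
Proof. by move=> ia Kf; elim: n => // n IH; exact: Kinfty_Sst. Qed.

Lemma Kinfty_K a f : Kinfty a f -> Ksp a f. Proof. by case. Qed.
Lemma Kinfty_Linfty a f : Kinfty a f -> Linfty f. Proof. by case=> _ []. Qed.

Section bounded.
Variables (a b : cfun R) (T : cop R).
Hypotheses (ia : inner a) (ib : inner b) (bT : bounded_op (Ksp a) (Ksp b) T).

Lemma op_K f : Ksp a f -> Ksp b (T f). Proof. by case: bT => h _ _; exact: h. Qed.

Lemma op_bound : exists2 C : R, 0 <= C & forall f, Ksp a f -> norm2 (T f) <= C * norm2 f.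
Proof.
case: bT => _ _ [C hC]; exists `|C|; first exact: normr_ge0.
move=> f Kf; apply: le_trans (hC f Kf) _; rewrite ler_wpM2r ?norm2_ge0//; exact: ler_norm.
Qed.

(** An operator acts on functions, not on classes; it respects [=T] because by linearity and the
    bound its value at a null difference has norm 0. *)
Lemma op_eqT f g : Ksp a f -> Ksp a g -> f =T g -> T f =T T g.
Proof.
move=> Kf Kg fg; have Kn := KZ ia (-1) Kf; have Kd := KD ia (-1) Kf Kg.
have K1 := op_K Kf; have K2 := op_K Kg; have K3 := op_K Kd.
have [C C0 hC] := op_bound.
have T0 : T (-1 *: f + g) =T 0.
  apply: norm2_eq0; L2s; apply/eqP; rewrite eq_le norm2_ge0 andbT.
  apply: le_trans (hC _ Kd) _; rewrite (norm2_eqT (g := 0)) ?norm2_0 ?mulr0//; L2s.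
  by apply: aeT_imp fg => t e; rewrite !fE e mulN1r addNr.
case: bT => _ lin _; have := lin (-1) f g Kf Kg.
apply: aeT_imp2 T0 => t; rewrite !fE => -> /esym/eqP; rewrite mulN1r addrC subr_eq0 => /eqP -> //.
Qed.

(** [f |-> ip (T (PK a f)) g] is a bounded functional on all of L^2, and its representing element is
    projected onto [Ksp a]. *)
Lemma adj_spec g : Ksp b g -> Ksp a (adj (Ksp a) T g) /\
  forall f, Ksp a f -> ip (T f) g = ip f (adj (Ksp a) T g).
Proof.
move=> Kg; apply: (@xgetPex _ 0 [set h | Ksp a h /\ forall f, Ksp a f -> ip (T f) g = ip f h]).
have [C C0 hC] := op_bound.
have [||w Lw hw] := @riesz_representation R (fun f => ip (T (PK a f)) g) (C * norm2 g).
- move=> x f1 f2 L1 L3; have Kp1 := K_PK ia L1; have Kp2 := K_PK ia L3.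
  have K12 := KD ia x Kp1 Kp2.
  have L4 : L2 (x *: f1 + f2) by L2s.
  have Kp := K_PK ia L4; have Ko1 := op_K Kp1; have Ko2 := op_K Kp2.
  have Ko12 := op_K K12; have Kop := op_K Kp.
  rewrite (ip_eqTl _ _ _ (op_eqT Kp K12 (PK_lin ia x L1 L3))); L2s.
  case: bT => _ lin _; rewrite (ip_eqTl _ _ _ (lin x _ _ Kp1 Kp2)); L2s.
  by rewrite ip_linl; L2s.
- move=> f Lf; have Kp := K_PK ia Lf; have Ko := op_K Kp.
  apply: le_trans (cauchy_schwarz _ _) _; L2s.
  rewrite -mulrA [X in C * X]mulrC mulrA; apply: ler_wpM2r; first exact: norm2_ge0.
  apply: le_trans (hC _ Kp) _; apply: ler_wpM2l => //; exact: norm2_PK.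
exists (PK a w); split; first exact: K_PK.
move=> f Kf; have Kp := K_PK ia (K_L2 Kf).
rewrite ip_PKr// -hw; L2s.
have Ko1 := op_K Kp; have Ko2 := op_K Kf.
by apply: ip_eqTl; L2s; apply: op_eqT => //; apply: eqT_sym; exact: PK_id.
Qed.

Lemma K_adj g : Ksp b g -> Ksp a (adj (Ksp a) T g).
Proof. by case/adj_spec. Qed.

Lemma ip_adj f g : Ksp a f -> Ksp b g -> ip (T f) g = ip f (adj (Ksp a) T g).
Proof. by move=> Kf /adj_spec[_]; exact. Qed.

End bounded.

Lemma Wstar_SstE N h t : Wstar N (Sst h) (c t) = zpow (- N%:Z) (c t) * (Wstar N h (c t) - coef h 0).
Proof.
rewrite WstarE /Sst !fE -!WstarE Wstar_zpow mulrN1; congr (_ * (_ - _)).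
Qed.

Section shift_identity.
Variables (N : nat) (a b phi : cfun R) (T : cop R).
Hypotheses (N0 : (0 < N)%N) (ia : inner a) (ib : inner b) (UT : isU N a b phi T).

Let Lphi : L2 phi. Proof. by case: UT. Qed.
Let bT : bounded_op (Ksp a) (Ksp b) T. Proof. by case: UT. Qed.

Lemma ip_isU f g : Kinfty a f -> Ksp b g -> ip (T f) g = ip (phi * f) (Wstar N g).
Proof.
move=> Kf Kg; have Lpf : L2 (phi * f) by rewrite mulrC; apply: Linfty_L2 => //; exact: Kinfty_Linfty Kf.
have KT := op_K bT (Kinfty_K Kf); have LW := L2_W N0 Lpf.
case: UT => _ _ h; rewrite (ip_eqTl _ _ _ (h f Kf)); L2s.
by rewrite ip_PKl// ip_W; L2s.
Qed.

Let defect f h := ip f (conjf phi) * conjc (coef h 0)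
   + \sum_(j < N) coef f j * ip (zpow (j%:Z - N%:Z) * phi) (Wstar N (Sst h)).

(** [iter N Sst f] and [Wstar N (Sst h)] both carry the factor z^(-N), which cancels in the pairing.
    The difference is then due to the [N] Taylor terms removed from [f] and the constant removed
    from [h]. *)
Let shift_identity_infty f h : Kinfty a f -> Ksp b h ->
  ip (T f) h - ip (T (iter N Sst f)) (Sst h) = defect f h.
Proof.
move=> Kf Kh; have Ks := Kinfty_iter_Sst N ia Kf; have Ksh := K_Sst ib Kh.
have Kf' := Kinfty_K Kf; have If := Kinfty_Linfty Kf.
have Lpf : L2 (phi * f) by rewrite mulrC; exact: Linfty_L2.
have Lpz (j : nat) : L2 (phi * zpow j) by rewrite mulrC; L2s.
rewrite !ip_isU// /defect.
pose h1 := Wstar N h - cst (coef h 0).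
have Lh1 : L2 h1 by rewrite /h1; L2s.
have -> : ip (phi * iter N Sst f) (Wstar N (Sst h)) =
   ip (phi * f - \sum_(j < N) coef f j *: (phi * zpow j)) h1.
  apply: ip_ext => t; rewrite Wstar_SstE conjcM zpow_conj opprK.
  rewrite !fE iter_SstE; L2s.
  have e : zpow (- N%:Z) (c t) * zpow N (c t) = 1 by rewrite -zpowD addNr zpow0E.
  have -> : (\sum_(j < N) coef f j *: (phi * zpow j)) (c t) = phi (c t) * fsum f N (c t).
    rewrite fct_sumE /fsum /psum fct_sumE mulr_sumr; apply: eq_bigr => j _.
    by rewrite !fE mulrCA.
  rewrite -[_ - coef h 0]/(h1 (c t)) -mulrBr.
  by rewrite -[RHS]mulr1 -e; ring.
rewrite ipBl; L2s.
  rewrite ip_suml; L2s; last by move=> i _; L2s.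
  rewrite {1}/h1 ipBr; L2s.
  have -> : ip (phi * f) (cst (coef h 0)) = ip f (conjf phi) * conjc (coef h 0).
    have -> : cst (coef h 0) = coef h 0 *: cst 1 :> cfun R by apply/funext => z; rewrite fE mulr1.
    rewrite ipZr; [|by L2s|exact: L2_cst].
    rewrite mulrC; congr (_ * _).
    by apply: ip_ext => t; rewrite !fE conjcK conjc1; ring.
  have lem (p q s : R[i]) : p - (p - q - s) = q + s by ring.
  rewrite lem; congr (_ + _).
  apply: eq_bigr => j _; rewrite ipZl; L2s; congr (_ * _).
  apply: ip_ext => t; rewrite Wstar_SstE conjcM zpow_conj opprK !fE zpowD.
  have e : zpow (- N%:Z) (c t) * zpow N (c t) = 1 by rewrite -zpowD addNr zpow0E.
  by rewrite -[_ - coef h 0]/(h1 (c t)) -[LHS]mulr1 -e; ring.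
Qed.

(** The vector [w] below represents the difference of the two sides as a functional of [f]. The case
    of bounded functions makes it orthogonal to every [PK a (zpow j)], hence null. *)
Theorem shift_identity f h : Ksp a f -> Ksp b h ->
  ip (T f) h - ip (T (iter N Sst f)) (Sst h) =
  ip f (conjf phi) * conjc (coef h 0)
   + \sum_(j < N) coef f j * ip (zpow (j%:Z - N%:Z) * phi) (Wstar N (Sst h)).
Proof.
move=> Kf Kh; have Ksh := K_Sst ib Kh.
pose x (j : 'I_N) := ip (zpow (j%:Z - N%:Z) * phi) (Wstar N (Sst h)).
pose ah := adj (Ksp a) T h; pose ash := adj (Ksp a) T (Sst h).
have Kah : Ksp a ah by exact: (K_adj ia bT).
have Kash : Ksp a ash by exact: (K_adj ia bT).
have Kz (j : nat) : Ksp a (PK a (zpow j)) by apply: K_PK => //; L2s.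
have Kp : Ksp a (PK a (conjf phi)) by apply: K_PK => //; L2s.
have Ki := K_iter_SK ia N Kash.
pose s := \sum_(j < N) conjc (x j) *: PK a (zpow j).
have Ks : Ksp a s.
  by rewrite /s; apply: (K_sum ia) => j _; exact: (KZ ia _ (Kz j)).
pose w := ah - iter N (SK a) ash - (coef h 0 *: PK a (conjf phi) + s).
have Kw : Ksp a w.
  by apply: (KB ia); [exact: (KB ia)|exact: (KD ia)].
have wE u : Ksp a u -> ip u w = ip (T u) h - ip (T (iter N Sst u)) (Sst h) - defect u h.
  move=> Ku; have Kiu := K_iter_Sst ia N Ku.
  rewrite /w ipBr; L2s; rewrite ipBr; L2s; rewrite ipDr; L2s; rewrite ipZr; L2s.
  rewrite (ip_iter_SKr ia N Kash Ku) -(ip_adj ia bT Ku Kh) -(ip_adj ia bT Kiu Ksh).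
  rewrite (ip_PKr ia (L2_conj Lphi) Ku).
  rewrite /s ip_sumr; L2s; last by move=> j _; exact: L2Z (K_L2 (Kz j)).
  rewrite /defect [conjc _ * _]mulrC; congr (_ - (_ + _)).
  apply: eq_bigr => j _; have Kzj := Kz j; rewrite ipZr; L2s.
  by rewrite conjcK (ip_PKr ia (L2_zpow j) Ku) mulrC.
have w0 : w =T 0.
  apply: (K_eq0_coef ia Kw) => j; rewrite wE; last exact: Kz.
  by rewrite (shift_identity_infty (Kinfty_PK_zpow ia j) Kh) subrr.
have := wE f Kf; rewrite (ip_eqTr _ _ _ w0); L2s.
by rewrite ip0r; L2s => /esym/eqP; rewrite subr_eq0 => /eqP.
Qed.

End shift_identity.

End operators.

(** * From the equation back to a symbol *)

Section converse.
Context {R : realType}.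
Local Notation c := (@circle_pt R).
Implicit Types f g h : cfun R.
Opaque L2 H2 Ksp ip.

Lemma ip_iter_Sst_sym (tau g : cfun R) n : H2 tau -> H2 g ->
  ip tau (iter n Sst g) = ip (zpow n * tau) g.
Proof.
move=> Ht Hg; have Lt := H2_L2 Ht; have Lg := H2_L2 Hg.
rewrite (ipC (f := iter n Sst g)); L2s.
by rewrite (ip_iter_Sst n Hg Ht) -ipC; L2s.
Qed.

Lemma cvgC_Z (x : nat -> R[i]) l k : cvgC x l -> cvgC (fun n => k * x n) (k * l).
Proof.
move=> h; apply: (@cvgC_bound _ _ _ (fun n => Normc.normc (x n - l)) (Normc.normc k)) => // n.
  exact: normc_ge0.
by rewrite -mulrBr Normc.normcM.
Qed.

Lemma fsumE f n t : fsum f n t = \sum_(j < n) coef f j * zpow j t.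
Proof. by rewrite /fsum /psum fct_sumE. Qed.

Section converse.
Variables (N : nat) (a b phi : cfun R) (T : cop R).
Variables (tau : 'I_N -> cfun R) (upsilon : cfun R).
Hypotheses (N0 : (0 < N)%N) (ia : inner a) (ib : inner b).
Hypothesis bT : bounded_op (Ksp a) (Ksp b) T.
Hypotheses (Ku : Ksp a upsilon) (Kt : forall p, Ksp b (tau p)).
Hypothesis Lphi : L2 phi.
Hypothesis phiE : forall t, phi (c t) = conjc (upsilon (c t)) +
  \sum_(p < N) p`!%:R * (Wstar N (tau p) (c t) * zpow (- p%:Z) (c t)).
Hypothesis TE : forall f h, Ksp a f -> Ksp b h ->
  ip (T f) h - ip (T (iter N Sst f)) (Sst h) =
  ip f upsilon * conjc (coef h 0) + \sum_(p < N) p`!%:R * coef f p * ip (tau p) h.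

(** The right-hand side of the equation at [iter (n * N) Sst f] and [iter n Sst g], with the shifts
    carried over to [upsilon] and [tau p]. *)
Let term f g n := ip f (zpow (n * N)%N * upsilon) * conjc (coef g n) +
  \sum_(p < N) p`!%:R * (coef f (n * N + p) * ip (zpow n * tau p) g).

Let iterated f g M : Ksp a f -> Ksp b g ->
  ip (T f) g = ip (T (iter (M * N) Sst f)) (iter M Sst g) + \sum_(n < M) term f g n.
Proof.
move=> Kf Kg; elim: M => [|M IH]; first by rewrite big_ord0 addr0 mul0n.
have Kf' := K_iter_Sst ia (M * N) Kf; have Kg' := K_iter_Sst ib M Kg.
have := TE Kf' Kg'; rewrite -iterD -mulSn => /eqP.
rewrite subr_eq => /eqP E.
rewrite IH big_ord_recr /= E.
have -> : term f g M = ip (iter (M * N) Sst f) upsilon * conjc (coef (iter M Sst g) 0) +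
    \sum_(p < N) p`!%:R * coef (iter (M * N) Sst f) p * ip (tau p) (iter M Sst g).
  rewrite /term; congr (_ + _).
    rewrite coef_iter_Sst ?addn0; [|exact: K_H2 Kg].
    by rewrite (ip_iter_Sst _ (K_H2 Kf) (K_H2 Ku)).
  apply: eq_bigr => p _; rewrite -mulrA (coef_iter_Sst _ _ (K_H2 Kf)).
  by rewrite (ip_iter_Sst_sym _ (K_H2 (Kt p)) (K_H2 Kg)).
by rewrite -iterS; ring.
Qed.

Let remainder_cvg f g : Ksp a f -> Ksp b g ->
  cvgC (fun M => \sum_(n < M) term f g n) (ip (T f) g).
Proof.
move=> Kf Kg e e0; have [C C0 hC] := op_bound bT.
(* [C] itself may be 0. The remainder is at most [C] times the two norms, so [e / (C + 1)] for [f]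
   and 1 for [g] are enough. *)
have C1 : 0 < C + 1 by rewrite ltr_wpDl.
have [N1 h1] := iter_Sst_cvg0 (K_H2 Kg) ltr01.
have [N2 h2] := iter_Sst_cvg0 (K_H2 Kf) (divr_gt0 e0 C1).
exists (maxn N1 N2) => M; rewrite geq_max => /andP[M1 M2].
rewrite (iterated M Kf Kg) opprD addrCA subrr addr0 normcN.
have Kf' := K_iter_Sst ia (M * N) Kf; have Kg' := K_iter_Sst ib M Kg.
have KT := op_K bT Kf'.
apply: le_trans (cauchy_schwarz (K_L2 KT) (K_L2 Kg')) _.
rewrite -[leRHS]mulr1; apply: ler_pM; [exact: norm2_ge0|exact: norm2_ge0| |exact: h1].
apply: le_trans (hC _ Kf') _.
have := h2 _ (leq_trans M2 (leq_pmulr M N0)); rewrite ler_pdivlMr// => h.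
apply: le_trans h; rewrite mulrC; apply: ler_wpM2l; first exact: norm2_ge0.
by rewrite lerDl.
Qed.

(** Expansion of [Wstar N g] along the Taylor series of [g], paired with [conjf upsilon * f], which
    is in L^2 because [f] is bounded. *)
Let first_cvg f g : Kinfty a f -> Kinfty b g ->
  cvgC (fun M => \sum_(n < M) ip f (zpow (n * N)%N * upsilon) * conjc (coef g n))
       (ip (conjf upsilon * f) (Wstar N g)).
Proof.
move=> Kf Kg; have Lu : L2 (conjf upsilon * f).
  by rewrite mulrC; apply: Linfty_L2; [exact: Kinfty_Linfty Kf|exact: L2_conj (K_L2 Ku)].
have Hg := K_H2 (Kinfty_K Kg); have Lg := H2_L2 Hg.
have Lf := K_L2 (Kinfty_K Kf); have Lup := K_L2 Ku.
have cg : cvgL2 (fun M => Wstar N (fsum g M)) (Wstar N g).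
  move=> e /(cvg_fsum Hg)[M hM]; exists M => n /hM.
  by rewrite -(norm2_Wstar N0); L2s.
apply: cvgC_near (cvgL2_ipr _ _ Lu cg); L2s; last by move=> n; L2s.
exists 0%N => M _.
have -> : Wstar N (fsum g M) = \sum_(n < M) coef g n *: Wstar N (zpow n).
  by apply/funext => z; rewrite WstarE fsumE fct_sumE.
rewrite ip_sumr; L2s; last by move=> i _; L2s.
apply: eq_bigr => n _; rewrite ipZr; L2s; rewrite mulrC; congr (_ * _).
apply: ip_ext => t; rewrite Wstar_zpow !fE conjcM PoszM [N%:Z * _]mulrC; ring.
Qed.

(** Expansion of [u = W N (zpow (- p) * f)], whose [n]-th coefficient is [coef f (n * N + p)]; it
    lies in [H2] because [p < N]. It is paired with [conjf (tau p) * g], in L^2 because [g] is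
    bounded. *)
Let second_cvg (p : 'I_N) f g : Kinfty a f -> Kinfty b g ->
  cvgC (fun M => \sum_(n < M) coef f (n * N + p) * ip (zpow n * tau p) g)
       (ip (Wstar N (tau p) * (zpow (- p%:Z) * f)) (Wstar N g)).
Proof.
move=> Kf Kg; have Lf := K_L2 (Kinfty_K Kf); have Hf := K_H2 (Kinfty_K Kf).
have Lg := K_L2 (Kinfty_K Kg); have Lt := K_L2 (Kt p).
have Ltg : L2 (conjf (tau p) * g).
  by rewrite mulrC; apply: Linfty_L2; [exact: Kinfty_Linfty Kg|exact: L2_conj].
pose u := W N (zpow (- p%:Z) * f).
have Lu : L2 u by rewrite /u; L2s.
have cu (n : int) : ip u (zpow n) = ip f (zpow (N%:Z * n + p%:Z)).
  rewrite /u ip_W; L2s; rewrite zpowM_adj opprK; apply: ip_ext => t.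
  by rewrite !fE Wstar_zpow -zpowD addrC.
have Hu : H2 u.
  apply: H2I => // n; rewrite cu.
  have -> : N%:Z * - n.+1%:Z + p%:Z = - (N * n.+1 - p).-1.+1%:Z.
    have h : (p < N * n.+1)%N by rewrite (leq_trans (ltn_ord p))// leq_pmulr.
    rewrite prednK ?subn_gt0// -subzn; last exact: ltnW.
    by rewrite opprB PoszM mulrN addrC.
  exact: H2_neg.
have -> : ip (Wstar N (tau p) * (zpow (- p%:Z) * f)) (Wstar N g) = ip u (conjf (tau p) * g).
  rewrite /u ip_W; L2s; apply: ip_ext => t.
  by rewrite !fE !WstarE !fE conjcM conjcK; ring.
apply: cvgC_near (cvgL2_ip (L2_fsum u) Lu Ltg (cvg_fsum Hu)).
exists 0%N => M _; rewrite /fsum /psum ip_suml; [|by move=> i _; rewrite /en; L2s|by []].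
apply: eq_bigr => n _; rewrite ipZl; [|by rewrite /en; L2s|by []].
rewrite /en cu /coef; congr (ip f _ * _).
  by rewrite PoszD PoszM [N%:Z * _]mulrC.
by apply: ip_ext => t; rewrite !fE conjcM conjcK; ring.
Qed.

Theorem isU_of_shift_identity : isU N a b phi T.
Proof.
split => // f Kf.
have Lpf : L2 (phi * f).
  by rewrite mulrC; apply: Linfty_L2 => //; exact: Kinfty_Linfty Kf.
have LW := L2_W N0 Lpf.
have KT := op_K bT (Kinfty_K Kf); have KP := K_PK ib LW.
apply: (K_eqT_coef KT KP) => i.
(* Coefficients are pairings with the bounded functions [PK b (zpow i)], for which the convergence
   of both sums is available. *)
have Kg := Kinfty_PK_zpow ib i; set g := PK b (zpow i) in Kg.
have Lz := @L2_zpow R i.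
rewrite /coef -(ip_PKr ib Lz KT) -(ip_PKr ib Lz KP) -/g.
rewrite (ip_PKl ib LW (Kinfty_K Kg)) (ip_W N0 Lpf (K_L2 (Kinfty_K Kg))).
have Lf := K_L2 (Kinfty_K Kf); have Lup := K_L2 Ku; have Lg := K_L2 (Kinfty_K Kg).
have If := Kinfty_Linfty Kf.
have L1 : L2 (conjf upsilon * f) by rewrite mulrC; apply: Linfty_L2 => //; L2s.
have L3 p : L2 (Wstar N (tau p) * (zpow (- p%:Z) * f)).
  have Lt := K_L2 (Kt p).
  by rewrite mulrCA [Wstar _ _ * _]mulrC; apply: L2_zpowM; apply: Linfty_L2 => //; L2s.
have -> : ip (phi * f) (Wstar N g) = ip (conjf upsilon * f) (Wstar N g) +
   \sum_(p < N) p`!%:R * ip (Wstar N (tau p) * (zpow (- p%:Z) * f)) (Wstar N g).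
  have -> : ip (phi * f) (Wstar N g) = ip (conjf upsilon * f + \sum_(p < N) p`!%:R *: (Wstar N (tau p) * (zpow (- p%:Z) * f))) (Wstar N g).
    apply: ip_ext => t; congr (_ * _); rewrite !fE phiE fct_sumE mulrDl mulr_suml; congr (_ + _).
    by apply: eq_bigr => p _; rewrite !fE; ring.
  have Ls : L2 (\sum_(p < N) p`!%:R *: (Wstar N (tau p) * (zpow (- p%:Z) * f))).
    by apply: L2_sum => p _; exact: L2Z.
  have LWg := L2_Wstar N0 Lg.
  rewrite (ipDl L1 Ls LWg); congr (_ + _).
  rewrite ip_suml; [|by move=> p _; exact: L2Z|by []].
  by apply: eq_bigr => p _; rewrite ipZl; L2s.
apply: cvgC_unique (remainder_cvg (Kinfty_K Kf) (Kinfty_K Kg)) _.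
have cZ (p : 'I_N) := cvgC_Z p`!%:R (second_cvg p Kf Kg).
apply: cvgC_near (cvgC_D (first_cvg Kf Kg) (@cvgC_sum _ _ (index_enum _) xpredT _ _ (fun p _ => cZ p))).
exists 0%N => M _; rewrite /term big_split /=; congr (_ + _).
by rewrite exchange_big /=; apply: eq_bigr => p _; rewrite mulr_sumr.
Qed.

End converse.
End converse.

(** * The operator identity and the symbol of the product *)

Section main.
Context {R : realType}.
Local Notation c := (@circle_pt R).
Implicit Types f g h x : cfun R.
Opaque L2 H2 Ksp ip.

Lemma zbarXE i t : (@zbar R ^+ i) (c t) = zpow (- i%:Z) (c t).
Proof. by rewrite cfunXE /zbar circle_pt_conj /zpow -exprnN exprVn. Qed.

Lemma L2_zbarX i f : L2 f -> L2 (@zbar R ^+ i * f).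
Proof.
move=> Lf; apply: (@L2_eqc _ (zpow (- i%:Z) * f)); last exact: L2_zpowM.
by move=> t; rewrite !fE zbarXE.
Qed.

Section model_shift_identity.
Variables (N : nat) (a b : cfun R) (T : cop R).
Hypotheses (N0 : (0 < N)%N) (ia : inner a) (ib : inner b).

(** Links the sections of the symbol in [shift_identity] to the vectors [S P W (zbar^(N-j) u)] of
    the operator identity, by taking the adjoints of S, P and W. *)
Lemma ip_SPW u (j : nat) h : (j < N)%N -> L2 u -> Ksp b h ->
  ip (SK b (PK b (W N (@zbar R ^+ (N - j) * u)))) h =
  ip (zpow (j%:Z - N%:Z) * u) (Wstar N (Sst h)).
Proof.
move=> jN Lu Kh; have Ksh := K_Sst ib Kh.
have Lz := L2_zbarX (N - j) Lu; have LW := L2_W N0 Lz; have KP := K_PK ib LW.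
rewrite (ip_SKl ib KP Kh) (ip_PKl ib LW Ksh) (ip_W N0 Lz (K_L2 Ksh)).
apply: ip_ext => t; congr (_ * _); rewrite !fE zbarXE; congr (zpow _ _ * _).
by rewrite -subzn ?opprB// ltnW.
Qed.

(** For an arbitrary symbol, as is the one of [A \o B] in the direct implication. *)
Lemma shift_identity_PK phi : isU N a b phi T ->
  forall f h, Ksp a f -> Ksp b h ->
  ip (T f) h - ip (T (iter N Sst f)) (Sst h) =
  ip f (PK a (conjf phi)) * conjc (coef h 0) +
  \sum_(j < N) coef f j * ip (SK b (PK b (W N (@zbar R ^+ (N - j) * phi)))) h.
Proof.
move=> UT f h Kf Kh; have Lphi : L2 phi by case: UT.
rewrite (shift_identity N0 ia ib UT Kf Kh) (ip_PKr ia (L2_conj Lphi) Kf); congr (_ + _).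
by apply: eq_bigr => j _; rewrite (ip_SPW (ltn_ord j) Lphi Kh).
Qed.

(** For this form of symbol the two parts separate. [conjf q] has negative frequencies only, so the
    first term sees [p] alone. For [j < N], [W N] of [zpow (j - N) * conjf p] has negative
    frequencies only and is orthogonal to [Sst h], so the sum sees [q] alone. *)
Lemma shift_identity_std p q : Ksp a p -> zK (Wstar N b) q -> isU N a b (conjf p + q) T ->
  forall f h, Ksp a f -> Ksp b h ->
  ip (T f) h - ip (T (iter N Sst f)) (Sst h) =
  ip f p * conjc (coef h 0) +
  \sum_(j < N) coef f j * ip (SK b (PK b (W N (@zbar R ^+ (N - j) * q)))) h.
Proof.
move=> Kp [Lq [q0 Kq0 qE]] UT f h Kf Kh.
have Lp := K_L2 Kp; have Lf := K_L2 Kf; have Ksh := K_Sst ib Kh.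
rewrite (shift_identity N0 ia ib UT Kf Kh); congr (_ * _ + _).
  have -> : conjf (conjf p + q) = p + conjf q.
    by apply/funext => z; rewrite !fE conjcD conjcK.
  rewrite ipDr; L2s; rewrite (ipC (f := conjf q)); L2s.
  suff -> : ip (conjf q) f = 0 by rewrite conjc0 addr0.
  apply: H2_orth; [by L2s|exact: K_H2 Kf|move=> n].
  have Lq0 := K_L2 Kq0.
  have Lz : L2 (zpow 1 * q0) by L2s.
  rewrite (ip_eqTl (g := conjf (zpow 1 * q0))); L2s; last first.
    by apply: aeT_imp qE => t e; rewrite !fE e idzE.
  rewrite (ip_ext (f' := zpow (- n.+1%:Z)) (g' := q0)) => [|t].
    rewrite (ipC (f := q0)); L2s.
    by rewrite (H2_neg _ (K_H2 Kq0)) conjc0.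
  by rewrite !fE conjcM !zpow_conj -addn1 PoszD opprD zpowD; ring.
apply: eq_bigr => j _; congr (_ * _).
rewrite (ip_SPW (ltn_ord j) Lq Kh) mulrDr ipDl; L2s.
rewrite [X in X + _](_ : _ = 0) ?add0r//.
have Lu : L2 (zpow (j%:Z - N%:Z) * conjf p) by L2s.
rewrite -(ip_W N0 Lu (K_L2 Ksh)) H2_orth//; [exact: L2_W|exact: K_H2 Ksh|move=> n].
rewrite (ip_W N0 Lu (L2_zpow n)).
rewrite (ip_ext (f' := zpow (- (N * n.+1 - j).-1.+1%:Z)) (g' := p)) => [|t].
  rewrite (ipC (f := p)); L2s.
  by rewrite (H2_neg _ (K_H2 Kp)) conjc0.
have h1 : (j < N * n.+1)%N by rewrite (leq_trans (ltn_ord j))// leq_pmulr.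
rewrite prednK ?subn_gt0// -subzn; last exact: ltnW.
rewrite Wstar_zpow !fE zpow_conj mulrAC -zpowD; congr (zpow _ _ * _).
by rewrite opprB mulnS PoszD PoszM opprD addrA.
Qed.

Lemma iterate_shift (F : cfun R -> cfun R -> R[i]) :
  (forall f h, Ksp a f -> Ksp b h -> ip (T f) h - ip (T (iter N Sst f)) (Sst h) = F f h) ->
  forall M f h, Ksp a f -> Ksp b h ->
  ip (T f) h = ip (T (iter (N * M) Sst f)) (iter M Sst h) +
    \sum_(n < M) F (iter (N * n) Sst f) (iter n Sst h).
Proof.
move=> TE M f h Kf Kh; elim: M => [|M ->]; first by rewrite muln0 big_ord0 addr0.
rewrite big_ord_recr /= -TE; [|exact: (K_iter_Sst ia)|exact: (K_iter_Sst ib)].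
rewrite -iterD -mulnS; ring.
Qed.

End model_shift_identity.

Lemma big_block (V : zmodType) (k m : nat) (F : nat -> V) :
  \sum_(p < k * m) F p = \sum_(n < m) \sum_(k * n <= p < k * n.+1) F p.
Proof.
rewrite -(big_mkord xpredT F); elim: m => [|m IH]; first by rewrite muln0 big_ord0 big_geq.
by rewrite big_ord_recr /= -IH -big_cat_nat ?leq_mul2l ?leqnSn ?orbT.
Qed.

Lemma big_block_ord (V : zmodType) (k n : nat) (F : nat -> V) :
  \sum_(k * n <= p < k * n.+1) F p = \sum_(l < k) F (k * n + l)%N.
Proof.
rewrite -{1}[(k * n)%N]add0n big_addn mulnS addnK big_mkord.
by apply: eq_bigr => l _; rewrite addnC.
Qed.

(** Within the [n]-th block the quotient [p %/ k] is [n], so the block index can be read off [p]. *)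
Lemma big_block_div (V : zmodType) (k m : nat) (F : nat -> nat -> V) : (0 < k)%N ->
  \sum_(n < m) \sum_(k * n <= p < k * n.+1) F n p = \sum_(p < k * m) F (p %/ k)%N p.
Proof.
move=> k0_; rewrite (@big_block _ k m (fun p => F (p %/ k)%N p)).
apply: eq_bigr => n _; apply: eq_big_nat => p /andP[h1 h2].
suff -> : (p %/ k)%N = n by [].
by apply/eqP; rewrite eqn_leq -ltnS ltn_divLR// leq_divRL// ![(_ * k)%N]mulnC h1 h2.
Qed.

Lemma conjf_sum (J : Type) (r : seq J) (P : pred J) (F : J -> cfun R) :
  conjf (\sum_(i <- r | P i) F i) = \sum_(i <- r | P i) conjf (F i).
Proof.
apply: (big_morph (@conjf R)) => [f g|]; apply/funext => z; first by rewrite !fE conjcD.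
by rewrite fE conjc0.
Qed.

Lemma conjfZ a f : conjf (a *: f) = conjc a *: conjf f.
Proof. by apply/funext => z; rewrite !fE conjcM. Qed.

Lemma conjfB f g : conjf (f - g) = conjf f - conjf g.
Proof. by apply/funext => z; rewrite !fE rmorphB. Qed.

Lemma bounded_comp (a b d : cfun R) (A B : cop R) : inner b -> inner d ->
  bounded_op (Ksp b) (Ksp d) A -> bounded_op (Ksp a) (Ksp b) B -> inner a ->
  bounded_op (Ksp a) (Ksp d) (A \o B).
Proof.
move=> ib id bA bB ia; split.
- by move=> f Kf; exact: (op_K bA (op_K bB Kf)).
- move=> x f g Kf Kg; have K1 := op_K bB Kf; have K2 := op_K bB Kg.
  have K3 := op_K bB (KD ia x Kf Kg); have K4 := KD ib x K1 K2.
  case: (bA) (bB) => _ linA _ [_ linB _].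
  apply: eqT_trans (linA x _ _ K1 K2).
  exact: (op_eqT ib bA K3 K4 (linB x _ _ Kf Kg)).
- have [C C0 hC] := op_bound bA; have [D D0 hD] := op_bound bB.
  exists (C * D) => f Kf; have K1 := op_K bB Kf.
  by apply: le_trans (hC _ K1) _; rewrite -mulrA ler_wpM2l// hD.
Qed.

Section product.
Variables (alpha beta gamma : cfun R) (k m : nat).
Variables (phim phip psim psip : cfun R) (A B : cop R).
Hypotheses (ia : inner alpha) (ib : inner beta) (ig : inner gamma).
Hypotheses (k0_ : (0 < k)%N) (m0 : (0 < m)%N).
Hypotheses (Kphim : Ksp beta phim) (zKphip : zK (Wstar m gamma) phip).
Hypothesis UA : isU m beta gamma (conjf phim + phip) A.
Hypotheses (Kpsim : Ksp alpha psim) (zKpsip : zK (Wstar k beta) psip).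
Hypothesis UB : isU k alpha beta (conjf psim + psip) B.

Let bA : bounded_op (Ksp beta) (Ksp gamma) A. Proof. by case: UA. Qed.
Let bB : bounded_op (Ksp alpha) (Ksp beta) B. Proof. by case: UB. Qed.
Let Lphip : L2 phip. Proof. by case: zKphip. Qed.
Let Lpsip : L2 psip. Proof. by case: zKpsip. Qed.
Let Bs := adj (Ksp alpha) B.
Let tt (j : nat) := SK gamma (PK gamma (W m (@zbar R ^+ (m - j) * phip))).
Let G n i := iter n.+1 (SK beta) (PK beta (W k (@zbar R ^+ i * psip))).
(** By [ip_iter_SK_k0] the pairing of [g] with [e n] is [coef g n], so up to [=T] this is
    [k0 beta n] divided by [n!]. *)
Let e n := iter n (SK beta) (k0 beta 0).
Let s n := iter (k * n) (SK alpha) psim.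

Let Kt j : Ksp gamma (tt j).
Proof. by apply: (K_SK ig); apply: K_L2 (K_PK ig (L2_W m0 _)); exact: L2_zbarX. Qed.
Let KG n i : Ksp beta (G n i).
Proof. by apply: (K_iter_SK ib); apply: (K_PK ib (L2_W k0_ _)); exact: L2_zbarX. Qed.
Let Ke n : Ksp beta (e n).
Proof. by apply: (K_iter_SK ib); exact: K_k0. Qed.
Let Ks n : Ksp alpha (s n).
Proof. exact: (K_iter_SK ia). Qed.
Let KBs g : Ksp beta g -> Ksp alpha (Bs g).
Proof. exact: (K_adj ia bB). Qed.

Let identityA x h : Ksp beta x -> Ksp gamma h ->
  ip (A x) h - ip (A (iter m Sst x)) (Sst h) =
  ip x phim * conjc (coef h 0) + \sum_(j < m) coef x j * ip (tt j) h.
Proof. exact: (shift_identity_std m0 ib ig Kphim zKphip UA). Qed.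

(** The equation of [B] iterated [m] times, with the backward shifts of the second slot moved to the
    first as powers of [SK beta]. *)
Let identityB f g : Ksp alpha f -> Ksp beta g ->
  ip (B f) g = ip (iter m (SK beta) (B (iter (k * m) Sst f))) g +
  \sum_(n < m) (ip f (s n) * ip (e n) g +
     \sum_(l < k) coef f (k * n + l) * ip (G n (k - l)) g).
Proof.
move=> Kf Kg; have Kf' := K_iter_Sst ia (k * m) Kf.
rewrite (iterate_shift ia ib (shift_identity_std k0_ ia ib Kpsim zKpsip UB) m Kf Kg).
rewrite (ip_iter_SKl ib m (op_K bB Kf') Kg); congr (_ + _).
apply: eq_bigr => n _; have Kgn := K_iter_Sst ib n Kg; congr (_ + _).
  rewrite (ip_iter_SKr ia (k * n) Kpsim Kf); congr (_ * _).
  rewrite (coef_iter_Sst _ _ (K_H2 Kg)) addn0 (ipC (K_L2 Kg) (K_L2 (Ke n))).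
  by rewrite (ip_iter_SK_k0 ib n 0 Kg) addn0 fact0 mul1r.
apply: eq_bigr => l _; rewrite (coef_iter_Sst _ _ (K_H2 Kf)); congr (_ * _).
have LW := L2_W k0_ (L2_zbarX (k - l) Lpsip).
have Kr := K_SK ib (K_L2 (K_PK ib LW)).
by rewrite -(ip_iter_SKl ib n Kr Kg) /G iterSr.
Qed.

(** Collects what multiplies [conjc (coef h 0)]: the first term of [identityA], taken at [B f], at
    the [e n] and at the [G n (k - l)]. The scalars are conjugated since [ip] is conjugate-linear in
    its second slot. *)
Definition remainder_upsilon : cfun R :=
  Bs phim - \sum_(n < m) conjc (ip (e n) phim) *: s n
  - \sum_(n < m) \sum_(l < k) conjc (l`!%:R^-1 * ip (G n (k - l)) phim) *:
       iter (k * n) (SK alpha) (k0 alpha l).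

(** Collects what multiplies [coef f p] for [p = k * n + l] with [l < k]; then [k * n.+1 - p] is
    [k - l]. *)
Definition remainder_tau_fun (n p : nat) : cfun R :=
  A (G n (k * n.+1 - p)) - \sum_(j < m) (j`!%:R^-1 * ip (G n (k * n.+1 - p)) (k0 beta j)) *: tt j.

(** The quotient [p %/ k] is the block of [p], and the inverse factorial offsets the [p!] with which
    [tau p] enters the equation. *)
Definition remainder_tau (p : nat) : cfun R := p`!%:R^-1 *: remainder_tau_fun (p %/ k) p.

Lemma K_remainder_upsilon : Ksp alpha remainder_upsilon.
Proof.
apply: (KB ia); [apply: (KB ia); [exact: KBs|]|].
- by apply: (K_sum ia) => n _; exact: (KZ ia).
- apply: (K_sum ia) => n _; apply: (K_sum ia) => l _; apply: (KZ ia); apply: (K_iter_SK ia).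
  exact: K_k0.
Qed.

Lemma K_remainder_tau_fun n p : Ksp gamma (remainder_tau_fun n p).
Proof.
apply: (KB ig); first exact: (op_K bA).
by apply: (K_sum ig) => j _; exact: (KZ ig).
Qed.

Lemma K_remainder_tau p : Ksp gamma (remainder_tau p).
Proof. by apply: (KZ ig); exact: K_remainder_tau_fun. Qed.

Lemma ip_remainder_upsilon f : Ksp alpha f ->
  ip f remainder_upsilon = ip (B f) phim - \sum_(n < m) ip f (s n) * ip (e n) phim
  - \sum_(n < m) \sum_(l < k) coef f (k * n + l) * ip (G n (k - l)) phim.
Proof.
move=> Kf; have Lf := K_L2 Kf; have LBs := K_L2 (KBs Kphim).
have Li n (l : nat) : L2 (iter (k * n) (SK alpha) (k0 alpha l)).
  by apply: K_L2; apply: (K_iter_SK ia); exact: K_k0.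
have L1 : L2 (\sum_(n < m) conjc (ip (e n) phim) *: s n).
  by apply: L2_sum => n _; exact: L2Z (K_L2 (Ks n)).
have L3 n : L2 (\sum_(l < k) conjc (l`!%:R^-1 * ip (G n (k - l)) phim) *:
       iter (k * n) (SK alpha) (k0 alpha l)).
  by apply: L2_sum => l _; exact: L2Z (Li _ _).
have L4 : L2 (\sum_(n < m) \sum_(l < k) conjc (l`!%:R^-1 * ip (G n (k - l)) phim) *:
       iter (k * n) (SK alpha) (k0 alpha l)).
  by apply: L2_sum => n _; exact: L3.
rewrite /remainder_upsilon (ipBr Lf (L2B LBs L1) L4) (ipBr Lf LBs L1).
rewrite -(ip_adj ia bB Kf Kphim); congr (_ - _ - _).
- rewrite ip_sumr; [|by move=> n _; exact: L2Z (K_L2 (Ks n))|by []].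
  by apply: eq_bigr => n _; rewrite (ipZr _ Lf (K_L2 (Ks n))) conjcK mulrC.
- rewrite ip_sumr; [|by move=> n _; exact: L3|by []].
  apply: eq_bigr => n _; rewrite ip_sumr; [|by move=> l _; exact: L2Z (Li _ _)|by []].
  apply: eq_bigr => l _; rewrite (ipZr _ Lf (Li _ _)) conjcK (ip_iter_SK_k0 ia _ _ Kf).
  have l0 : l`!%:R != 0 :> R[i] by rewrite pnatr_eq0 -lt0n fact_gt0.
  by field.
Qed.

Lemma ip_remainder_tau_fun n p h : Ksp gamma h ->
  ip (remainder_tau_fun n p) h = ip (A (G n (k * n.+1 - p))) h -
   \sum_(j < m) coef (G n (k * n.+1 - p)) j * ip (tt j) h.
Proof.
move=> Kh; have Lh := K_L2 Kh.
have KGp := KG n (k * n.+1 - p); have KA := op_K bA KGp.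
rewrite /remainder_tau_fun (ipBl (K_L2 KA) _ Lh); last first.
  by apply: L2_sum => j _; exact: L2Z (K_L2 (Kt j)).
congr (_ - _); rewrite ip_suml; [|by move=> j _; exact: L2Z (K_L2 (Kt j))|by []].
apply: eq_bigr => j _; rewrite (ipZl _ (K_L2 (Kt j)) Lh) (ip_k0 ib j KGp).
have j0 : j`!%:R != 0 :> R[i] by rewrite pnatr_eq0 -lt0n fact_gt0.
by field.
Qed.

Let lhs := product_lhs alpha beta gamma k m phip psim A B.

Lemma product_lhsE f : lhs f =
  \sum_(n < m) n`!%:R^-1 *: (ip f (s n) *: A (k0 beta n))
  - \sum_(j < m) (j`!%:R^-1) ^+ 2 *:
      (ip f (iter (k * m) (SK alpha) (Bs (k0t beta j))) *: SK gamma (A (k0t beta j)))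
  + \sum_(j < m) j`!%:R^-1 *:
      (ip f (Bs (k0 beta j) - \sum_(n < m) conjc (ip (e n) (k0 beta j)) *: s n) *: tt j).
Proof.
rewrite /lhs /product_lhs.
rewrite -[LHS]/((\sum_(n < m) _) f - (\sum_(j < m) _) f + (\sum_(j < m) _) f).
by rewrite !fct_sumE.
Qed.

Let KAk n : Ksp gamma (A (k0 beta n)).
Proof. by apply: (op_K bA); exact: K_k0. Qed.
Let KSAk j : Ksp gamma (SK gamma (A (k0t beta j))).
Proof. by apply: (K_SK ig); apply: K_L2 (op_K bA _); exact: (K_k0t ib). Qed.

Lemma K_product_lhs f : Ksp gamma (lhs f).
Proof.
rewrite product_lhsE -[X in X + _]scale1r; apply: (KD ig); first apply: (KB ig).
- by apply: (K_sum ig) => n _; do 2! apply: (KZ ig).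
- by apply: (K_sum ig) => n _; do 2! apply: (KZ ig).
- by apply: (K_sum ig) => n _; do 2! apply: (KZ ig).
Qed.

Let ip_Ae n h : Ksp gamma h -> n`!%:R^-1 * ip (A (k0 beta n)) h = ip (A (e n)) h.
Proof.
move=> Kh; have Kas := K_adj ib bA Kh; have Kk := K_k0 ib n.
rewrite (ip_adj ib bA Kk Kh) (ip_adj ib bA (Ke n) Kh).
rewrite (ipC (K_L2 Kas) (K_L2 Kk)) (ipC (K_L2 Kas) (K_L2 (Ke n))).
rewrite (ip_k0 ib n Kas) (ip_iter_SK_k0 ib n 0 Kas) addn0 fact0 mul1r.
have n0 : n`!%:R != 0 :> R[i] by rewrite pnatr_eq0 -lt0n fact_gt0.
by rewrite conjcM conjc_nat mulKf.
Qed.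

Lemma ip_product_lhs f h : Ksp alpha f -> Ksp gamma h ->
  ip (lhs f) h = \sum_(n < m) ip f (s n) * ip (A (e n)) h
  - \sum_(j < m) (j`!%:R^-1) ^+ 2 *
      (ip f (iter (k * m) (SK alpha) (Bs (k0t beta j))) * ip (SK gamma (A (k0t beta j))) h)
  + \sum_(j < m) (coef (B f) j - \sum_(n < m) coef (e n) j * ip f (s n)) * ip (tt j) h.
Proof.
move=> Kf Kh; have Lf := K_L2 Kf; have Lh := K_L2 Kh.
have L1 n a : L2 (a *: A (k0 beta n)) by exact: L2Z (K_L2 (KAk n)).
have L3 j a : L2 (a *: SK gamma (A (k0t beta j))) by exact: L2Z (K_L2 (KSAk j)).
have L4 j a : L2 (a *: tt j) by exact: L2Z (K_L2 (Kt j)).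
rewrite product_lhsE ipDl; [|apply: L2B; apply: L2_sum => n _; exact: L2Z|by apply: L2_sum => n _; exact: L2Z|by []].
rewrite ipBl; [|by apply: L2_sum => n _; exact: L2Z|by apply: L2_sum => n _; exact: L2Z|by []].
congr (_ - _ + _).
- rewrite ip_suml; [|by move=> n _; exact: L2Z|by []].
  apply: eq_bigr => n _; rewrite (ipZl _ (L1 _ _) Lh) (ipZl _ (K_L2 (KAk n)) Lh).
  by rewrite mulrCA ip_Ae.
- rewrite ip_suml; [|by move=> n _; exact: L2Z|by []].
  by apply: eq_bigr => n _; rewrite (ipZl _ (L3 _ _) Lh) (ipZl _ (K_L2 (KSAk n)) Lh).
- rewrite ip_suml; [|by move=> n _; exact: L2Z|by []].
  apply: eq_bigr => j _; rewrite (ipZl _ (L4 _ _) Lh) (ipZl _ (K_L2 (Kt j)) Lh) mulrA.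
  congr (_ * _).
  have Kk := K_k0 ib j; have KBk := KBs Kk.
  have j0 : j`!%:R != 0 :> R[i] by rewrite pnatr_eq0 -lt0n fact_gt0.
  rewrite ipBr; [|by []|exact: K_L2 KBk|by apply: L2_sum => n _; exact: L2Z (K_L2 (Ks n))].
  rewrite -(ip_adj ia bB Kf Kk) (ip_k0 ib j (op_K bB Kf)) mulrBr mulKf//.
  congr (_ - _); rewrite ip_sumr; [|by move=> n _; exact: L2Z (K_L2 (Ks n))|by []].
  rewrite mulr_sumr; apply: eq_bigr => n _.
  by rewrite (ipZr _ Lf (K_L2 (Ks n))) conjcK (ip_k0 ib j (Ke n)) -mulrA mulKf.
Qed.

Lemma sum_remainder_tau f h : Ksp gamma h ->
  \sum_(p < k * m) p`!%:R * coef f p * ip (remainder_tau p) h =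
  \sum_(n < m) \sum_(l < k) coef f (k * n + l) *
    (ip (A (G n (k - l))) h - \sum_(j < m) coef (G n (k - l)) j * ip (tt j) h).
Proof.
move=> Kh.
rewrite (@big_block _ k m (fun p => p`!%:R * coef f p * ip (remainder_tau p) h)).
apply: eq_bigr => n _.
rewrite (@big_block_ord _ k n (fun p => p`!%:R * coef f p * ip (remainder_tau p) h)).
apply: eq_bigr => l _; set p := (k * n + l)%N.
have pk : (p %/ k)%N = n by rewrite /p mulnC divnMDl// divn_small ?addn0.
have pl : (k * n.+1 - p)%N = (k - l)%N by rewrite /p mulnS addnC subnDl.
have p0 : p`!%:R != 0 :> R[i] by rewrite pnatr_eq0 -lt0n fact_gt0.
rewrite -pl -(ip_remainder_tau_fun n p Kh) /remainder_tau pk.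
rewrite (ipZl _ (K_L2 (K_remainder_tau_fun _ _)) (K_L2 Kh)).
by field.
Qed.

Lemma shift_identity_product f h : Ksp alpha f -> Ksp gamma h ->
  ip (A (B f)) h - ip (A (B (iter (k * m) Sst f))) (Sst h) =
  ip (lhs f) h + ip f remainder_upsilon * conjc (coef h 0) +
  \sum_(p < k * m) p`!%:R * coef f p * ip (remainder_tau p) h.
Proof.
move=> Kf Kh; have KBf := op_K bB Kf.
have Kf' := K_iter_Sst ia (k * m) Kf; have Ky := op_K bB Kf'.
have Ksh := K_Sst ig Kh; have Ka := K_adj ib bA Ksh.
set a' := adj (Ksp beta) A (Sst h) in Ka; set y := B (iter _ _ _) in Ky *.
(* With [g = S^m A^* S^* h], the pairing [ip x g] is the second term of [identityA], so that [gE] is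
   [identityA] solved for it. *)
have Kg := K_iter_SK ib m Ka; set g := iter m (SK beta) a' in Kg.
have gE x : Ksp beta x -> ip x g =
    ip (A x) h - ip x phim * conjc (coef h 0) - \sum_(j < m) coef x j * ip (tt j) h.
  move=> Kx; rewrite (ip_iter_SKr ib m Ka Kx) -(ip_adj ib bA (K_iter_Sst ib m Kx) Ksh).
  rewrite -[RHS]addrA -opprD -(identityA Kx Kh); ring.
(* [identityB] makes [ip (S^m y) (S^m a')] appear, and [ip_iter_SK2] reduces it to [ip y a'], the
   second term of the equation for the product. *)
have E := gE _ KBf; rewrite (identityB Kf Kg) -/y (ip_iter_SK2 ib m Ky Ka) in E.
rewrite -(ip_adj ib bA Ky Ksh) in E.
have -> : ip (A (B f)) h - ip (A y) (Sst h) =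
  ip (B f) phim * conjc (coef h 0) + \sum_(j < m) coef (B f) j * ip (tt j) h
  - \sum_(j < m) (j`!%:R^-1) ^+ 2 * (ip y (k0t beta j) * ip (k0t beta j) a')
  + \sum_(n < m) (ip f (s n) * ip (e n) g +
     \sum_(l < k) coef f (k * n + l) * ip (G n (k - l)) g).
  set u := \sum_(n < m) (_ + _) in E *; set v := \sum_(j < m) (_ ^+ 2 * _) in E *.
  have -> : u = ip (A (B f)) h - ip (B f) phim * conjc (coef h 0) -
     \sum_(j < m) coef (B f) j * ip (tt j) h - (ip (A y) (Sst h) - v) by rewrite -E; ring.
  ring.
rewrite (ip_product_lhs Kf Kh) (ip_remainder_upsilon Kf) (sum_remainder_tau f Kh).
(* What [S^m] loses against an isometry becomes the second sum of [product_lhs], after moving [B]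
   and [A] across by their adjoints. *)
have -> : \sum_(j < m) (j`!%:R^-1) ^+ 2 * (ip y (k0t beta j) * ip (k0t beta j) a') =
  \sum_(j < m) (j`!%:R^-1) ^+ 2 *
      (ip f (iter (k * m) (SK alpha) (Bs (k0t beta j))) * ip (SK gamma (A (k0t beta j))) h).
  apply: eq_bigr => j _; congr (_ * (_ * _)); have Kk := K_k0t ib j.
    by rewrite (ip_iter_SKr ia (k * m) (KBs Kk) Kf) -(ip_adj ia bB Kf' Kk).
  by rewrite -(ip_adj ib bA Kk Ksh) (ip_SKl ig (op_K bA Kk) Kh).
rewrite big_split /=.
(* [gE] at [e n]: the first and last of the three sums belong to [product_lhs], the middle one to
   [remainder_upsilon]. *)
have -> : \sum_(n < m) ip f (s n) * ip (e n) g = \sum_(n < m) ip f (s n) * ip (A (e n)) h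
   - (\sum_(n < m) ip f (s n) * ip (e n) phim) * conjc (coef h 0)
   - \sum_(j < m) (\sum_(n < m) coef (e n) j * ip f (s n)) * ip (tt j) h.
  have -> : \sum_(j < m) (\sum_(n < m) coef (e n) j * ip f (s n)) * ip (tt j) h =
      \sum_(n < m) ip f (s n) * \sum_(j < m) coef (e n) j * ip (tt j) h.
    under eq_bigr do rewrite mulr_suml.
    rewrite exchange_big /=; apply: eq_bigr => n _; rewrite mulr_sumr.
    by apply: eq_bigr => j _; ring.
  rewrite mulr_suml -!sumrB; apply: eq_bigr => n _; rewrite (gE _ (Ke n)); ring.
(* [gE] at [G n (k - l)]: everything goes into the two remainders. *)
have -> : \sum_(n < m) \sum_(l < k) coef f (k * n + l) * ip (G n (k - l)) g =
   \sum_(n < m) \sum_(l < k) coef f (k * n + l) *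
    (ip (A (G n (k - l))) h - \sum_(j < m) coef (G n (k - l)) j * ip (tt j) h) -
   (\sum_(n < m) \sum_(l < k) coef f (k * n + l) * ip (G n (k - l)) phim) * conjc (coef h 0).
  rewrite mulr_suml -sumrB; apply: eq_bigr => n _.
  rewrite mulr_suml -sumrB; apply: eq_bigr => l _; rewrite (gE _ (KG n (k - l))); ring.
have -> : \sum_(j < m) (coef (B f) j - \sum_(n < m) coef (e n) j * ip f (s n)) * ip (tt j) h =
   \sum_(j < m) coef (B f) j * ip (tt j) h -
   \sum_(j < m) (\sum_(n < m) coef (e n) j * ip f (s n)) * ip (tt j) h.
  by rewrite -sumrB; apply: eq_bigr => j _; rewrite mulrBl.
ring.
Qed.

Lemma conjf_remainder_upsilon : conjf remainder_upsilon =
  conjf (Bs phim) - \sum_(n < m) ip (e n) phim *: conjf (s n)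
  - \sum_(n < m) \sum_(l < k) (l`!%:R^-1 * ip (G n (k - l)%N) phim) *:
      conjf (iter (k * n) (SK alpha) (k0 alpha l)).
Proof.
rewrite /remainder_upsilon !conjfB !conjf_sum; congr (_ - _ - _).
- by apply: eq_bigr => n _; rewrite conjfZ conjcK.
- apply: eq_bigr => n _; rewrite conjf_sum; apply: eq_bigr => l _.
  by rewrite conjfZ conjcK.
Qed.

Section symbol.
Variables (tau : 'I_(k * m) -> cfun R) (upsilon : cfun R).

(** Brings the symbol to the form of [isU_of_shift_identity], with the remainders added to [tau] and
    [upsilon]. Its last two sums over blocks are the two parts of [remainder_tau]. *)
Lemma product_symbolE t :
  product_symbol alpha beta gamma phim phip psim psip A B tau upsilon (c t) =
  conjc ((upsilon + remainder_upsilon) (c t)) +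
  \sum_(p < k * m) p`!%:R *
    (Wstar (k * m) (tau p + remainder_tau p) (c t) * zpow (- p%:Z) (c t)).
Proof.
pose u n p := Wstar (k * m) (A (G n (k * n.+1 - p))) * @zbar R ^+ p.
pose v n p := Wstar (k * m) (\sum_(j < m) (j`!%:R^-1 * ip (G n (k * n.+1 - p)) (k0 beta j)) *: tt j)
  * @zbar R ^+ p.
have -> : product_symbol alpha beta gamma phim phip psim psip A B tau upsilon =
    conjf upsilon + conjf remainder_upsilon +
    (\sum_(p < k * m) p`!%:R *: (Wstar (k * m) (tau p) * @zbar R ^+ p) +
     \sum_(p < k * m) u (p %/ k)%N p - \sum_(p < k * m) v (p %/ k)%N p).
  by rewrite -!(big_block_div m _ k0_) conjf_remainder_upsilon !addrA.
rewrite -big_split -sumrB /= [LHS]fE [X in X + _]fE fct_sumE !fE conjcD; congr (_ + _).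
apply: eq_bigr => p _; rewrite /u /v !fE zbarXE !WstarE !fE.
have p0 : p`!%:R != 0 :> R[i] by rewrite pnatr_eq0 -lt0n fact_gt0.
rewrite /remainder_tau /remainder_tau_fun !fE; set w := A _ _; set w' := (\sum_(j < m) _) _.
by field.
Qed.

Hypotheses (Kt' : forall p, Ksp gamma (tau p)) (Ku : Ksp alpha upsilon).

Let km0 : (0 < k * m)%N. Proof. by rewrite muln_gt0 k0_. Qed.

Let KtD (p : 'I_(k * m)) : Ksp gamma (tau p + remainder_tau p).
Proof. exact: (KA ig (Kt' p) (K_remainder_tau p)). Qed.

Let KuD : Ksp alpha (upsilon + remainder_upsilon).
Proof. exact: (KA ia Ku K_remainder_upsilon). Qed.

Lemma L2_product_symbol :
  L2 (product_symbol alpha beta gamma phim phip psim psip A B tau upsilon).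
Proof.
apply: (@L2_eqc _ (conjf (upsilon + remainder_upsilon) + \sum_(p < k * m) p`!%:R *:
    (zpow (- p%:Z) * Wstar (k * m) (tau p + remainder_tau p)))).
  move=> t; rewrite product_symbolE !fE fct_sumE; congr (_ + _).
  by apply: eq_bigr => p _; rewrite !fE [zpow _ _ * _]mulrC.
apply: (L2D (L2_conj (K_L2 KuD))); apply: L2_sum => p _.
by apply: L2Z; apply: L2_zpowM; exact: (L2_Wstar km0 (K_L2 (KtD p))).
Qed.

Lemma ip_product_rhs f h : Ksp alpha f -> Ksp gamma h ->
  ip (product_rhs alpha gamma tau upsilon f) h = ip f upsilon * conjc (coef h 0) +
    \sum_(p < k * m) p`!%:R * coef f p * ip (tau p) h.
Proof.
move=> Kf Kh; have Lh := K_L2 Kh; have Kk := K_k0 ig 0.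
have LT p : L2 (tau p) := K_L2 (Kt' p).
have -> : product_rhs alpha gamma tau upsilon f =
    ip f upsilon *: k0 gamma 0 + \sum_(p < k * m) ip f (k0 alpha p) *: tau p.
  by rewrite -[LHS]/(_ + (\sum_(p < k * m) _) f) fct_sumE.
rewrite (ipDl (L2Z _ (K_L2 Kk)) _ Lh); last by apply: L2_sum => p _; exact: L2Z.
rewrite (ipZl _ (K_L2 Kk) Lh) (ipC Lh (K_L2 Kk)) (ip_k0 ig 0 Kh) fact0 mul1r; congr (_ + _).
rewrite ip_suml; [|by move=> p _; exact: L2Z|by []].
by apply: eq_bigr => p _; rewrite (ipZl _ (LT p) Lh) (ip_k0 ia p Kf).
Qed.

Lemma K_product_rhs f : Ksp gamma (product_rhs alpha gamma tau upsilon f).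
Proof.
rewrite -[product_rhs _ _ _ _ _]/(_ *: _ + (\sum_(p < k * m) _) f) fct_sumE.
apply: (KD ig); first exact: K_k0.
by apply: (K_sum ig) => p _; exact: (KZ ig).
Qed.

(** Under the identity, [shift_identity_product] is the equation of order [k * m] with data
    [tau p + remainder_tau p] and [upsilon + remainder_upsilon]. *)
Lemma isU_product : (forall f, Ksp alpha f -> lhs f =T product_rhs alpha gamma tau upsilon f) ->
  isU (k * m) alpha gamma
    (product_symbol alpha beta gamma phim phip psim psip A B tau upsilon) (A \o B).
Proof.
move=> lhs_rhs.
apply: (@isU_of_shift_identity _ _ _ _ _ _ (fun p => tau p + remainder_tau p)
  (upsilon + remainder_upsilon) km0 ia ig (bounded_comp ib ig bA bB ia) KuD KtD
  L2_product_symbol product_symbolE).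
move=> f h Kf Kh /=; have Lf := K_L2 Kf; have Lh := K_L2 Kh.
rewrite (shift_identity_product Kf Kh).
rewrite (ip_eqTl (K_L2 (K_product_lhs f)) (K_L2 (K_product_rhs f)) Lh (lhs_rhs f Kf)).
rewrite (ip_product_rhs Kf Kh) (ipDr Lf (K_L2 Ku) (K_L2 K_remainder_upsilon)).
have -> : \sum_(p < k * m) p`!%:R * coef f p * ip (tau p + remainder_tau p) h =
    \sum_(p < k * m) p`!%:R * coef f p * ip (tau p) h +
    \sum_(p < k * m) p`!%:R * coef f p * ip (remainder_tau p) h.
  rewrite -big_split; apply: eq_bigr => p _ /=.
  by rewrite (ipDl (K_L2 (Kt' p)) (K_L2 (K_remainder_tau p)) Lh) mulrDr.
ring.
Qed.

End symbol.

Lemma identity_of_isU phi : isU (k * m) alpha gamma phi (A \o B) ->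
  exists (tau : 'I_(k * m) -> cfun R) (upsilon : cfun R),
    [/\ forall p, Ksp gamma (tau p), Ksp alpha upsilon &
        forall f, Ksp alpha f -> lhs f =T product_rhs alpha gamma tau upsilon f].
Proof.
move=> UAB; have km0 : (0 < k * m)%N by rewrite muln_gt0 k0_.
have Lphi : L2 phi by case: UAB.
pose r p := SK gamma (PK gamma (W (k * m) (@zbar R ^+ (k * m - p) * phi))).
have Kr p : Ksp gamma (r p).
  by apply: (K_SK ig); apply: K_L2 (K_PK ig (L2_W km0 _)); exact: L2_zbarX.
(* The symbol gives [A \o B] the equation with data [p!^-1 r p] and [PK alpha (conjf phi)]; after
   subtraction of the remainders these are the data of [product_lhs]. *)
pose tau (p : 'I_(k * m)) := p`!%:R^-1 *: r p - remainder_tau p.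
pose upsilon := PK alpha (conjf phi) - remainder_upsilon.
have KP := K_PK ia (L2_conj Lphi).
have Kt' p : Ksp gamma (tau p) by apply: (KB ig (KZ ig _ (Kr p))); exact: K_remainder_tau.
have Ku : Ksp alpha upsilon by apply: (KB ia KP); exact: K_remainder_upsilon.
exists tau, upsilon; split => // f Kf; apply: (K_eqT ig (K_product_lhs f)).
  exact: K_product_rhs.
move=> h Kh; have Lh := K_L2 Kh; rewrite (ip_product_rhs _ Kt' Kf Kh).
have := shift_identity_PK km0 ia ig UAB Kf Kh; rewrite /= (shift_identity_product Kf Kh).
rewrite (ipBr (K_L2 Kf) (K_L2 KP) (K_L2 K_remainder_upsilon)).
have -> : \sum_(p < k * m) p`!%:R * coef f p * ip (tau p) h =
    \sum_(p < k * m) coef f p * ip (r p) h -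
    \sum_(p < k * m) p`!%:R * coef f p * ip (remainder_tau p) h.
  rewrite -sumrB; apply: eq_bigr => p _.
  have p0 : p`!%:R != 0 :> R[i] by rewrite pnatr_eq0 -lt0n fact_gt0.
  rewrite (ipBl (K_L2 (KZ ig _ (Kr p))) (K_L2 (K_remainder_tau p)) Lh).
  by rewrite (ipZl _ (K_L2 (Kr p)) Lh); field.
move=> E; set S := \sum_(p < k * m) coef f p * _ in E *.
have -> : S = ip (lhs f) h + ip f remainder_upsilon * conjc (coef h 0) +
  \sum_(p < k * m) p`!%:R * coef f p * ip (remainder_tau p) h -
  ip f (PK alpha (conjf phi)) * conjc (coef h 0) by rewrite E; ring.
ring.
Qed.

End product.
End main.

Theorem theorem5p1 (R : realType) (alpha beta gamma : cfun R) (k m : nat)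
    (phim phip psim psip : cfun R) (A B : cop R)
    (inner_alpha : inner alpha) (inner_beta : inner beta)
    (inner_gamma : inner gamma)
    (nc_alpha : nonconstant alpha) (nc_beta : nonconstant beta)
    (nc_gamma : nonconstant gamma)
    (k_gt0 : (0 < k)%N) (m_gt0 : (0 < m)%N)
    (k_le_dim : dim_geq (Ksp alpha) k) (m_le_dim : dim_geq (Ksp beta) m)
    (phimK : Ksp beta phim) (phipK : zK (Wstar m gamma) phip)
    (AE : isU m beta gamma (conjf phim + phip) A)
    (psimK : Ksp alpha psim) (psipK : zK (Wstar k beta) psip)
    (BE : isU k alpha beta (conjf psim + psip) B) :
  let identity (tau : 'I_(k * m) -> cfun R) (upsilon : cfun R) :=
    forall h, Ksp alpha h ->
      product_lhs alpha beta gamma k m phip psim A B h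
        =T product_rhs alpha gamma tau upsilon h in
  (Scal (k * m) alpha gamma (A \o B) <->
   exists (tau : 'I_(k * m) -> cfun R) (upsilon : cfun R),
     [/\ forall p, Ksp gamma (tau p), Ksp alpha upsilon & identity tau upsilon])
  /\
  (forall (tau : 'I_(k * m) -> cfun R) (upsilon : cfun R),
     (forall p, Ksp gamma (tau p)) -> Ksp alpha upsilon -> identity tau upsilon ->
     isU (k * m) alpha gamma
       (product_symbol alpha beta gamma phim phip psim psip A B tau upsilon)
       (A \o B)).
Proof.
move=> identity; split; last first.
  move=> tau upsilon Kt Ku E.
  exact: (isU_product inner_alpha inner_beta inner_gamma k_gt0 m_gt0 phimK phipK AE psimK psipK BE Kt Ku E).
split => [[phi UAB]|[tau [upsilon [Kt Ku E]]]].
  exact: (identity_of_isU inner_alpha inner_beta inner_gamma k_gt0 m_gt0 phimK phipK AE psimK psipK BE UAB).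
eexists.
exact: (isU_product inner_alpha inner_beta inner_gamma k_gt0 m_gt0 phimK phipK AE psimK psipK BE Kt Ku E).
Qed.
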